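(* 1. (Symmetric inclusion process $\mathrm{SIP}(2k)$.) Let $k>0$, $0<p<1$. (i) For all $\alpha,\beta\in\mathbb R$ the operator $$S_{\alpha,\beta}=\exp\Big(\beta\big(-K^{+}+\tfrac1p K^{-}\big)\Big)\exp\big(\mathrm i\alpha K^{0}\big)$$ extends to a unitary operator on $L^2(w_{p,k})$. Consequently the functions $(x,y)\mapsto S_{\alpha,\beta}\big(D^{\rm ch}_p(x,\cdot)\big)(y)$ are single-site self-duality functions for $\mathrm{SIP}(2k)$, and the family $\{\,y\mapsto S_{\alpha,\beta}(D^{\rm ch}_p(x,\cdot))(y)\,\}_{x\in\mathbb N}$ is orthogonal in $L^2(w_{p,k})$ with squared norms $\|D^{\rm ch}_p(x,\cdot)\|^2_{w_{p,k}}$. (ii) For $\hat\alpha=\pi$ and $\hat\beta=\sqrt p\,\operatorname{arctanh}(\sqrt p)$, $$S_{\hat\alpha,\hat\beta}\big(D^{\rm ch}_p(x,\cdot)\big)(y)=(p-1)^k\,M(x,y;p),\qquad x,y\in\mathbb N .$$ 2. (Symmetric exclusion process $\mathrm{SEP}(2j)$.) Let $2j\in\{1,2,\dots\}$, $0<p<1$. (i) For all $\alpha,\beta\in\mathbb R$ the operator $$S_{\alpha,\beta}=\exp\Big(\beta\big(-J^{+}+\tfrac{1-p}{p}J^{-}\big)\Big)\exp\big(\mathrm i\alpha J^{0}\big)$$ is unitary on $L^2(w_{p,j})$. Consequently the functions $(x,y)\mapsto S_{\alpha,\beta}(D^{\rm ch}_p(x,\cdot))(y)$ are single-site self-duality functions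 for $\mathrm{SEP}(2j)$, and the family $\{\,y\mapsto S_{\alpha,\beta}(D^{\rm ch}_p(x,\cdot))(y)\,\}_{0\le x\le 2j}$ is orthogonal in $L^2(w_{p,j})$ with squared norms $\|D^{\rm ch}_p(x,\cdot)\|^2_{w_{p,j}}$. (ii) For $\hat\alpha=\pi$ and $\hat\beta=\sqrt{\tfrac{p}{1-p}}\,\arctan\Big(\sqrt{\tfrac{p}{1-p}}\Big)$, $$S_{\hat\alpha,\hat\beta}\big(D^{\rm ch}_p(x,\cdot)\big)(y)=(p-1)^j\,K(x,y;p),\qquad x,y\in\{0,\dots,2j\}.$$ 3. (Independent random walkers $\mathrm{IRW}$.) Let $p>0$. (i) For all $\alpha,\beta\in\mathbb R$ the operator $$S_{\alpha,\beta}=\exp\big(\beta(-p\,a^{\dagger}+a)\big)\exp\big(\mathrm i\alpha\, a a^{\dagger}\big)$$ extends to a unitary operator on $L^2(w_p)$. Consequently the functions $(x,y)\mapsto S_{\alpha,\beta}(D^{\rm ch}_p(x,\cdot))(y)$ are single-site self-duality functions for $\mathrm{IRW}$, and the family $\{\,y\mapsto S_{\alpha,\beta}(D^{\rm ch}_p(x,\cdot))(y)\,\}_{x\in\mathbb N}$ is orthogonal in $L^2(w_p)$ with squared norms $\|D^{\rm ch}_p(x,\cdot)\|^2_{w_p}$. (ii) For $\hat\alpha=\pi$ and $\hat\beta=1$, $$S_{\hat\alpha,\hat\beta}\big(D^{\rm ch}_p(x,\cdot)\big)(y)=e^{-p/2}\,C(x,y;p),\qquad x,y\in\mathbb N .$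$
   Context: $\mathbb N=\{0,1,2,\dots\}$. **Processes.** Let $(V,E)$ be a finite graph. For a configuration $\mathbf x=(x_i)_{i\in V}$, $\mathbf x^{i,l}$ is obtained by moving one particle from $i$ to $l$ (terms with rate $0$ are omitted). The generators are $L=\sum_{\{i,l\}\in E}L_{i,l}$ with - $\mathrm{SIP}(2k)$, $k>0$, state space $\mathbb N^V$: $L_{i,l}f(\mathbf x)=x_i(2k+x_l)[f(\mathbf x^{i,l})-f(\mathbf x)]+x_l(2k+x_i)[f(\mathbf x^{l,i})-f(\mathbf x)]$; - $\mathrm{SEP}(2j)$, $2j\in\{1,2,\dots\}$, state space $\{0,\dots,2j\}^V$: $L_{i,l}f(\mathbf x)=x_i(2j-x_l)[f(\mathbf x^{i,l})-f(\mathbf x)]+x_l(2j-x_i)[f(\mathbf x^{l,i})-f(\mathbf x)]$; - $\mathrm{IRW}$, state space $\mathbb N^V$: $L_{i,l}f(\mathbf x)=x_i[f(\mathbf x^{i,l})-f(\mathbf x)]+x_l[f(\mathbf x^{l,i})-f(\mathbf x)]$. A (possibly complex-valued) function $d(x,y)$ of two single-site occupation numbers is a *single-site self-duality function* if, for every finite graph, $D(\mathbf x,\mathbf y)=\prod_{i\in V}d(x_i,y_i)$ satisfies $[LD(\cdot,\mathbf y)](\mathbf x)=[LD(\mathbf x,\cdot)](\mathbf y)$ for all $\mathbf x,\mathbf y$. **Algebra generators** (acting on functions $f$ of one occupation number, with $f(-1)=0$, and $f(2j+1)=0$ in the SEP case): - SIP: $(K^+f)(x)=(2k+x)f(x+1)$,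 $(K^-f)(x)=xf(x-1)$, $(K^0f)(x)=(x+k)f(x)$; - SEP: $(J^+f)(x)=(2j-x)f(x+1)$, $(J^-f)(x)=xf(x-1)$, $(J^0f)(x)=(x-j)f(x)$, $x\in\{0,\dots,2j\}$; - IRW: $(a^\dagger f)(x)=f(x+1)$, $(af)(x)=xf(x-1)$. **Weights.** $w_{p,k}(x)=\frac{\Gamma(2k+x)}{x!\,\Gamma(2k)}p^x(1-p)^{2k}$ on $\mathbb N$; $w_{p,j}(x)=\binom{2j}{x}\big(\frac{p}{1-p}\big)^x(1-p)^{2j}$ on $\{0,\dots,2j\}$; $w_p(x)=\frac{p^x}{x!}e^{-p}$ on $\mathbb N$. $L^2(w)$ is the complex Hilbert space with inner product $\langle f,g\rangle_w=\sum_x f(x)\overline{g(x)}w(x)$. **Trivial (cheap) self-duality functions.** $D^{\rm ch}_p(x,y)=\frac{y!\,\Gamma(2k)}{\Gamma(2k+y)}p^{-y}\delta_{x,y}$ (SIP); $\frac{(2j-y)!\,y!}{(2j)!}\big(\frac{1-p}{p}\big)^y\delta_{x,y}$ (SEP); $\frac{y!}{p^y}\delta_{x,y}$ (IRW). **Polynomials.** $M(x,y;p)={}_2F_1(-x,-y;2k;1-\tfrac1p)$ (Meixner), $K(x,y;p)={}_2F_1(-x,-y;-2j;\tfrac1p)$ (Krawtchouk, $x,y\in\{0,\dots,2j\}$, sum taken over $0\le m\le\min(x,y)$), $C(x,y;p)={}_2F_0(-x,-y;-;-\tfrac1p)$ (Charlier). **Exponentials.** Exponentials of diagonal operators are diagonal.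 For $A=-K^++\frac1pK^-$ (resp. $A=-pa^\dagger+a$) and finitely supported $f$, $e^{\beta A}f$ is the value at time $\beta$ of the solution $g_\beta$ of $\frac{d}{d\beta}g_\beta=Ag_\beta$, $g_0=f$ (pointwise on $\mathbb N$), for which the generating function $\sum_y g_\beta(y)\frac{\Gamma(2k+y)}{y!\Gamma(2k)}t^y$ (resp. $\sum_y g_\beta(y)\frac{t^y}{y!}$) is jointly real-analytic in $(\beta,t)$ near $\mathbb R\times\{0\}$. In the SEP case $e^{\beta A}$ is a matrix exponential. ''Extends to a unitary operator'' means that the operator, so defined on finitely supported functions (a dense subspace), extends to a unitary operator on the Hilbert space. **Branches.** In the SIP case $(p-1)^k:=e^{\mathrm i\pi k}(1-p)^k$; in the SEP case $(p-1)^j:=e^{-\mathrm i\pi j}(1-p)^j$. *)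

(* Defs.v *)
From HB Require Import structures.
From mathcomp Require Import all_boot all_order all_algebra.
From mathcomp Require Import all_classical all_reals all_analysis.
From mathcomp Require Import complex.

Set Implicit Arguments.
Unset Strict Implicit.
Unset Printing Implicit Defensive.

Import Order.TTheory GRing.Theory Num.Theory.
Import numFieldNormedType.Exports.

Local Open Scope classical_set_scope.
Local Open Scope ring_scope.
Local Open Scope complex_scope.

Section ComplexAnalysis.
Context {R : realType}.

(* The topology of [R[i]] is handled componentwise. *)
Definition clim_to (u : nat -> R[i]) (l : R[i]) : Prop :=
  ((fun n => complex.Re (u n)) @ \oo --> complex.Re l) /\
  ((fun n => complex.Im (u n)) @ \oo --> complex.Im l).

Definition clim (u : nat -> R[i]) : R[i] :=
  limn (fun n => complex.Re (u n)) +i* limn (fun n => complex.Im (u n)).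

Definition csum (u : nat -> R[i]) : R[i] := clim (series u).

Definition cexp (z : R[i]) : R[i] :=
  (expR (complex.Re z))%:C * (cos (complex.Im z) +i* sin (complex.Im z)).

(* Near [(b0, t0)], [G] is the sum of an absolutely convergent power series in
   [(b - b0, t - t0)]. *)
Definition real_analytic_at (G : R -> R -> R[i]) (b0 t0 : R) : Prop :=
  exists c : nat -> nat -> R[i],
    \forall z \near ((b0, t0) : R * R),
      (exists M : R, forall N : nat,
         \sum_(m < N) \sum_(n < N)
            Normc.normc (c m n) * `|z.1 - b0| ^+ m * `|z.2 - t0| ^+ n
         <= M) /\
      clim_to (fun N : nat => \sum_(m < N) \sum_(n < N)
                 c m n * ((z.1 - b0) ^+ m * (z.2 - t0) ^+ n)%:C)
              (G z.1 z.2).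

End ComplexAnalysis.

Section SpecialFunctions.
Context {R : realType}.

Definition Gamma (s : R) : R :=
  \int[lebesgue_measure]_(t in `]0, +oo[) (t `^ (s - 1) * expR (- t)).

Definition arctanh (x : R) : R := ln ((1 + x) / (1 - x)) / 2.

Definition rising (a : R) (m : nat) : R := \prod_(i < m) (a + i%:R).

(* The [m]-th term of the hypergeometric series with upper parameters [a] and
   lower parameters [b]. *)
Definition hyp_term (a b : seq R) (z : R) (m : nat) : R :=
  (\prod_(c <- a) rising c m) / (\prod_(c <- b) rising c m) * z ^+ m / m`!%:R.

Definition hypergeometric (a b : seq R) (z : R) : R :=
  limn (series (hyp_term a b z)).

Definition meixner (k p : R) (x y : nat) : R :=
  hypergeometric [:: - x%:R; - y%:R] [:: 2 * k] (1 - p^-1).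

Definition krawtchouk (n : nat) (p : R) (x y : nat) : R :=
  \sum_(m < (minn x y).+1) hyp_term [:: - x%:R; - y%:R] [:: - n%:R] p^-1 m.

Definition charlier (p : R) (x y : nat) : R :=
  hypergeometric [:: - x%:R; - y%:R] [::] (- p^-1).

End SpecialFunctions.

Section Processes.
Context {R : realType}.
(* A site occupation is an element of [T], with [occ] the number of particles,
   [inc] and [dec] adding and removing one particle.  When [inc] or [dec] is
   meaningless the corresponding jump has rate 0. *)
Variables (T : Type) (occ : T -> nat) (inc dec : T -> T).
(* [rate a b] is the rate at which a particle leaves a site with [a] particles
   for a neighbouring site with [b] particles. *)
Variable rate : nat -> nat -> R.

Definition move (V : finType) (x : {ffun V -> T}) (i l : V) : {ffun V -> T} :=
  [ffun v => if v == i then dec (x v) else if v == l then inc (x v) else x v].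

Definition edge_generator (V : finType) (i l : V)
    (f : {ffun V -> T} -> R[i]) (x : {ffun V -> T}) : R[i] :=
  (rate (occ (x i)) (occ (x l)))%:C * (f (move x i l) - f x) +
  (rate (occ (x l)) (occ (x i)))%:C * (f (move x l i) - f x).

(* Each unordered edge is counted once; [edge_generator] is symmetric in its
   endpoints. *)
Definition generator (V : finType) (e : rel V)
    (f : {ffun V -> T} -> R[i]) (x : {ffun V -> T}) : R[i] :=
  \sum_(i : V) \sum_(l : V | e i l && (enum_rank i < enum_rank l)%N)
    edge_generator i l f x.

Definition single_site_self_duality (d : T -> T -> R[i]) : Prop :=
  forall (V : finType) (e : rel V), symmetric e -> irreflexive e ->
  forall x y : {ffun V -> T},
    generator e (fun x' => \prod_(i : V) d (x' i) (y i)) x =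
    generator e (fun y' => \prod_(i : V) d (x i) (y' i)) y.

End Processes.

Section Dualities.
Context {R : realType}.

Definition sip_self_duality (k : R) : (nat -> nat -> R[i]) -> Prop :=
  single_site_self_duality id succn predn
    (fun a b => a%:R * (2 * k + b%:R)).

Definition irw_self_duality : (nat -> nat -> R[i]) -> Prop :=
  single_site_self_duality id succn predn (fun a _ => a%:R : R).

Definition sep_self_duality (n : nat) : ('I_n.+1 -> 'I_n.+1 -> R[i]) -> Prop :=
  single_site_self_duality (@nat_of_ord n.+1)
    (fun x : 'I_n.+1 => inord x.+1) (fun x : 'I_n.+1 => inord x.-1)
    (fun a b => a%:R * (n%:R - b%:R) : R).

End Dualities.

Section L2.
Context {R : realType}.

(* The weights used below are positive everywhere, so elements of the weighted
   L2 spaces are genuine functions and no quotient is needed. *)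
Definition L2 (w : nat -> R) : set (nat -> R[i]) :=
  [set f | cvgn (series (fun x => Normc.normc (f x) ^+ 2 * w x))].

Definition inner (w : nat -> R) (f g : nat -> R[i]) : R[i] :=
  csum (fun x => f x * conjc (g x) * (w x)%:C).

Definition finner (n : nat) (w : 'I_n.+1 -> R) (f g : 'I_n.+1 -> R[i]) : R[i] :=
  \sum_(x : 'I_n.+1) f x * conjc (g x) * (w x)%:C.

Definition unitary_on (T : Type) (H : set (T -> R[i]))
    (ip : (T -> R[i]) -> (T -> R[i]) -> R[i])
    (U : (T -> R[i]) -> (T -> R[i])) : Prop :=
  [/\ forall f, H f -> H (U f),
      forall (a : R[i]) f g, H f -> H g ->
        U (fun x => a * f x + g x) = (fun x => a * U f x + U g x),
      forall f g, H f -> H g -> ip (U f) (U g) = ip f g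
    & forall g, H g -> exists2 f, H f & U f = g].

Definition finitely_supported (f : nat -> R[i]) : Prop :=
  exists N : nat, forall x, (N <= x)%N -> f x = 0.

Definition extends_to_unitary (w : nat -> R)
    (S : (nat -> R[i]) -> (nat -> R[i])) : Prop :=
  exists2 U, unitary_on (L2 w) (inner w) U &
    forall f, finitely_supported f -> U f = S f.

End L2.

Section Exponentials.
Context {R : realType}.

(* [exp(i a A)] for a diagonal operator [A], whose [x]-th diagonal entry is
   the value at [x] of the image of the indicator function of [x]. *)
Definition exp_idiag (T : eqType) (a : R) (A : (T -> R[i]) -> (T -> R[i]))
    (f : T -> R[i]) : T -> R[i] :=
  fun x => cexp ('i * a%:C * A (fun y => (y == x)%:R) x) * f x.

(* [g] solves [dg/db = A g], [g 0 = f], pointwise on [nat], with generating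
   function [sum_y g b y * u y * t ^ y] real-analytic near [b-axis x {0}]. *)
Definition flow_solution (u : nat -> R) (A : (nat -> R[i]) -> (nat -> R[i]))
    (f : nat -> R[i]) (g : R -> nat -> R[i]) : Prop :=
  [/\ g 0 = f,
      forall (b : R) (y : nat),
        is_derive b 1 (fun s : R => complex.Re (g s y)) (complex.Re (A (g b) y)) /\
        is_derive b 1 (fun s : R => complex.Im (g s y)) (complex.Im (A (g b) y))
    & exists G : R -> R -> R[i], forall b0 : R,
        real_analytic_at G b0 0 /\
        \forall z \near ((b0, 0) : R * R),
          clim_to (series (fun y => g z.1 y * (u y * z.2 ^+ y)%:C))
                  (G z.1 z.2)].

(* The solution is unique for finitely supported [f]; the default value of
   [xget] is only reached when there is none. *)
Definition exp_flow (u : nat -> R) (b : R) (A : (nat -> R[i]) -> (nat -> R[i]))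
    (f : nat -> R[i]) : nat -> R[i] :=
  xget (fun _ _ => 0) [set g | flow_solution u A f g] b.

Definition exp_well_defined (u : nat -> R)
    (A : (nat -> R[i]) -> (nat -> R[i])) : Prop :=
  forall f, finitely_supported f -> exists! g, flow_solution u A f g.

Definition mxexp (n : nat) (M : 'M[R[i]]_n.+1) : 'M[R[i]]_n.+1 :=
  \matrix_(x, y) csum (fun m => (m`!%:R)^-1 * (M ^+ m) x y).

Definition op_mx (n : nat) (A : ('I_n.+1 -> R[i]) -> ('I_n.+1 -> R[i])) :
    'M[R[i]]_n.+1 :=
  \matrix_(x, y) A (fun z => (z == y)%:R) x.

Definition exp_mx (n : nat) (b : R) (A : ('I_n.+1 -> R[i]) -> ('I_n.+1 -> R[i]))
    (f : 'I_n.+1 -> R[i]) : 'I_n.+1 -> R[i] :=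
  fun x => (mxexp (b%:C *: op_mx A) *m (\col_y f y)) x ord0.

End Exponentials.

Section SIP.
Context {R : realType}.
Variables k p : R.
Implicit Type f : nat -> R[i].

Definition sip_Kp f (x : nat) : R[i] := (2 * k + x%:R)%:C * f x.+1.
Definition sip_Km f (x : nat) : R[i] := if x is x'.+1 then x%:R * f x' else 0.
Definition sip_K0 f (x : nat) : R[i] := (x%:R + k)%:C * f x.

Definition sip_w (x : nat) : R :=
  Gamma (2 * k + x%:R) / (x`!%:R * Gamma (2 * k)) *
  p ^+ x * (1 - p) `^ (2 * k).

Definition sip_Dch (x y : nat) : R[i] :=
  (y`!%:R * Gamma (2 * k) / Gamma (2 * k + y%:R) * p ^- y)%:C * (x == y)%:R.

Definition sip_gf (y : nat) : R :=
  Gamma (2 * k + y%:R) / (y`!%:R * Gamma (2 * k)).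

Definition sip_A f (x : nat) : R[i] := - sip_Kp f x + (p^-1)%:C * sip_Km f x.

Definition sip_S (a b : R) f : nat -> R[i] :=
  exp_flow sip_gf b sip_A (exp_idiag a sip_K0 f).

(* The branch [(p - 1) ^ k = e ^ (i pi k) (1 - p) ^ k]. *)
Definition sip_phase : R[i] := cexp ('i * (pi * k)%:C) * ((1 - p) `^ k)%:C.

End SIP.

(* [n] is [2j]. *)
Section SEP.
Context {R : realType}.
Variables (n : nat) (p : R).
Implicit Types (f : 'I_n.+1 -> R[i]) (x y : 'I_n.+1).

Let j : R := n%:R / 2.

Definition sep_Jp f x : R[i] :=
  (n%:R - x%:R) * (if (x < n)%N then f (inord x.+1) else 0).
Definition sep_Jm f x : R[i] :=
  x%:R * (if (0 < x)%N then f (inord x.-1) else 0).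
Definition sep_J0 f x : R[i] := (x%:R - j)%:C * f x.

Definition sep_w x : R := 'C(n, x)%:R * (p / (1 - p)) ^+ x * (1 - p) ^+ n.

Definition sep_Dch x y : R[i] :=
  ((n - y)`!%:R * y`!%:R / n`!%:R * ((1 - p) / p) ^+ y)%:C * (x == y)%:R.

Definition sep_A f x : R[i] := - sep_Jp f x + ((1 - p) / p)%:C * sep_Jm f x.

Definition sep_S (a b : R) f : 'I_n.+1 -> R[i] :=
  exp_mx b sep_A (exp_idiag a sep_J0 f).

(* The branch [(p - 1) ^ j = e ^ (- i pi j) (1 - p) ^ j]. *)
Definition sep_phase : R[i] := cexp (- 'i * (pi * j)%:C) * ((1 - p) `^ j)%:C.

End SEP.

Section IRW.
Context {R : realType}.
Variable p : R.
Implicit Type f : nat -> R[i].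

Definition irw_ad f (x : nat) : R[i] := f x.+1.
Definition irw_a f (x : nat) : R[i] := if x is x'.+1 then x%:R * f x' else 0.

Definition irw_w (x : nat) : R := p ^+ x / x`!%:R * expR (- p).

Definition irw_Dch (x y : nat) : R[i] := (y`!%:R / p ^+ y)%:C * (x == y)%:R.

Definition irw_gf (y : nat) : R := (y`!%:R)^-1.

Definition irw_A f (x : nat) : R[i] := - p%:C * irw_ad f x + irw_a f x.

Definition irw_S (a b : R) f : nat -> R[i] :=
  exp_flow irw_gf b irw_A (exp_idiag a (fun h => irw_a (irw_ad h)) f).

End IRW.

(* Main.v *)
(* All three generators have the form
   [A f y = - (lam + sig y) f (y + 1) + c y f (y - 1)], with [sig = 1], [-1], [0]
   for SIP, SEP and IRW, and [A] is antisymmetric for the reversible weight [W].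
   The algebra generated by the raising and lowering operators integrates to a
   group, and the matrix coefficients of a group element in Gauss coordinates
   [(tau, rho, nb)] are explicit finite sums [ker].  Such a sum solves the flow
   of [A] when [tau] solves the Riccati equation [tau' = c - sig tau ^ 2]: [tanh]
   for SIP, [tan] for SEP, the identity for IRW.  At [tau = 1] it is a
   terminating hypergeometric sum.  It is a self-duality function because the
   two-site generator commutes with the diagonal action of the algebra.  The
   antisymmetry of [A] makes its rows orthogonal with squared norms [1 / W], and
   its columns are the rows at time [- b]; hence the operator with this kernel
   is unitary.  In the SEP case [tan] has poles, so unitarity and duality are
   derived, at all times, from the equation of the matrix exponential: two
   solutions which agree at time 0 coincide since the energy of their difference
   is conserved. *)

(* For SIP and IRW the equation [g' = A g] alone does not determine the exponential: since [A f y]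
   involves [f (y + 1)], one may prescribe [g b 0] as a nonzero smooth function that is flat at time
   0 and solve successively for the other coordinates. Uniqueness rests on the analyticity of the
   generating function. If the difference of two solutions vanishes at some time, the equation makes
   it flat there to every order; an analytic flat function vanishes nearby, and connectedness of the
   line concludes. In return, the kernel must be shown to be analytic. This works because [m]
   applications of [A] cost a factor [m!] up to geometric factors. Antisymmetry is only formal on an
   infinite state space: truncation at [N] leaves a boundary flux. It dies out because
   [sig * tau ^ 2] stays strictly below [c] on bounded time intervals, so that the rows decay
   geometrically in the weighted norm. At [tau = 1] the coordinate [nb] becomes the constant in
   front of the polynomial, and the sign [(-1) ^ x] of the kernel is cancelled by the phase at angle
   [pi]. *)
Require Import Defs.
From HB Require Import structures.
From mathcomp Require Import all_boot all_order all_algebra.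
From mathcomp Require Import all_classical all_reals all_analysis.
From mathcomp Require Import complex.
From mathcomp Require Import measurable_realfun.
From mathcomp Require Import ring lra.

Set Implicit Arguments.
Unset Strict Implicit.
Unset Printing Implicit Defensive.

Import Order.TTheory GRing.Theory Num.Theory.
Import numFieldNormedType.Exports.

Local Open Scope classical_set_scope.
Local Open Scope ring_scope.
Local Open Scope complex_scope.

(** * Real analysis *)

Section RealDerivatives.
Context {R : realType}.
Implicit Types (f g : R -> R) (x a b : R).

Lemma is_derive_eq f x a b : is_derive x 1 f a -> a = b -> is_derive x 1 f b.
Proof. by move=> + <-. Qed.

Lemma is_derive1_cst (c x : R) : is_derive x 1 (fun=> c) 0.
Proof. exact: is_derive_cst. Qed.

Lemma is_derive1_id x : is_derive x 1 (fun y : R => y) 1.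
Proof. exact: is_derive_id. Qed.

Lemma is_derive1_add f g x a b : is_derive x 1 f a -> is_derive x 1 g b ->
  is_derive x 1 (fun y => f y + g y) (a + b).
Proof. by move=> df dg; exact: is_deriveD. Qed.

Lemma is_derive1_opp f x a : is_derive x 1 f a ->
  is_derive x 1 (fun y => - f y) (- a).
Proof. by move=> df; exact: is_deriveN. Qed.

Lemma is_derive1_mul f g x a b : is_derive x 1 f a -> is_derive x 1 g b ->
  is_derive x 1 (fun y => f y * g y) (a * g x + f x * b).
Proof.
move=> df dg; apply: is_derive_eq (is_deriveM df dg) _.
by rewrite addrC /GRing.scale/= (mulrC a).
Qed.

Lemma is_derive1_cmul (c : R) f x a : is_derive x 1 f a ->
  is_derive x 1 (fun y => c * f y) (c * a).
Proof.
move=> df; apply: is_derive_eq (is_derive1_mul (is_derive1_cst c x) df) _.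
by rewrite mul0r add0r.
Qed.

Lemma is_derive1_exprn f x a n : is_derive x 1 f a ->
  is_derive x 1 (fun y => f y ^+ n) (n%:R * f x ^+ n.-1 * a).
Proof.
move=> df; elim: n => [|n IH].
  by rewrite !mul0r; exact: is_derive1_cst.
rewrite (_ : (fun y => f y ^+ n.+1) = (fun y => f y * f y ^+ n)); last first.
  by apply/funext => y; rewrite exprS.
apply: is_derive_eq (is_derive1_mul df IH) _.
case: n {IH} => [|n] /=; first by rewrite expr0; ring.
by rewrite -[in RHS]natr1 exprS; ring.
Qed.

Lemma is_derive1_compose f g x a b :
  is_derive (g x) 1 f a -> is_derive x 1 g b ->
  is_derive x 1 (fun y => f (g y)) (a * b).
Proof. by move=> df dg; exact: is_derive1_comp. Qed.

Lemma is_derive1_sum (I : Type) (r : seq I) (P : pred I) (h : I -> R -> R)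
    (dh : I -> R) x :
  (forall i, is_derive x 1 (h i) (dh i)) ->
  is_derive x 1 (fun y => \sum_(i <- r | P i) h i y) (\sum_(i <- r | P i) dh i).
Proof.
move=> H; elim: r => [|i r IH].
  rewrite big_nil (_ : (fun _ => _) = fun=> 0); first exact: is_derive1_cst.
  by apply/funext => y; rewrite big_nil.
rewrite big_cons (_ : (fun _ => _) = fun y =>
    if P i then h i y + \sum_(j <- r | P j) h j y
    else \sum_(j <- r | P j) h j y); last first.
  by apply/funext => y; rewrite big_cons.
by case: (P i) => //; exact: is_derive1_add.
Qed.

Lemma is_derive1_cvg f x a : is_derive x 1 f a -> {for x, continuous f}.
Proof.
move=> df; apply: differentiable_continuous; apply/derivable1_diffP.
exact: ex_derive.
Qed.

(** Both [B + f] and [B - f] have nonnegative derivatives, hence are nondecreasing. The majorant [B]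
    varies because the Taylor estimate integrates it. *)
Lemma ler_derive_bound f (df B dB : R -> R) (b0 b : R) : b0 <= b ->
  (forall y, b0 <= y <= b -> is_derive y 1 f (df y)) ->
  (forall y, b0 <= y <= b -> is_derive y 1 B (dB y)) ->
  (forall y, b0 <= y <= b -> `|df y| <= dB y) ->
  `|f b - f b0| <= B b - B b0.
Proof.
have main (h dh : R -> R) : b0 <= b ->
    (forall y, b0 <= y <= b -> is_derive y 1 h (dh y)) ->
    (forall y, b0 <= y <= b -> 0 <= dh y) -> h b0 <= h b.
  rewrite le_eqVlt => /predU1P[->//|lt_b] dh' h0.
  have h1 y : y \in `]b0, b[ -> is_derive y 1 h (dh y).
    by rewrite in_itv/= => /andP[y1 y2]; apply: dh'; rewrite !ltW.
  have h2 : {within `[b0, b], continuous h}.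
    apply: derivable_within_continuous => z; rewrite in_itv/= => /dh' ?.
    exact: ex_derive.
  have [z] := MVT lt_b h1 h2.
  rewrite in_itv/= => /andP[z1 z2] e; rewrite -subr_ge0 e mulr_ge0//.
    by apply: h0; rewrite !ltW.
  by rewrite subr_ge0 ltW.
move=> le_b df' dB' dfB; rewrite ler_norml; apply/andP; split.
  have := main (fun y => B y + f y) (fun y => dB y + df y) le_b
    (fun y hy => is_derive1_add (dB' y hy) (df' y hy)).
  suff: forall y, b0 <= y <= b -> 0 <= dB y + df y by move=> h /(_ h); lra.
  by move=> y /dfB; rewrite ler_norml; lra.
have := main (fun y => B y + - f y) (fun y => dB y + - df y) le_b
  (fun y hy => is_derive1_add (dB' y hy) (is_derive1_opp (df' y hy))).
suff: forall y, b0 <= y <= b -> 0 <= dB y - df y by move=> h /(_ h); lra.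
by move=> y /dfB; rewrite ler_norml; lra.
Qed.

End RealDerivatives.

(** * Positivity and functional equation of the Gamma function *)

Section GammaFunction.
Context {R : realType}.
Implicit Types s t : R.
Local Notation mu := (@lebesgue_measure R).

Let gamma_dens s t : R := t `^ (s - 1) * expR (- t).
(** Compact intervals exhausting the half-line, on which the fundamental theorem of calculus
    applies. *)
Let A (n : nat) : set R := `[n.+1%:R^-1, n.+2%:R]%classic.

Let A_gt0 n t : A n t -> 0 < t.
Proof.
by rewrite /A/= in_itv/= => /andP[h _]; apply: lt_le_trans h; rewrite invr_gt0.
Qed.

Let dens_ge0 s t : 0 <= gamma_dens s t.
Proof. by rewrite mulr_ge0 ?powR_ge0 ?expR_ge0. Qed.

Let dens_cont s : {in `]0, +oo[, continuous (gamma_dens s)}.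
Proof.
move=> t t0.
apply: differentiable_continuous; apply/derivable1_diffP.
apply: derivableM; first exact: derivable_powR.
by apply: diff_derivable; apply: differentiable_comp; exact/derivable1_diffP.
Qed.

Let within_cont (f : R -> R) n : {in `]0, +oo[, continuous f} ->
  {within A n, continuous f}.
Proof.
move=> cf; apply: continuous_in_subspaceT => t.
by rewrite inE => /A_gt0 t0; apply: cf; rewrite in_itv/= t0.
Qed.

Let A_lt n : (n.+1%:R^-1 : R) < n.+2%:R.
Proof.
apply: (@le_lt_trans _ _ 1); last by rewrite ltr1n.
by rewrite invf_le1// ler1n.
Qed.

(** Half of the exponential absorbs the power: for [t > 1], one term of the exponential series at
    [t / 2] dominates [t ^ m.+1]. *)
Let dens_le s : 0 <= s -> exists2 C : R, 0 < C & forall t, 0 < t ->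
  t `^ s * expR (- t) <= C * expR (- (t / 2)).
Proof.
move=> s0; have [m sm] : exists m : nat, s <= m.+1%:R.
  exists (Num.Def.truncn `|s|); apply: (le_trans (ler_norm _)).
  exact/ltW/truncnS_gt.
pose C : R := 1 + m.+1`!%:R * 2 ^+ m.+1.
have C1 : 1 <= C by rewrite lerDl mulr_ge0.
exists C; first by apply: lt_le_trans C1.
move=> t t0; have -> : - t = (- (t / 2)) + - (t / 2) by lra.
rewrite expRD mulrA ler_wpM2r ?expR_ge0//.
rewrite expRN ler_pdivrMr ?expR_gt0//.
have e1 : 1 <= expR (t / 2) by apply: le_trans (expR_ge1Dx _); lra.
have [t1|t1] := leP t 1.
  apply: (@le_trans _ _ 1).
    have -> : 1 = 1 `^ s :> R by rewrite powR1.
    by apply: ge0_ler_powR; rewrite // nnegrE// ltW.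
  by rewrite (le_trans e1)// ler_peMl// expR_ge0.
apply: (@le_trans _ _ (t ^+ m.+1)).
  by rewrite -powR_mulrn; [apply: ler_powR => //|]; exact: ltW.
have := @expR_ge1Dxn R (t / 2) m (ltac:(lra)).
have f0 : 0 < (m.+1`!%:R : R) by rewrite ltr0n fact_gt0.
rewrite expr_div_n => h.
have : t ^+ m.+1 / 2 ^+ m.+1 / m.+1`!%:R <= expR (t / 2) by lra.
rewrite ler_pdivrMr// ler_pdivrMr ?exprn_gt0// => /le_trans; apply.
rewrite -mulrA mulrC ler_wpM2r ?expR_ge0// /C; lra.
Qed.

(** Antiderivative of [s * gamma_dens s - gamma_dens (s + 1)], hence the boundary term of the
    integration by parts. *)
Let F s t : R := t `^ s * expR (- t).

Let F_cvg0 s : 0 < s -> (fun n => F s (n.+1%:R^-1)) @ \oo --> 0.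
Proof.
move=> s0; have := @powR_cvg0 R _ s0.
move=> /(@cvg_at_rightP R _ _ _).1 /(_ (fun n => n.+1%:R^-1)).
have h1 : forall n, 0 < (n.+1%:R^-1 : R) by move=> n; rewrite invr_gt0.
have h2 : ((n.+1%:R^-1 : R) @[n --> \oo] --> 0) by exact: cvg_harmonic.
move=> /(_ (conj h1 h2)) h.
apply: (squeeze_cvgr _ (cvg_cst 0) h).
apply: nearW => n.
by rewrite mulr_ge0 ?powR_ge0 ?expR_ge0//= ler_piMr ?powR_ge0// expR_le1 oppr_le0.
Qed.

Let F_cvgy s : 0 < s -> (fun n => F s (n.+2%:R)) @ \oo --> 0.
Proof.
move=> s0; have [C C0 hC] := dens_le (ltW s0).
have h : (fun n => C * expR (- (n.+2%:R / 2) : R)) @ \oo --> 0.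
  rewrite -(mulr0 C); apply: cvgMr.
  have h1 : (fun n => expR (- 1 : R) * (expR (- 2^-1) ^+ n)) @ \oo --> 0.
    rewrite -(mulr0 (expR (-1))); apply: cvgMr; apply: cvg_expr.
    by rewrite ger0_norm ?expR_ge0// expR_lt1; lra.
  apply: cvg_trans h1; apply: near_eq_cvg; apply: nearW => n.
  rewrite -expRM_natl -expRD; congr expR.
  have -> : n.+2%:R = n%:R + 2 :> R by rewrite -natrD addn2.
  lra.
apply: (squeeze_cvgr _ (cvg_cst 0) h).
apply: nearW => n; rewrite mulr_ge0 ?powR_ge0 ?expR_ge0//=; exact: hC.
Qed.


Let J s n := (\int[mu]_(t in A n) (gamma_dens s t)%:E)%E.

Let J_fin s n : J s n \is a fin_num.
Proof.
apply: integrable_fin_num => //; first exact: measurable_itv.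
apply: continuous_compact_integrable; first exact: segment_compact.
exact/within_cont/dens_cont.
Qed.

Let J_parts s n : 0 < s ->
  (s%:E * J s n = J (s + 1) n + (F s n.+2%:R - F s n.+1%:R^-1)%:E)%E.
Proof.
move=> s0.
have Fd t : 0 < t -> is_derive t 1 (F s) (s * gamma_dens s t - gamma_dens (s + 1) t).
  move=> t0.
  have h1 : is_derive t 1 (fun t => expR (- t)) (expR (- t) * - 1).
    exact: (@is_derive1_compose R expR (fun t => - t)).
  have h2 := is_derive1_powR s t0.
  apply: is_derive_eq (is_derive1_mul h2 h1) _.
  by rewrite /gamma_dens addrK; ring.
have subA : {subset A n <= `]0, +oo[%classic}.
  by move=> t; rewrite !inE => /A_gt0 t0; rewrite /= in_itv/= t0.
have cF : {within A n, continuous F s}.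
  apply: within_cont => t; rewrite in_itv/= andbT => t0.
  exact: is_derive1_cvg (Fd t t0).
have cf r : {within A n, continuous gamma_dens r} by apply: within_cont.
have cd : {within A n, continuous (fun t => s * gamma_dens s t - gamma_dens (s + 1) t)}.
  apply: within_cont => t t0; apply: cvgB; last exact: dens_cont.
  by apply: cvgMr; exact: dens_cont.
have ioo t : t \in `]n.+1%:R^-1, n.+2%:R[ -> 0 < t.
  by rewrite in_itv/= => /andP[h _]; apply: le_lt_trans h; rewrite invr_ge0.
have := @continuous_FTC2 R _ (F s) _ _ (A_lt n) cd.
have FLR : derivable_oo_LRcontinuous (F s) n.+1%:R^-1 n.+2%:R.
  have [_ h1 h2] := (continuous_within_itvP (F s) (A_lt n)).1 cF.
  by split => // t /ioo t0; have := Fd _ t0 => ?; exact: ex_derive.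
move=> /(_ FLR) h.
have {}h : (\int[mu]_(x in A n) (s * gamma_dens s x - gamma_dens (s + 1) x)%:E =
    (F s n.+2%:R)%:E - (F s n.+1%:R^-1)%:E)%E.
  apply: h => t tn; rewrite derive1E.
  by have [_ ->] := Fd _ (ioo _ tn).
have intf r : mu.-integrable (A n) (EFin \o gamma_dens r).
  by apply: continuous_compact_integrable; [exact: segment_compact|exact: cf].
move: h; under eq_integral do rewrite EFinB EFinM.
have mA : measurable (A n) by exact: measurable_itv.
rewrite integralB//=; [|by apply: integrableZl => //; exact: intf|exact: intf].
rewrite integralZl//; last exact: intf.
move=> h; rewrite EFinB -h -/(J s n) -/(J (s + 1) n).
by rewrite addeC subeK.
Qed.


Let I s := (\int[mu]_(t in `]0%R, +oo[) (gamma_dens s t)%:E)%E.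

Let meas_dens s : measurable_fun `](0 : R), +oo[ (gamma_dens s).
Proof.
by apply: open_continuous_measurable_fun => // t; rewrite inE => /dens_cont; exact.
Qed.

Let J_cvg s : J s n @[n --> \oo] --> I s.
Proof.
have -> : I s = (\int[mu]_(t in \bigcup_n A n) (gamma_dens s t)%:E)%E.
  congr (integral _ _ _); apply/seteqP; split => t.
    rewrite /= in_itv/= andbT => t0.
    exists (Num.Def.truncn (t + t^-1)) => //; rewrite /A/= in_itv/=.
    have := truncnS_gt (t + t^-1); set n := Num.Def.truncn _.
    have ti : 0 < t^-1 by rewrite invr_gt0.
    move=> h; have h1 : t^-1 <= n.+1%:R by lra.
    have h2 : t <= n.+2%:R by rewrite -natr1; lra.
    by rewrite h2 andbT -[leRHS]invrK lef_pV2 ?posrE.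
  by move=> [n _ /A_gt0 t0]; rewrite /= in_itv/= t0.
apply: ge0_nondecreasing_set_cvg_integral.
- apply/nondecreasing_seqP => n; apply/subsetPset => t; rewrite /A/= !in_itv/=.
  move=> /andP[h1 h2]; apply/andP; split.
    by apply: le_trans h1; rewrite lef_pV2 ?posrE// ler_nat.
  by apply: (le_trans h2); rewrite ler_nat.
- by move=> n; exact: measurable_itv.
- move=> n; apply/measurable_EFinP.
  apply: (measurable_funS _ _ (meas_dens s)) => // t /A_gt0.
  by rewrite /= in_itv/= andbT.
- by move=> n t _; rewrite lee_fin.
Qed.

Let I_rec s : 0 < s -> (s%:E * I s = I (s + 1))%E.
Proof.
move=> s0; have h1 : (s%:E * J s n)%E @[n --> \oo] --> (s%:E * I s)%E.
  by apply: cvgeZl => //; exact: J_cvg.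
have h2 : (J (s + 1) n + (F s n.+2%:R - F s n.+1%:R^-1)%:E)%E @[n --> \oo] -->
    (I (s + 1) + (0 - 0)%:E)%E.
  apply: cvgeD; [by rewrite fin_num_adde_defl|exact: J_cvg|].
  by apply: cvg_EFin; [exact: nearW|apply: cvgB; [exact: F_cvgy|exact: F_cvg0]].
move: h2; rewrite subrr adde0 => h2.
rewrite -(cvg_lim _ h1)//; apply/cvg_lim => //; apply: cvg_trans h2.
by apply: near_eq_cvg; apply: nearW => n; rewrite /= J_parts.
Qed.

(** For [s >= 1] the majorant of [dens_le] has an explicit antiderivative, which bounds the
    truncated integrals uniformly. *)
Let I_fin1 s : 1 <= s -> (I s < +oo)%E.
Proof.
move=> s1; have [C C0 hC] := @dens_le (s - 1) (ltac:(lra)).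
have JC n : (J s n <= (C * 2)%:E)%E.
  pose G (t : R) : R := (- (C * 2)) * expR (- (t / 2)).
  pose g (t : R) : R := C * expR (- (t / 2)).
  have ed t : is_derive t 1 (fun t : R => expR (- (t / 2)))
      (expR (- (t / 2)) * - (1 * 2^-1 + t * 0)).
    have h : is_derive t 1 (fun t : R => - (t / 2)) (- (1 * 2^-1 + t * 0)).
      exact: is_derive1_opp (is_derive1_mul (is_derive1_id t) (is_derive1_cst _ t)).
    exact: (is_derive1_compose (is_derive_expR _) h).
  have Gd t : is_derive t 1 G (g t).
    by apply: is_derive_eq (is_derive1_cmul _ (ed t)) _; rewrite /g; lra.
  have gc : continuous g.
    by move=> t; exact: is_derive1_cvg (is_derive1_cmul C (ed t)).
  have gcn : {within A n, continuous g} by apply: continuous_subspaceT.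
  have GLR : derivable_oo_LRcontinuous G n.+1%:R^-1 n.+2%:R.
    have cG : {within A n, continuous G}.
      by apply: continuous_subspaceT => t; exact: is_derive1_cvg (Gd t).
    have [_ h1 h2] := (continuous_within_itvP G (A_lt n)).1 cG.
    by split => // t _; have := Gd t => ?; exact: ex_derive.
  have h := continuous_FTC2 (A_lt n) gcn GLR.
  apply: (@le_trans _ _ (\int[mu]_(t in A n) (g t)%:E)%E).
    apply: ge0_le_integral => //=.
    - exact: measurable_itv.
    - by move=> t _; rewrite lee_fin.
    - apply/measurable_EFinP.
      apply: (measurable_funS _ _ (meas_dens s)) => // t /A_gt0.
      by rewrite /= in_itv/= andbT.
    - apply/measurable_EFinP; apply: measurable_funTS.
      exact: continuous_measurable_fun.
    - by move=> t /A_gt0 t0; rewrite lee_fin; exact: hC.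
  rewrite h; last first.
    by move=> t _; rewrite derive1E; have [_ ->] := Gd t.
  rewrite lee_fin /G.
  have e0 := expR_ge0 (- (n.+2%:R / 2) : R).
  have e1 : expR (- (n.+1%:R^-1 / 2)) <= (1 : R).
    by rewrite expR_le1 oppr_le0 divr_ge0 ?invr_ge0.
  nra.
apply: (@le_lt_trans _ _ (C * 2)%:E); last by rewrite ltry.
have Jc := @J_cvg s; rewrite -(cvg_lim _ Jc)//.
apply: lime_le; first by apply/cvg_ex; exists (I s).
exact: nearW.
Qed.

Let I_gt0 s : 1 <= s -> (0 < I s)%E.
Proof.
move=> s1; apply: (@lt_le_trans _ _ (expR (-2))%:E); first by rewrite lte_fin expR_gt0.
apply: (@le_trans _ _ (\int[mu]_(t in `[1%R, 2%R]) (expR (-2))%:E)%E).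
  rewrite integral_cst//= lebesgue_measure_itv/= lte_fin ltr1n/=.
  by rewrite -EFinB -EFinM lee_fin; lra.
apply: (@le_trans _ _ (\int[mu]_(t in `[1%R, 2%R]) (gamma_dens s t)%:E)%E).
  apply: ge0_le_integral => //=.
  - apply/measurable_EFinP.
    apply: (measurable_funS _ _ (meas_dens s)) => // t/=.
    by rewrite /= !in_itv/= andbT; lra.
  - move=> t; rewrite in_itv/= => /andP[t1 t2]; rewrite lee_fin.
    have h1 : 1 <= t `^ (s - 1) by rewrite -[leLHS](powRr0 t) ler_powR// subr_ge0.
    have h2 : expR (- 2) <= expR (- t) by rewrite ler_expR; lra.
    by rewrite -[leLHS]mul1r /gamma_dens ler_pM ?expR_ge0.
apply: ge0_subset_integral => //=.
- by apply/measurable_EFinP; exact: meas_dens.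
- by move=> t _; rewrite lee_fin.
- by move=> t; rewrite /= !in_itv/= andbT; lra.
Qed.

(** [Gamma] is read off from an extended integral, an infinite one being read as 0. Finiteness and
    positivity, known at [s + 1 >= 1], come down to [s] through the recursion. *)
Lemma Gamma_gt0 s : 0 < s -> 0 < Gamma s.
Proof.
move=> s0; have s1 : 1 <= s + 1 by lra.
have := I_fin1 s1; have := I_gt0 s1; rewrite -I_rec// /Gamma/Rintegral -/(I s).
case: (I s) => [r| |]; rewrite ?gt0_mulNye ?gt0_muleNy// ?gt0_muley ?lte_fin//.
by rewrite pmulr_rgt0.
Qed.

Lemma GammaS s : 0 < s -> Gamma (s + 1) = s * Gamma s.
Proof.
move=> s0; rewrite /Gamma /Rintegral -/(I s) -/(I (s + 1)) -I_rec//.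
have s1 : 1 <= s + 1 by lra.
have := I_fin1 s1; have := I_gt0 s1; rewrite -I_rec//.
by case: (I s) => [r| |]; rewrite ?gt0_mulNye ?gt0_muleNy// ?gt0_muley.
Qed.

End GammaFunction.

(** * The duality kernel *)

Section Kernel.
Context {R : realType}.
Implicit Types (lam sig c tau rho nb : R) (x y m M : nat).

Lemma sum_ordS_recl M (F : nat -> R) :
  \sum_(m < M.+1) F m = F 0 + \sum_(m < M) F m.+1.
Proof. by rewrite big_ord_recl. Qed.

Definition poch lam sig m : R := \prod_(i < m) (lam + sig * i%:R).

Lemma poch0 lam sig : poch lam sig 0 = 1.
Proof. by rewrite /poch big_ord0. Qed.

Lemma pochS lam sig m : poch lam sig m.+1 = poch lam sig m * (lam + sig * m%:R).
Proof. by rewrite /poch big_ord_recr. Qed.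

(** This is [exp(tau B)] applied to the indicator of [m], for the lowering operator
    [(B f) y = y * f (y - 1)]. The lemmas below give the action of the algebra generators on this
    family. *)
Definition shift_basis tau m y : R := 'C(y, m)%:R * tau ^+ (y - m).

Lemma bas_small tau m y : (y < m)%N -> shift_basis tau m y = 0.
Proof. by move=> h; rewrite /shift_basis bin_small// mul0r. Qed.

Lemma basQ tau m y : y%:R * shift_basis tau m y.-1 = m.+1%:R * shift_basis tau m.+1 y.
Proof.
case: y => [|y]; first by rewrite mul0r bas_small// mulr0.
by rewrite /shift_basis subSS !mulrA -!natrM mul_bin_diag.
Qed.

(** Write [y = m + (y - m)] and absorb the second part into the binomial. *)
Lemma basZ tau m y :
  y%:R * shift_basis tau m y = m%:R * shift_basis tau m y + m.+1%:R * tau * shift_basis tau m.+1 y.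
Proof.
have [ym|my] := ltnP y m.
  by rewrite !bas_small ?mulr0 ?addr0// (ltn_trans ym).
have [->|ltm] := eqVneq y m; first by rewrite (@bas_small _ m.+1)// mulr0 addr0.
have my' : (m < y)%N by rewrite ltn_neqAle eq_sym ltm.
have e : (m.+1 * 'C(y, m.+1) = (y - m) * 'C(y, m))%N by rewrite mul_bin_left.
rewrite /shift_basis (_ : (y - m = (y - m.+1).+1)%N); last by rewrite subnSK.
rewrite exprS.
have -> : m.+1%:R * tau * ('C(y, m.+1)%:R * tau ^+ (y - m.+1)) =
    (m.+1 * 'C(y, m.+1))%:R * (tau * tau ^+ (y - m.+1)) :> R.
  by rewrite natrM; ring.
by rewrite e natrM natrB//; ring.
Qed.

Lemma basS0 tau y : shift_basis tau 0 y.+1 = tau * shift_basis tau 0 y.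
Proof. by rewrite /shift_basis !bin0 !subn0 exprS !mul1r. Qed.

Lemma basSS tau m y : shift_basis tau m.+1 y.+1 = tau * shift_basis tau m.+1 y + shift_basis tau m y.
Proof.
rewrite /shift_basis binS natrD mulrDl subSS; congr (_ + _).
have [ym|my] := leqP y m; first by rewrite bin_small// !(mul0r, mulr0).
rewrite (_ : (y - m = (y - m.+1).+1)%N); last by rewrite subnSK.
by rewrite exprS; ring.
Qed.

Lemma basP0 lam sig tau y :
  (lam + sig * y%:R) * shift_basis tau 0 y.+1 =
  tau * lam * shift_basis tau 0 y + sig * tau ^+ 2 * shift_basis tau 1 y.
Proof.
have h := basZ tau 0 y; rewrite basS0 mulrDl.
rewrite (_ : sig * y%:R * (tau * shift_basis tau 0 y) = sig * tau * (y%:R * shift_basis tau 0 y)); last ring.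
by rewrite h; ring.
Qed.

(** Pascal's rule [basSS], then [basZ] at [m] and at [m + 1]. Index 0, treated in [basP0], has no
    lower neighbour. *)
Lemma basPS lam sig tau m y :
  (lam + sig * y%:R) * shift_basis tau m.+1 y.+1 =
  (lam + sig * m%:R) * shift_basis tau m y +
  tau * (lam + 2 * sig * m.+1%:R) * shift_basis tau m.+1 y +
  sig * tau ^+ 2 * m.+2%:R * shift_basis tau m.+2 y.
Proof.
have := basZ tau m y; have := basZ tau m.+1 y; rewrite basSS => h1 h2.
rewrite (_ : _ * _ = lam * (tau * shift_basis tau m.+1 y + shift_basis tau m y) +
  sig * tau * (y%:R * shift_basis tau m.+1 y) + sig * (y%:R * shift_basis tau m y)); last ring.
by rewrite h1 h2; ring.
Qed.

(** Reciprocal of [wt] at [c = 1]: a trivial duality function is the diagonal middle factor of the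
    Gauss decomposition. *)
Definition ker_coef lam sig m : R := m`!%:R / poch lam sig m.

Definition kerm lam sig tau rho x y m : R :=
  ker_coef lam sig m * rho ^+ m * shift_basis (- tau) m x * shift_basis tau m y.

(* Matrix coefficients of a Gauss decomposition, with coordinates
   [(tau, rho, nb)], in the group of the algebra generated by the raising and
   lowering operators. *)
Definition ker lam sig tau rho nb x y : R :=
  nb * \sum_(m < (minn x y).+1) kerm lam sig tau rho x y m.

Lemma ker_widen lam sig tau rho nb x y M : (minn x y < M)%N ->
  ker lam sig tau rho nb x y = nb * \sum_(m < M) kerm lam sig tau rho x y m.
Proof.
move=> h; rewrite /ker; congr (_ * _).
rewrite (big_ord_widen _ (kerm lam sig tau rho x y) h) [in RHS](bigID (fun m : 'I_M => m < (minn x y).+1)%N)/=.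
rewrite [X in _ = _ + X]big1 ?addr0// => i; rewrite -leqNgt gtn_min => /orP[] h1.
  by rewrite /kerm (bas_small _ h1) mulr0 mul0r.
by rewrite /kerm (bas_small _ h1) mulr0.
Qed.

(** Through this symmetry every ladder identity in [y] yields one in [x], and the transposed kernel
    is the kernel at the opposite time. *)
Lemma ker_sym lam sig tau rho nb x y :
  ker lam sig tau rho nb x y = ker lam sig (- tau) rho nb y x.
Proof.
rewrite /ker minnC; congr (_ * _); apply: eq_bigr => m _.
by rewrite /kerm opprK; ring.
Qed.

Section Ladder.
Variables (lam sig tau rho nb : R) (x y M : nat).
Hypothesis hM : (x + y < M)%N.
(** Restricted to indices below [x] or [y], because in SEP the factor vanishes at [m = 2j]. *)
Hypothesis nz : forall m, (m < x)%N || (m < y)%N -> lam + sig * m%:R != 0.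

Let K m := ker_coef lam sig m * rho ^+ m.
Let e m := shift_basis (- tau) m x.
Let f m := shift_basis tau m y.

(** Four moments in which every ladder operation, on either argument, can be expressed. Exchanging
    the arguments and reversing [tau] swaps [kerSB] with [kerSC] and fixes the other two. *)
Definition kerS0 := nb * \sum_(m < M) K m * e m * f m.
Definition kerS1 := nb * \sum_(m < M) m%:R * K m * e m * f m.
Definition kerSB := nb * \sum_(m < M) m.+1%:R * K m * e m.+1 * f m.
Definition kerSC := nb * \sum_(m < M) m.+1%:R * K m * e m * f m.+1.

Let E := ker lam sig tau rho nb.

Let e_big m : (M <= m)%N -> e m = 0.
Proof.
move=> h; apply: bas_small; apply: leq_trans h; apply: leq_ltn_trans hM.
exact: leq_addr.
Qed.

Lemma ker_S0 : E x y = kerS0.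
Proof.
rewrite /E (@ker_widen _ _ _ _ _ _ _ M)//; apply: leq_ltn_trans hM.
by rewrite (leq_trans (geq_minl _ _))// leq_addr.
Qed.

Lemma ker_Qy : y%:R * E x y.-1 = kerSC.
Proof.
rewrite /E (@ker_widen _ _ _ _ _ _ _ M); last first.
  apply: leq_ltn_trans hM; by rewrite (leq_trans (geq_minl _ _))// leq_addr.
rewrite mulrCA /kerSC; congr (_ * _); rewrite mulr_sumr; apply: eq_bigr => m _.
rewrite /kerm (_ : y%:R * _ = ker_coef lam sig m * rho ^+ m * shift_basis (- tau) m x *
  (y%:R * shift_basis tau m y.-1)); last ring.
by rewrite basQ /K /e /f; ring.
Qed.

Lemma ker_Zy : y%:R * E x y = kerS1 + tau * kerSC.
Proof.
rewrite ker_S0 /kerS0 /kerS1 /kerSC mulrCA [X in _ + X]mulrCA -mulrDr.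
congr (_ * _); rewrite !mulr_sumr -big_split; apply: eq_bigr => m _ /=.
rewrite (_ : y%:R * _ = K m * e m * (y%:R * f m)); last ring.
by rewrite basZ /f; ring.
Qed.

Let KS m : (m < x)%N || (m < y)%N ->
  K m.+1 * (lam + sig * m%:R) = m.+1%:R * rho * K m.
Proof.
move=> h; rewrite /K /ker_coef pochS factS natrM exprS invfM.
rewrite (_ : _ * _ * _ * _ = m.+1%:R * rho * (m`!%:R / poch lam sig m * rho ^+ m) *
  ((lam + sig * m%:R)^-1 * (lam + sig * m%:R))); last by ring.
by rewrite mulVf ?mulr1// nz.
Qed.

(** The raising operator couples neighbouring indices, and [KS] trades the shift of [K] for a factor
    [rho]. Index 0 is split off because of [basP0]; the terms at the top index [M] vanish since
    [x < M]. *)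
Lemma ker_Py : (lam + sig * y%:R) * E x y.+1 =
  rho * kerSB + tau * (lam * kerS0 + 2 * sig * kerS1) + sig * tau ^+ 2 * kerSC.
Proof.
rewrite /E (@ker_widen _ _ _ _ _ _ _ M.+1); last first.
  rewrite ltnS; apply: leq_trans (ltnW hM).
  by rewrite (leq_trans (geq_minl _ _))// leq_addr.
rewrite sum_ordS_recl.
transitivity (nb * (\sum_(m < M) K m.+1 * (lam + sig * m%:R) * e m.+1 * f m +
  tau * \sum_(m < M.+1) (lam + 2 * sig * m%:R) * K m * e m * f m +
  sig * tau ^+ 2 * \sum_(m < M.+1) m.+1%:R * K m * e m * f m.+1)).
  rewrite mulrCA; congr (_ * _).
  rewrite (sum_ordS_recl _ (fun m => (lam + 2 * sig * m%:R) * K m * e m * f m)).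
  rewrite (sum_ordS_recl _ (fun m => m.+1%:R * K m * e m * f m.+1)).
  rewrite mulrDr mulr_sumr.
  rewrite [X in X + _](_ : _ = K 0 * e 0 * ((lam + sig * y%:R) * shift_basis tau 0 y.+1)); last first.
    by rewrite /kerm /K /e; ring.
  rewrite basP0.
  rewrite [X in _ + X](_ : _ = \sum_(m < M) (K m.+1 * (lam + sig * m%:R) * e m.+1 * f m +
     tau * ((lam + 2 * sig * m.+1%:R) * K m.+1 * e m.+1 * f m.+1) +
     sig * tau ^+ 2 * (m.+2%:R * K m.+1 * e m.+1 * f m.+2))); last first.
    apply: eq_bigr => m _; rewrite /kerm.
    rewrite [LHS](_ : _ = K m.+1 * e m.+1 * ((lam + sig * y%:R) * shift_basis tau m.+1 y.+1)); last first.
      by rewrite /K /e; ring.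
    by rewrite basPS /f; ring.
  by rewrite !big_split /= -!mulr_sumr /f; ring.
rewrite [X in tau * X]big_ord_recr /= e_big// [X in sig * tau ^+ 2 * X]big_ord_recr /= e_big//.
rewrite !(mulr0, mul0r, addr0).
rewrite [X in nb * (X + _ + _)](_ : _ = rho * \sum_(m < M) m.+1%:R * K m * e m.+1 * f m); last first.
  rewrite mulr_sumr; apply: eq_bigr => m _.
  have [mx|xm] := ltnP m x; first by rewrite KS ?mx//; ring.
  by rewrite /e (bas_small _ (_ : x < m.+1)%N)// !(mulr0, mul0r).
rewrite [X in tau * X](_ : _ = lam * \sum_(m < M) K m * e m * f m +
  2 * sig * \sum_(m < M) m%:R * K m * e m * f m); last first.
  by rewrite !mulr_sumr -big_split; apply: eq_bigr => m _ /=; ring.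
by rewrite /kerSB /kerS0 /kerS1 /kerSC; ring.
Qed.

End Ladder.

Lemma kerSB_sym lam sig tau rho nb x y M :
  kerSB lam sig (- tau) rho nb y x M = kerSC lam sig tau rho nb x y M.
Proof.
rewrite /kerSB /kerSC opprK; congr (_ * _); apply: eq_bigr => m _; ring.
Qed.

Lemma kerSC_sym lam sig tau rho nb x y M :
  kerSC lam sig (- tau) rho nb y x M = kerSB lam sig tau rho nb x y M.
Proof.
rewrite /kerSB /kerSC opprK; congr (_ * _); apply: eq_bigr => m _; ring.
Qed.

Lemma kerS1_sym lam sig tau rho nb x y M :
  kerS1 lam sig (- tau) rho nb y x M = kerS1 lam sig tau rho nb x y M.
Proof.
rewrite /kerS1 opprK; congr (_ * _); apply: eq_bigr => m _; ring.
Qed.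

Lemma kerS0_sym lam sig tau rho nb x y M :
  kerS0 lam sig (- tau) rho nb y x M = kerS0 lam sig tau rho nb x y M.
Proof.
rewrite /kerS0 opprK; congr (_ * _); apply: eq_bigr => m _; ring.
Qed.

Section TwoSites.
Variables (lam sig tau rho nb : R).
Let E := ker lam sig tau rho nb.

(* Both sides reduce to an expression which is symmetric under the exchange of
   [kerSB] and [kerSC]. *)
Lemma ker_two_sites x1 x2 y1 y2 :
  (forall m, (m < x1)%N || (m < y1)%N || (m < x2)%N || (m < y2)%N ->
    lam + sig * m%:R != 0) ->
  y1%:R * (lam + sig * y2%:R) *
    (E x1 y1.-1 * E x2 y2.+1 - E x1 y1 * E x2 y2) +
  y2%:R * (lam + sig * y1%:R) *
    (E x1 y1.+1 * E x2 y2.-1 - E x1 y1 * E x2 y2) =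
  x1%:R * (lam + sig * x2%:R) *
    (E x1.-1 y1 * E x2.+1 y2 - E x1 y1 * E x2 y2) +
  x2%:R * (lam + sig * x1%:R) *
    (E x1.+1 y1 * E x2.-1 y2 - E x1 y1 * E x2 y2).
Proof.
move=> nz.
have nz1 m : (m < x1)%N || (m < y1)%N -> lam + sig * m%:R != 0.
  by move=> h; rewrite nz// h.
have nz2 m : (m < x2)%N || (m < y2)%N -> lam + sig * m%:R != 0.
  by move=> h; rewrite nz// -orbA h orbT.
have Px x y M : (forall m, (m < x)%N || (m < y)%N -> lam + sig * m%:R != 0) ->
    (x + y < M)%N -> (lam + sig * x%:R) * E x.+1 y =
    rho * kerSC lam sig tau rho nb x y M
    - tau * (lam * kerS0 lam sig tau rho nb x y M
             + 2 * sig * kerS1 lam sig tau rho nb x y M)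
    + sig * tau ^+ 2 * kerSB lam sig tau rho nb x y M.
  move=> nz' h; rewrite /E ker_sym (@ker_Py _ _ _ _ _ _ _ M); first last.
  - by move=> m; rewrite orbC; exact: nz'.
  - by rewrite addnC.
  by rewrite kerSB_sym kerSC_sym kerS0_sym kerS1_sym; ring.
have Qx x y M : (x + y < M)%N -> x%:R * E x.-1 y = kerSB lam sig tau rho nb x y M.
  move=> h; rewrite /E ker_sym (@ker_Qy _ _ _ _ _ _ _ M)//; last by rewrite addnC.
  by rewrite kerSC_sym.
have Zx x y M : (x + y < M)%N -> x%:R * E x y =
    kerS1 lam sig tau rho nb x y M - tau * kerSB lam sig tau rho nb x y M.
  move=> h; rewrite /E ker_sym (@ker_Zy _ _ _ _ _ _ _ M)//; last by rewrite addnC.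
  by rewrite kerSC_sym kerS1_sym; ring.
have h1 := ltnSn (x1 + y1); have h2 := ltnSn (x2 + y2).
have S1 := ker_S0 lam sig tau rho nb h1; have S2 := ker_S0 lam sig tau rho nb h2.
have QY1 := ker_Qy lam sig tau rho nb h1; have QY2 := ker_Qy lam sig tau rho nb h2.
have ZY1 := ker_Zy lam sig tau rho nb h1; have ZY2 := ker_Zy lam sig tau rho nb h2.
have PY1 := ker_Py tau rho nb h1 nz1; have PY2 := ker_Py tau rho nb h2 nz2.
have QX1 := Qx _ _ _ h1; have QX2 := Qx _ _ _ h2.
have ZX1 := Zx _ _ _ h1; have ZX2 := Zx _ _ _ h2.
have PX1 := Px _ _ _ nz1 h1; have PX2 := Px _ _ _ nz2 h2.
rewrite -!/E in S1 S2 QY1 QY2 ZY1 ZY2 PY1 PY2.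
(* Used once for each side: it groups the factors into values of one-site ladder operations. *)
have -> : forall (u v a b a' b' e e' : R),
    u * (lam + sig * v) * (a * b' - e * e') + v * (lam + sig * u) * (b * a' - e * e')
  = (u * a) * ((lam + sig * v) * b') + ((lam + sig * u) * b) * (v * a')
    - lam * ((u * e) * e' + e * (v * e')) - 2 * sig * (u * e) * (v * e').
  by move=> *; ring.
have -> : forall (u v a b a' b' e e' : R),
    u * (lam + sig * v) * (a * b' - e * e') + v * (lam + sig * u) * (b * a' - e * e')
  = (u * a) * ((lam + sig * v) * b') + ((lam + sig * u) * b) * (v * a')
    - lam * ((u * e) * e' + e * (v * e')) - 2 * sig * (u * e) * (v * e').
  by move=> *; ring.
rewrite QY1 QY2 ZY1 ZY2 PY1 PY2 QX1 QX2 ZX1 ZX2 PX1 PX2 S1 S2; ring.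
Qed.

End TwoSites.

Section Flow.
Variables (lam sig c : R) (tau nb : R -> R).

(* [exp(b A)] applied to delta functions, when [tau' = c - sig * tau ^ 2] and
   [nb' = - lam * tau * nb]. *)
Definition flow_ker (b : R) x y : R :=
  ker lam sig (tau b) (c - sig * tau b ^+ 2) (nb b) x y.

Definition flow_op (f : nat -> R) y : R :=
  - (lam + sig * y%:R) * f y.+1 + c * y%:R * f y.-1.

(** The reversible weight: [wtS] is the balance between the two coefficients of [flow_op] that makes
    it antisymmetric. *)
Definition wt y : R := poch lam sig y / (y`!%:R * c ^+ y).

(** Termwise differentiation, with [rho' = - 2 * sig * tau * rho], produces the four moments.
    Replacing [c] by [rho + sig * tau ^ 2] in [flow_op] matches them with [ker_Py] and [ker_Qy]. *)
Lemma flow_ker_derive (b : R) x y :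
  (forall m, (m < x)%N || (m < y)%N -> lam + sig * m%:R != 0) ->
  is_derive b 1 tau (c - sig * tau b ^+ 2) ->
  is_derive b 1 nb (- lam * tau b * nb b) ->
  is_derive b 1 (fun s => flow_ker s x y) (flow_op (flow_ker b x) y).
Proof.
move=> nz dtau dnb.
have dbas m z (t : R -> R) a : is_derive b 1 t a ->
    is_derive b 1 (fun s => shift_basis (t s) m z) (m.+1%:R * a * shift_basis (t b) m.+1 z).
  move=> dt; apply: is_derive_eq (is_derive1_cmul _ (is_derive1_exprn (z - m) dt)) _.
  have [zm|mz] := leqP z m.
    rewrite (bas_small _ (_ : z < m.+1)%N)// (_ : (z - m = 0)%N) ?mul0r ?mulr0//.
    by apply/eqP; rewrite subn_eq0.
  rewrite /shift_basis -subnS.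
  have e : (m.+1 * 'C(z, m.+1) = (z - m) * 'C(z, m))%N by rewrite mul_bin_left.
  rewrite [RHS](_ : _ = a * (t b) ^+ (z - m.+1) * (m.+1 * 'C(z, m.+1))%:R).
    by rewrite e natrM; ring.
  by rewrite natrM; ring.
pose rho s := c - sig * tau s ^+ 2.
have drho : is_derive b 1 rho (- 2 * sig * tau b * rho b).
  apply: is_derive_eq (is_derive1_add (is_derive1_cst c b)
    (is_derive1_opp (is_derive1_cmul sig (is_derive1_exprn 2 dtau)))) _.
  by rewrite /rho /= expr1; ring.
have hM := ltnSn (x + y); set M := (x + y).+1 in hM.
pose K m s := ker_coef lam sig m * rho s ^+ m.
have dK m : is_derive b 1 (K m) (- 2 * sig * m%:R * tau b * K m b).
  apply: is_derive_eq (is_derive1_cmul _ (is_derive1_exprn m drho)) _.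
  rewrite /K; case: m => [|m]; first by rewrite !(mul0r, mulr0).
  by rewrite /= exprS; ring.
have dk m : is_derive b 1 (fun s => kerm lam sig (tau s) (rho s) x y m)
   (- 2 * sig * tau b * (m%:R * K m b * shift_basis (- tau b) m x * shift_basis (tau b) m y)
    - rho b * (m.+1%:R * K m b * shift_basis (- tau b) m.+1 x * shift_basis (tau b) m y)
    + rho b * (m.+1%:R * K m b * shift_basis (- tau b) m x * shift_basis (tau b) m.+1 y)).
  have := is_derive1_mul (is_derive1_mul (dK m) (dbas m x _ _ (is_derive1_opp dtau)))
    (dbas m y _ _ dtau).
  by move=> h; apply: is_derive_eq h _; rewrite -/(rho b); ring.
have dS := is_derive1_mul dnb (is_derive1_sum (index_enum 'I_M) predT dk).
rewrite (_ : (fun s => flow_ker s x y) =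
    (fun s => nb s * \sum_(m < M) kerm lam sig (tau s) (rho s) x y m)); last first.
  apply/funext => s; rewrite /flow_ker (@ker_widen _ _ _ _ _ _ _ M)//.
  by rewrite ltnS (leq_trans (geq_minl _ _))// leq_addr.
apply: is_derive_eq dS _.
rewrite /flow_op [- (lam + _) * _]mulNr -[c * _ * _]mulrA /flow_ker.
rewrite (ker_Py _ _ _ hM nz) (ker_Qy _ _ _ _ _ hM).
rewrite /kerS0 /kerS1 /kerSB /kerSC -/(rho b).
rewrite !big_split /= sumrN -!mulr_sumr.
rewrite (_ : \sum_(m < M) kerm lam sig (tau b) (rho b) x y m =
  \sum_(m < M) ker_coef lam sig m * rho b ^+ m * shift_basis (- tau b) m x * shift_basis (tau b) m y)//.
rewrite /K [in RHS](_ : c = rho b + sig * tau b ^+ 2); last by rewrite /rho; ring.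
ring.
Qed.

Lemma wt_gt0 y : 0 < c -> (forall m, (m < y)%N -> 0 < lam + sig * m%:R) -> 0 < wt y.
Proof.
move=> c0 pos; rewrite divr_gt0 ?mulr_gt0 ?exprn_gt0 ?ltr0n ?fact_gt0//.
by apply: prodr_gt0 => i _; exact: pos.
Qed.

Lemma wtS y : c != 0 -> c * y.+1%:R * wt y.+1 = (lam + sig * y%:R) * wt y.
Proof.
move=> c0; rewrite /wt pochS factS natrM exprS.
have y0 : (y.+1%:R : R) != 0 by rewrite pnatr_eq0.
have f0 : (y`!%:R : R) != 0 by rewrite pnatr_eq0 -lt0n fact_gt0.
have e0 : c ^+ y != 0 by rewrite expf_neq0.
move: y0 f0 e0; move: (y.+1%:R) (y`!%:R) (c ^+ y) => u v w u0 v0 w0.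
by field; rewrite c0 u0 v0 w0.
Qed.

(** At [tau = 0] both basis factors are Kronecker deltas, and only [m = x = y] survives. *)
Lemma flow_ker0 b x y : tau b = 0 -> nb b = 1 ->
  flow_ker b x y = (x == y)%:R / wt x.
Proof.
move=> tb nbb; rewrite /flow_ker tb nbb /ker mul1r expr0n/= mulr0 subr0.
have b0 m z : shift_basis 0 m z = (m == z)%:R :> R.
  rewrite /shift_basis; have [zm|mz|->] := ltngtP z m.
  - by rewrite bin_small// mul0r.
  - by rewrite expr0n subn_eq0 leqNgt mz mulr0.
  - by rewrite binn subnn mul1r.
have [<-|xy] := eqVneq x y; last first.
  rewrite mul0r big1// => m _; rewrite /kerm oppr0 !b0.
  by have [->|_] := eqVneq (m : nat) x; rewrite ?(negbTE xy) !(mulr0, mul0r).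
rewrite minnn big_ord_recr /= big1 => [|m _]; last first.
  by rewrite /kerm !b0 ltn_eqF// mulr0.
by rewrite add0r /kerm oppr0 !b0 eqxx !mulr1 /ker_coef /wt invf_div mul1r mulrAC.
Qed.

Lemma flow_ker_sym b x y : tau (- b) = - tau b -> nb (- b) = nb b ->
  flow_ker b x y = flow_ker (- b) y x.
Proof. by move=> h1 h2; rewrite /flow_ker h1 h2 sqrrN ker_sym. Qed.

End Flow.

End Kernel.

(** * Weighted L2 spaces *)

Section RealSequences.
Context {R : realType}.
Implicit Types (u v : nat -> R) (l B : R).

Definition psum u (N : nat) : R := \sum_(n < N) u n.

Lemma series_psum u : series u = psum u.
Proof. by rewrite seriesEord. Qed.

Lemma psumD u v N : psum (fun n => u n + v n) N = psum u N + psum v N.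
Proof. exact: big_split. Qed.

Lemma psumZ (a : R) u N : psum (fun n => a * u n) N = a * psum u N.
Proof. by rewrite /psum mulr_sumr. Qed.

Lemma psumS u N : psum u N.+1 = psum u N + u N.
Proof. exact: big_ord_recr. Qed.

Lemma psum_le u v N : (forall n, u n <= v n) -> psum u N <= psum v N.
Proof. by move=> h; apply: ler_sum => n _. Qed.

Lemma psum_ge0 u N : (forall n, 0 <= u n) -> 0 <= psum u N.
Proof. by move=> h; apply: sumr_ge0 => n _. Qed.

Lemma psum_homo u : (forall n, 0 <= u n) -> nondecreasing_seq (psum u).
Proof. by move=> h; apply/nondecreasing_seqP => n; rewrite psumS lerDl. Qed.

Lemma cvgn_ext u v l : (forall n, u n = v n) -> u @ \oo --> l -> v @ \oo --> l.
Proof. by move=> /funext ->. Qed.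

Lemma cvgn_le u l B : u @ \oo --> l -> (forall n, u n <= B) -> l <= B.
Proof.
move=> ul h; have cu : cvgn u by apply/cvg_ex; exists l.
by rewrite -(cvg_lim _ ul)//; apply: limr_le => //; exact: nearW.
Qed.

Lemma cvgn_ge u l B : u @ \oo --> l -> (forall n, B <= u n) -> B <= l.
Proof.
move=> ul h; have cu : cvgn u by apply/cvg_ex; exists l.
by rewrite -(cvg_lim _ ul)//; apply: limr_ge => //; exact: nearW.
Qed.

Lemma cvgn_unique u l l' : u @ \oo --> l -> u @ \oo --> l' -> l = l'.
Proof. by move=> ul ul'; rewrite -(cvg_lim _ ul)// -(cvg_lim _ ul'). Qed.

Lemma cvg_psum_sum M (g : nat -> nat -> R) (l : nat -> R) :
  (forall m, g m @ \oo --> l m) ->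
  (fun N => \sum_(m < M) g m N) @ \oo --> \sum_(m < M) l m.
Proof.
move=> h; elim: M => [|M IH].
  rewrite big_ord0; apply: (cvgn_ext (u := fun=> 0)); last exact: cvg_cst.
  by move=> n; rewrite big_ord0.
rewrite big_ord_recr; apply: (cvgn_ext (u := fun N => \sum_(m < M) g m N + g M N)).
  by move=> n; rewrite big_ord_recr.
exact: cvgD.
Qed.

Lemma psum_le_lim u l N : (forall n, 0 <= u n) -> psum u @ \oo --> l -> psum u N <= l.
Proof.
move=> u0 ul; rewrite -(cvg_lim _ ul)//.
by apply: nondecreasing_cvgn_le; [exact: psum_homo|apply/cvg_ex; exists l].
Qed.

Lemma psum_bounded_cvg u B : (forall n, 0 <= u n) -> (forall N, psum u N <= B) ->
  cvgn (psum u).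
Proof.
move=> u0 uB; apply: nondecreasing_is_cvgn; first exact: psum_homo.
by exists B => _ [N _ <-].
Qed.

Lemma psum_norm_cvg u v : (forall n, `|u n| <= v n) -> cvgn (psum v) -> cvgn (psum u).
Proof.
move=> uv cv; rewrite -series_psum; apply: normed_cvg.
apply: (@series_le_cvg _ _ v); last by rewrite series_psum.
- by move=> n /=.
- by move=> n; apply: le_trans (uv n).
- exact: uv.
Qed.

End RealSequences.

Section RealL2.
Context {R : realType}.
Variable w : nat -> R.
Hypothesis w_gt0 : forall n, 0 < w n.
Implicit Types (f g : nat -> R).

Let w_ge0 n : 0 <= w n. Proof. exact: ltW. Qed.

Definition sqw f n : R := f n ^+ 2 * w n.
Definition rl2 f : Prop := cvgn (psum (sqw f)).
(** The squared norm: without the root, disjoint pieces simply add up. *)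
Definition nrm f : R := limn (psum (sqw f)).
Definition rip f g : R := limn (psum (fun n => f n * g n * w n)).

Lemma sqw_ge0 f n : 0 <= sqw f n.
Proof. by rewrite mulr_ge0 ?sqr_ge0. Qed.

Lemma nrm_cvg f : rl2 f -> psum (sqw f) @ \oo --> nrm f.
Proof. by []. Qed.

Lemma psum_le_nrm f N : rl2 f -> psum (sqw f) N <= nrm f.
Proof. by move=> l2f; apply: psum_le_lim => //; exact: sqw_ge0. Qed.

Lemma rl2_bounded f B : (forall N, psum (sqw f) N <= B) -> rl2 f.
Proof. by apply: psum_bounded_cvg; exact: sqw_ge0. Qed.

Lemma nrm_le f B : (forall N, psum (sqw f) N <= B) -> nrm f <= B.
Proof. by move=> h; apply: cvgn_le (nrm_cvg (rl2_bounded h)) h. Qed.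

Lemma pointwise_le_nrm f n : rl2 f -> f n ^+ 2 * w n <= nrm f.
Proof.
move=> l2f; apply: le_trans (psum_le_nrm n.+1 l2f).
by rewrite psumS lerDr psum_ge0// => m; exact: sqw_ge0.
Qed.

Lemma rip_cvg f g : rl2 f -> rl2 g ->
  psum (fun n => f n * g n * w n) @ \oo --> rip f g.
Proof.
move=> l2f l2g.
suff h : cvgn (psum (fun n => f n * g n * w n)) by exact: h.
apply: (@psum_norm_cvg _ _ (fun n => sqw f n + sqw g n)).
  move=> n; rewrite /sqw -mulrDl normrM (ger0_norm (w_ge0 n)) ler_wpM2r// normrM.
  have := sqr_ge0 (`|f n| - `|g n|); rewrite -(real_normK (num_real (f n))) -(real_normK (num_real (g n))).
  have := normr_ge0 (f n); have := normr_ge0 (g n); nra.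
by rewrite (_ : psum _ = psum (sqw f) \+ psum (sqw g));
  [exact: is_cvgD|apply/funext => N; exact: psumD].
Qed.

Lemma rl2D f g : rl2 f -> rl2 g -> rl2 (fun n => f n + g n).
Proof.
move=> l2f l2g; apply: (@rl2_bounded _ (2 * (nrm f + nrm g))) => N.
apply: (@le_trans _ _ (2 * (psum (sqw f) N + psum (sqw g) N))).
  rewrite -psumD -psumZ; apply: psum_le => n; rewrite /sqw.
  have := w_ge0 n; have := sqr_ge0 (f n - g n); nra.
by rewrite ler_pM2l// lerD// psum_le_nrm.
Qed.

Lemma rl2Z (a : R) f : rl2 f -> rl2 (fun n => a * f n).
Proof.
move=> l2f; apply: (@rl2_bounded _ (a ^+ 2 * nrm f)) => N.
rewrite (_ : sqw _ = fun n => a ^+ 2 * sqw f n); last by apply/funext => n; rewrite /sqw; ring.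
by rewrite psumZ ler_wpM2l ?sqr_ge0// psum_le_nrm.
Qed.

Lemma nrmD f g : rl2 f -> rl2 g ->
  nrm (fun n => f n + g n) = nrm f + nrm g + 2 * rip f g.
Proof.
move=> l2f l2g; apply: cvgn_unique (nrm_cvg (rl2D l2f l2g)) _.
apply: (cvgn_ext (u := fun N => psum (sqw f) N + psum (sqw g) N +
    2 * psum (fun n => f n * g n * w n) N)).
  by move=> N; rewrite -psumZ -!psumD; apply: eq_bigr => n _; rewrite /sqw; ring.
by apply: cvgD; [apply: cvgD; exact: nrm_cvg|apply: cvgMr; exact: rip_cvg].
Qed.

Definition trunc (N : nat) f n : R := if (n < N)%N then f n else 0.

Lemma rl2_le f g : (forall n, `|f n| <= `|g n|) -> rl2 g -> rl2 f.
Proof.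
move=> h l2g; apply: (@rl2_bounded _ (nrm g)) => N.
apply: le_trans (psum_le_nrm N l2g); apply: psum_le => n.
rewrite /sqw ler_wpM2r// -(real_normK (num_real (f n))) -(real_normK (num_real (g n))).
by rewrite lerXn2r ?nnegrE.
Qed.

Lemma rl2_trunc N f : rl2 f -> rl2 (trunc N f).
Proof. by apply: rl2_le => n; rewrite /trunc; case: ifP; rewrite ?normr0. Qed.

Lemma rl2_tail N f : rl2 f -> rl2 (fun n => f n - trunc N f n).
Proof.
by apply: rl2_le => n; rewrite /trunc; case: ifP; rewrite ?subrr ?subr0 ?normr0.
Qed.

Lemma nrm_tail N f : rl2 f ->
  nrm (fun n => f n - trunc N f n) <= nrm f - psum (sqw f) N.
Proof.
move=> l2f; apply: nrm_le => M; rewrite lerBrDr.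
apply: le_trans (psum_le_nrm (maxn M N) l2f).
apply: (@le_trans _ _ (psum (sqw (fun n => f n - trunc N f n)) (maxn M N) +
   psum (sqw (trunc N f)) (maxn M N))).
  apply: lerD.
    by apply: psum_homo; [exact: sqw_ge0|exact: leq_maxl].
  rewrite (_ : psum (sqw f) N = psum (sqw (trunc N f)) N); last first.
    by apply: eq_bigr => n _; rewrite /sqw /trunc ltn_ord.
  by apply: psum_homo; [exact: sqw_ge0|exact: leq_maxr].
rewrite -psumD; apply: psum_le => n; rewrite /sqw /trunc.
by case: ifP => _; rewrite ?subrr ?subr0 ?expr0n ?mul0r ?add0r ?addr0.
Qed.

Lemma nrm_tail_cvg0 f : rl2 f ->
  (fun N => nrm f - psum (sqw f) N) @ \oo --> 0.
Proof.
move=> l2f; rewrite -(subrr (nrm f)).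
by apply: cvgB; [exact: cvg_cst|exact: nrm_cvg].
Qed.

Section Kernel.
Variable P : nat -> nat -> R.
Hypothesis rowP : forall x x', psum (fun y => P x y * P x' y * w y) @ \oo -->
  (x == x')%:R / w x.
Hypothesis colP : forall y y', psum (fun x => P x y * P x y' * w x) @ \oo -->
  (y == y')%:R / w y.

(** The row [P x] stands for the image of the delta function at [x] divided by [w x], whence the
    factor [w x]. *)
Definition opk f y : R := limn (psum (fun x => f x * P x y * w x)).

Let colP_l2 y : rl2 (fun x => P x y).
Proof.
apply/cvg_ex; exists ((y == y)%:R / w y).
by apply: (cvgn_ext _ (@colP y y)) => N; apply: eq_bigr => n _; rewrite /sqw expr2.
Qed.

Lemma opk_cvg f y : rl2 f -> psum (fun x => f x * P x y * w x) @ \oo --> opk f y.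
Proof. by move=> l2f; exact: rip_cvg. Qed.

Lemma opk_lin (a : R) f g : rl2 f -> rl2 g ->
  opk (fun x => a * f x + g x) = fun y => a * opk f y + opk g y.
Proof.
move=> l2f l2g; apply/funext => y.
apply: (cvgn_unique (u := psum (fun x => (a * f x + g x) * P x y * w x))).
  by apply: opk_cvg; apply: rl2D => //; exact: rl2Z.
apply: (cvgn_ext (u := fun N => a * psum (fun x => f x * P x y * w x) N
    + psum (fun x => g x * P x y * w x) N)).
  by move=> N; rewrite -psumZ -psumD; apply: eq_bigr => n _; ring.
by apply: cvgD; [apply: cvgMr|]; exact: opk_cvg.
Qed.

Definition opkN N f y : R := \sum_(x < N) f x * P x y * w x.

Lemma opk_trunc N f y : opk (trunc N f) y = opkN N f y.
Proof.
rewrite /opk; apply/cvg_lim => //.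
apply: (@cvg_trans _ ((fun=> opkN N f y) @ \oo)); last exact: cvg_cst.
apply: near_eq_cvg; near=> M.
have NM : (N <= M)%N by near: M; exact: nbhs_infty_ge.
rewrite /opkN (big_ord_widen _ (fun x => f x * P x y * w x) NM) big_mkcond/=.
by apply: eq_bigr => x _; rewrite /trunc; case: ifP; rewrite ?mul0r.
Unshelve. all: by end_near. Qed.

(** The square of a finite combination of rows is expanded; row orthogonality leaves only the
    diagonal. *)
Lemma nrm_opkN N f : psum (sqw (opkN N f)) @ \oo --> psum (sqw f) N.
Proof.
pose g x y := f x * P x y * w x.
apply: (cvgn_ext (u := fun M => \sum_(x < N) \sum_(x' < N)
   (f x * w x * (f x' * w x')) * psum (fun y => P x y * P x' y * w y) M)).
  move=> M; transitivity (\sum_(y < M) \sum_(x < N) \sum_(x' < N) g x y * g x' y * w y).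
    rewrite [RHS]exchange_big; apply: eq_bigr => x _ /=.
    rewrite [RHS]exchange_big; apply: eq_bigr => x' _ /=.
    by rewrite /psum mulr_sumr; apply: eq_bigr => y _; rewrite /g; ring.
  apply: eq_bigr => y _; rewrite /sqw expr2 {1}/opkN !mulr_suml.
  by apply: eq_bigr => x _; rewrite /opkN mulr_sumr mulr_suml.
have -> : psum (sqw f) N = \sum_(x < N) \sum_(x' < N)
   (f x * w x * (f x' * w x')) * ((x == x' :> nat)%:R / w x).
  apply: eq_bigr => x _; rewrite (bigD1 x)//= big1 => [|x' /negbTE xx'].
    by rewrite eqxx mul1r addr0 /sqw; field; rewrite gt_eqF.
  by rewrite eq_sym -val_eqE/= in xx' *; rewrite xx' mul0r mulr0.
apply: (@cvg_psum_sum _ N (fun x M => \sum_(x' < N)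
   (f x * w x * (f x' * w x')) * psum (fun y => P x y * P x' y * w y) M)
   (fun x => \sum_(x' < N)(f x * w x * (f x' * w x')) * ((x == x' :> nat)%:R / w x))).
move=> x; apply: (@cvg_psum_sum _ N (fun x' M =>
   (f x * w x * (f x' * w x')) * psum (fun y => P x y * P x' y * w y) M)
   (fun x' => (f x * w x * (f x' * w x')) * ((x == x' :> nat)%:R / w x))) => x'.
by apply: cvgMr; exact: rowP.
Qed.

(* Fatou: pass to the limit [N -> oo] under finitely many squares. *)
Lemma psum_opk_le f M : rl2 f -> psum (sqw (opk f)) M <= nrm f.
Proof.
move=> l2f; apply: (@cvgn_le _ (fun N => psum (sqw (opkN N f)) M)).
  apply: (@cvg_psum_sum _ M (fun y N => sqw (opkN N f) y)) => y.
  by apply: cvgMl; rewrite [X in _ --> X]expr2; apply: cvgM; exact: opk_cvg.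
move=> N; apply: le_trans (psum_le_nrm N l2f).
exact: (psum_le_lim _ (sqw_ge0 (opkN N f)) (@nrm_opkN N f)).
Qed.

Lemma rl2_opk f : rl2 f -> rl2 (opk f).
Proof. by move=> l2f; apply: (@rl2_bounded _ (nrm f)) => M; exact: psum_opk_le. Qed.

Lemma nrm_opk_le f : rl2 f -> nrm (opk f) <= nrm f.
Proof. by move=> l2f; apply: nrm_le => M; exact: psum_opk_le. Qed.

Lemma opk_finite f N y : (forall x, (N <= x)%N -> f x = 0) ->
  opk f y = opkN N f y.
Proof.
move=> h; rewrite -opk_trunc; congr (opk _ y); apply/funext => x; rewrite /trunc.
by case: ltnP => // /h.
Qed.

End Kernel.
End RealL2.

Section Inversion.
Context {R : realType}.
Variable w : nat -> R.
Hypothesis w_gt0 : forall n, 0 < w n.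
Variable P : nat -> nat -> R.
Hypothesis rowP : forall x x', psum (fun y => P x y * P x' y * w y) @ \oo -->
  (x == x')%:R / w x.
Hypothesis colP : forall y y', psum (fun x => P x y * P x y' * w x) @ \oo -->
  (y == y')%:R / w y.

Let PT y x := P x y.

Lemma opk_opkN N f x0 : (x0 < N)%N -> opk w PT (opkN w P N f) x0 = f x0.
Proof.
move=> x0N; apply/cvg_lim => //.
apply: (cvgn_ext (u := fun M => \sum_(x < N)
   (f x * w x) * psum (fun y => P x y * P x0 y * w y) M)).
  move=> M; rewrite /psum /opkN.
  under [RHS]eq_bigr do rewrite -mulrA mulr_suml.
  rewrite [RHS]exchange_big; apply: eq_bigr => x _ /=.
  by rewrite mulr_sumr; apply: eq_bigr => y _; rewrite /PT; ring.
have -> : f x0 = \sum_(x < N) (f x * w x) * ((x == x0 :> nat)%:R / w x).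
  rewrite (bigD1 (Ordinal x0N))//= big1 => [|x /negbTE xx0].
    by rewrite eqxx mul1r addr0; field; rewrite gt_eqF.
  by rewrite -val_eqE/= in xx0; rewrite xx0 mul0r mulr0.
apply: (@cvg_psum_sum _ N (fun x M =>
   (f x * w x) * psum (fun y => P x y * P x0 y * w y) M)
   (fun x => (f x * w x) * ((x == x0 :> nat)%:R / w x))) => x.
by apply: cvgMr; exact: rowP.
Qed.

(** Split [f] at [N]. The head is recovered exactly at [x0 < N] by [opk_opkN]; the contribution of
    the tail is controlled by its squared norm, both operators being contractions. *)
Lemma opkK f : rl2 w f -> opk w PT (opk w P f) = f.
Proof.
move=> l2f; apply/funext => x0; set g := opk w PT _ x0.
have bnd N : (x0 < N)%N -> (g - f x0) ^+ 2 * w x0 <= nrm w f - psum (sqw w f) N.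
  move=> x0N; apply: le_trans (nrm_tail w_gt0 N l2f).
  set t := fun n => f n - trunc N f n.
  have l2t : rl2 w t by exact: rl2_tail.
  have l2T : rl2 w (trunc N f) by exact: rl2_trunc.
  have l2Pt : rl2 w (opk w P t) by exact: rl2_opk.
  have e : g = f x0 + opk w PT (opk w P t) x0.
    rewrite /g [in LHS](_ : f = fun x => 1 * trunc N f x + t x); last first.
      by apply/funext => x; rewrite /t; ring.
    rewrite opk_lin// (opk_lin _ _ (P := PT))//; last first.
      by apply: rl2_opk.
    rewrite (_ : opk w P (trunc N f) = opkN w P N f); last first.
      by apply/funext => y; exact: opk_trunc.
    by rewrite opk_opkN// mul1r.
  rewrite e [f x0 + _]addrC addrK.
  apply: (le_trans (pointwise_le_nrm w_gt0 x0 (_ : rl2 w (opk w PT (opk w P t))))).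
    by apply: rl2_opk.
  by apply: le_trans (nrm_opk_le _ _ _ l2t) => //; apply: nrm_opk_le.
have : (g - f x0) ^+ 2 * w x0 <= 0.
  (* [bnd] requires [x0 < N], hence the shift by [x0.+1]. *)
  apply: (cvgn_ge (u := fun N => nrm w f - psum (sqw w f) (N + x0.+1)%N)).
    have := nrm_tail_cvg0 l2f.
    by rewrite -(cvg_shiftn x0.+1); exact.
  by move=> N; apply: bnd; rewrite addnS ltnS leq_addl.
rewrite pmulr_lle0// => h.
have : (g - f x0) ^+ 2 == 0 by rewrite eq_le h sqr_ge0.
by rewrite sqrf_eq0 subr_eq0 => /eqP.
Qed.

End Inversion.

Section Isometry.
Context {R : realType}.
Variable w : nat -> R.
Hypothesis w_gt0 : forall n, 0 < w n.
Variable P : nat -> nat -> R.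
Hypothesis rowP : forall x x', psum (fun y => P x y * P x' y * w y) @ \oo -->
  (x == x')%:R / w x.
Hypothesis colP : forall y y', psum (fun x => P x y * P x y' * w x) @ \oo -->
  (y == y')%:R / w y.

Let PT y x := P x y.

(** Two contractions inverse to each other are isometries. *)
Lemma nrm_opk f : rl2 w f -> nrm w (opk w P f) = nrm w f.
Proof.
move=> l2f; apply/eqP; rewrite eq_le; apply/andP; split.
  exact: (nrm_opk_le w_gt0).
rewrite -{1}(opkK w_gt0 rowP colP l2f).
by apply: (nrm_opk_le w_gt0) => //; exact: (rl2_opk w_gt0).
Qed.

Lemma rip_opk f g : rl2 w f -> rl2 w g ->
  rip w (opk w P f) (opk w P g) = rip w f g.
Proof.
move=> l2f l2g.
have l2Pf : rl2 w (opk w P f) by exact: (rl2_opk w_gt0).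
have l2Pg : rl2 w (opk w P g) by exact: (rl2_opk w_gt0).
have e1 := nrmD w_gt0 l2f l2g; have e2 := nrmD w_gt0 l2Pf l2Pg.
have e3 : opk w P (fun x => f x + g x) = fun y => opk w P f y + opk w P g y.
  rewrite (_ : (fun x => f x + g x) = fun x => 1 * f x + g x).
    by rewrite (opk_lin w_gt0)//; apply/funext => y; rewrite mul1r.
  by apply/funext => y; rewrite mul1r.
have := nrm_opk (rl2D w_gt0 l2f l2g); rewrite e3 e1 e2 !nrm_opk//; lra.
Qed.

Local Notation Re := (@complex.Re _).
Local Notation Im := (@complex.Im _).

Lemma L2_rl2 (f : nat -> R[i]) : L2 w f <-> rl2 w (Re \o f) /\ rl2 w (Im \o f).
Proof.
have e x : Normc.normc (f x) ^+ 2 = Re (f x) ^+ 2 + Im (f x) ^+ 2.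
  by case: (f x) => a b /=; rewrite sqr_sqrtr// addr_ge0 ?sqr_ge0.
rewrite /L2 /= series_psum; split => [h|[h1 h2]].
  have [l hl] := (cvg_ex _).1 h.
  have b0 x : 0 <= Normc.normc (f x) ^+ 2 * w x by rewrite mulr_ge0 ?sqr_ge0 ?ltW.
  have b N := psum_le_lim N b0 hl.
  split; apply: (rl2_bounded w_gt0 (B := l)) => N; apply: le_trans (b N);
    apply: psum_le => x; rewrite /sqw /= e; apply: ler_wpM2r; rewrite ?(ltW (w_gt0 x))//.
    by rewrite lerDl sqr_ge0.
  by rewrite lerDr sqr_ge0.
rewrite (_ : psum _ = psum (sqw w (Re \o f)) \+ psum (sqw w (Im \o f))).
  exact: is_cvgD.
by apply/funext => N; rewrite /= -psumD; apply: eq_bigr => x _; rewrite e /sqw mulrDl.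
Qed.

Lemma clim_uniq (u : nat -> R[i]) l : clim_to u l -> clim u = l.
Proof.
by move=> [h1 h2]; rewrite /clim (cvg_lim _ h1)// (cvg_lim _ h2)//; case: l {h1 h2}.
Qed.

Lemma Re_sum (I : Type) (r : seq I) (p : pred I) (F : I -> R[i]) :
  Re (\sum_(i <- r | p i) F i) = \sum_(i <- r | p i) Re (F i).
Proof. by elim/big_rec2: _ => // i x [a b] _ /= <-; case: (F i). Qed.

Lemma Im_sum (I : Type) (r : seq I) (p : pred I) (F : I -> R[i]) :
  Im (\sum_(i <- r | p i) F i) = \sum_(i <- r | p i) Im (F i).
Proof. by elim/big_rec2: _ => // i x [a b] _ /= <-; case: (F i). Qed.

Lemma inner_rip (f g : nat -> R[i]) : L2 w f -> L2 w g ->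
  inner w f g = (rip w (Re \o f) (Re \o g) + rip w (Im \o f) (Im \o g)) +i*
    (rip w (Im \o f) (Re \o g) - rip w (Re \o f) (Im \o g)).
Proof.
move=> /L2_rl2[f1 f2] /L2_rl2[g1 g2]; apply: clim_uniq; rewrite /clim_to.
have -> : series (fun x => f x * conjc (g x) * (w x)%:C) =
    fun N => \sum_(x < N) f x * conjc (g x) * (w x)%:C by rewrite seriesEord.
split=> /=.
  apply: (cvgn_ext (u := fun N => psum (fun x => (Re \o f) x * (Re \o g) x * w x) N
      + psum (fun x => (Im \o f) x * (Im \o g) x * w x) N)).
    move=> N; rewrite Re_sum -psumD; apply: eq_bigr => x _ /=.
    by case: (f x) => a b; case: (g x) => a' b' /=; ring.
  by apply: cvgD; exact: (rip_cvg w_gt0).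
apply: (cvgn_ext (u := fun N => psum (fun x => (Im \o f) x * (Re \o g) x * w x) N
    - psum (fun x => (Re \o f) x * (Im \o g) x * w x) N)).
  move=> N; rewrite Im_sum /psum -sumrB; apply: eq_bigr => x _ /=.
  by case: (f x) => a b; case: (g x) => a' b' /=; ring.
by apply: cvgB; exact: (rip_cvg w_gt0).
Qed.

(** The kernel is real, so it acts separately on the two parts of a complex function. *)
Definition copk (Q : nat -> nat -> R) (f : nat -> R[i]) (y : nat) : R[i] :=
  opk w Q (Re \o f) y +i* opk w Q (Im \o f) y.

Lemma Re_copk Q f : Re \o copk Q f = opk w Q (Re \o f).
Proof. by []. Qed.

Lemma Im_copk Q f : Im \o copk Q f = opk w Q (Im \o f).
Proof. by []. Qed.

Lemma copk_unitary : unitary_on (L2 w) (inner w) (copk P).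
Proof.
have l2P f : L2 w f -> L2 w (copk P f).
  move=> /L2_rl2[h1 h2]; apply/L2_rl2.
  by split; [exact: (rl2_opk w_gt0 rowP colP h1)|exact: (rl2_opk w_gt0 rowP colP h2)].
split => //.
- move=> a f g /L2_rl2[f1 f2] /L2_rl2[g1 g2]; apply/funext => y.
  case: a => a1 a2.
  have f1' := rl2Z w_gt0 (a := a1) f1; have f2' := rl2Z w_gt0 (a := a1) f2.
  have h1 := rl2D w_gt0 f1' g1; have h2 := rl2D w_gt0 f2' g2.
  rewrite /copk.
  rewrite (_ : Re \o (fun x => (a1 +i* a2) * f x + g x) = fun x => (- a2) * (Im \o f) x + (a1 * (Re \o f) x + (Re \o g) x)); last first.
    by apply/funext => x /=; case: (f x) => ? ?; case: (g x) => ? ? /=; ring.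
  rewrite (_ : Im \o (fun x => (a1 +i* a2) * f x + g x) = fun x => a2 * (Re \o f) x + (a1 * (Im \o f) x + (Im \o g) x)); last first.
    by apply/funext => x /=; case: (f x) => ? ?; case: (g x) => ? ? /=; ring.
  rewrite !(opk_lin w_gt0 colP)//.
  by apply/eqP; rewrite eq_complex /=; apply/andP; split; apply/eqP; ring.
- move=> f g l2f l2g; rewrite !inner_rip//; [|exact: l2P..].
  move: l2f l2g => /L2_rl2[f1 f2] /L2_rl2[g1 g2].
  by rewrite !Re_copk !Im_copk !rip_opk.
(* The transposed kernel provides the preimage, by [opkK] with rows and columns exchanged. *)
- move=> g /L2_rl2[g1 g2]; exists (copk PT g).
    by apply/L2_rl2; split; [exact: (rl2_opk w_gt0 colP rowP g1)|exact: (rl2_opk w_gt0 colP rowP g2)].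
  apply/funext => y; rewrite /copk.
  rewrite Re_copk Im_copk (opkK w_gt0 colP rowP g1) (opkK w_gt0 colP rowP g2).
  by rewrite /=; case: (g y).
Qed.

Lemma copk_finite (f : nat -> R[i]) N y : (forall x, (N <= x)%N -> f x = 0) ->
  copk P f y = \sum_(x < N) f x * (P x y * w x)%:C.
Proof.
move=> h; rewrite /copk !(@opk_finite _ w P _ N); last 2 first.
- by move=> x /h /= ->.
- by move=> x /h /= ->.
apply/eqP; rewrite eq_complex /= Re_sum Im_sum; apply/andP; split; apply/eqP;
  by apply: eq_bigr => x _ /=; case: (f x) => a b /=; ring.
Qed.

Lemma phase_unitary (th : nat -> R[i]) : (forall x, th x * conjc (th x) = 1) ->
  unitary_on (L2 w) (inner w) (fun f => copk P (fun x => th x * f x)).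
Proof.
move=> hth; have [U1 U2 U3 U4] := copk_unitary.
have n1 x : Normc.normc (th x) = 1.
  have := hth x; case: (th x) => a b /= [h _].
  by rewrite (_ : _ + _ = 1) ?sqrtr1//; rewrite -h; ring.
have l2th (th' : nat -> R[i]) : (forall x, Normc.normc (th' x) = 1) ->
    forall f, L2 w f -> L2 w (fun x => th' x * f x).
  move=> h f; rewrite /L2 /= (_ : (fun x => _) = (fun x => Normc.normc (f x) ^+ 2 * w x))//.
  by apply/funext => x; rewrite Normc.normcM h mul1r.
split.
- by move=> f l2f; apply: U1; exact: l2th.
- move=> a f g l2f l2g; rewrite -U2; [|exact: l2th..].
  by congr (copk P _); apply/funext => x; ring.
- move=> f g l2f l2g; rewrite U3; [|exact: l2th..].
  rewrite /inner; congr csum; apply/funext => x.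
  rewrite rmorphM /= [LHS](_ : _ = (th x * conjc (th x)) * (f x * conjc (g x)) * (w x)%:C); last by ring.
  by rewrite hth mul1r.
- move=> g /U4[f l2f <-]; exists (fun x => conjc (th x) * f x).
    by apply: l2th => // x; rewrite -[RHS](n1 x); case: (th x) => a b /=; rewrite sqrrN.
  by congr (copk P _); apply/funext => x; rewrite mulrA hth mul1r.
Qed.

End Isometry.

(** * Orthogonality of the kernel *)

Section GeometricBounds.
Context {R : realType}.

(** [M] dominates the finitely many quotients [a i / q ^ i] with [i <= N]; from [N] on the quotient
    no longer increases. The summand 1 makes [M] positive. *)
Lemma ratio_bound (a : nat -> R) (q : R) (N : nat) : 0 < q ->
  (forall n, 0 <= a n) -> (forall n, (N <= n)%N -> a n.+1 <= q * a n) ->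
  exists2 M : R, 0 < M & forall n, a n <= M * q ^+ n.
Proof.
move=> q0 a0 h; pose M := 1 + \sum_(i < N.+1) a i * q ^- i.
have M0 i : 0 <= a i * q ^- i by rewrite mulr_ge0 ?invr_ge0 ?exprn_ge0 ?(ltW q0).
have le i : (i <= N)%N -> a i * q ^- i <= M.
  move=> iN; rewrite /M (bigD1 (Ordinal (_ : i < N.+1)%N))//= addrCA lerDl.
  by rewrite addr_ge0// sumr_ge0.
have leM i : a i * q ^- i <= M -> a i <= M * q ^+ i by rewrite ler_pdivrMr ?exprn_gt0.
exists M; first by rewrite ltr_pwDl// sumr_ge0.
move=> n; have [nN|Nn] := leqP n N; first exact/leM/le.
rewrite -(subnK (ltnW Nn)); elim: (n - N)%N => [|k IH]; first exact/leM/le.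
rewrite addSn exprS mulrCA; apply: (le_trans (h _ (leq_addl _ _))).
by rewrite ler_pM2l.
Qed.

Lemma natr_ge_ex (x : R) : exists N : nat, forall n, (N <= n)%N -> x <= n%:R.
Proof.
exists (Num.Def.truncn `|x|).+1 => n h; apply: (le_trans (ler_norm x)).
by apply: ltW; apply: lt_le_trans (truncnS_gt _) _; rewrite ler_nat.
Qed.

Lemma natr_geometric_cvg0 (q : R) : 0 < q -> q < 1 ->
  (fun n => n.+1%:R * q ^+ n) @ \oo --> 0.
Proof.
move=> q0 q1; pose r := (1 + q) / 2.
have qr : q < r by rewrite /r; lra.
have r1 : r < 1 by rewrite /r; lra.
have [N hN] := natr_ge_ex (2 * q / (r - q)).
have [|||M M0 hM] := @ratio_bound (fun n => n.+1%:R * q ^+ n) r N.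
- exact: lt_trans qr.
- by move=> n; rewrite mulr_ge0 ?exprn_ge0 ?(ltW q0).
- move=> n /hN; rewrite ler_pdivrMr ?subr_gt0// => h.
  rewrite exprS mulrCA !mulrA ler_wpM2r ?exprn_ge0 ?(ltW q0)//.
  by rewrite -[n.+2%:R]natr1 -[n.+1%:R]natr1; nra.
have h0 : (fun n => M * r ^+ n) @ \oo --> 0.
  rewrite -(mulr0 M); apply: cvgMr; apply: cvg_expr.
  by rewrite ger0_norm//; lra.
apply: (squeeze_cvgr _ (cvg_cst 0) h0); apply: nearW => n.
by rewrite hM mulr_ge0 ?exprn_ge0 ?(ltW q0).
Qed.

(** Multiplied by [e ^ m], the left side is one term of the binomial expansion of [(T + e) ^ y]. *)
Lemma bin_geometric (T e : R) m y : 0 <= T -> 0 < e ->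
  'C(y, m)%:R * T ^+ (y - m) <= e ^- m * (T + e) ^+ y.
Proof.
move=> T0 e0; rewrite [leRHS]mulrC ler_pdivlMr ?exprn_gt0//.
have [ym|my] := ltnP y m.
  by rewrite bin_small// mul0r mul0r exprn_ge0// addr_ge0 ?(ltW e0).
rewrite exprDn (bigD1 (Ordinal (_ : m < y.+1)%N))//= -[X in _ <= X + _]mulr_natl mulrA lerDl.
by apply: sumr_ge0 => i _; rewrite mulrn_wge0// mulr_ge0 ?exprn_ge0 ?(ltW e0).
Qed.

End GeometricBounds.

Section Antisymmetry.
Context {R : realType}.
Variables (lam sig c : R).
Hypothesis c0 : c != 0.
Local Notation W := (wt lam sig c).
Local Notation A := (flow_op lam sig c).

(** Discrete Green identity: by [wtS] the sum telescopes and leaves the flux through the boundary at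
    [N]. *)
Lemma flow_op_antisym (g h : nat -> R) N :
  \sum_(y < N) (A g y * h y + g y * A h y) * W y =
  - (c * N%:R * W N * (g N * h N.-1 + g N.-1 * h N)).
Proof.
elim: N => [|N IH]; first by rewrite big_ord0 !(mulr0, mul0r) oppr0.
rewrite big_ord_recr /= {}IH wtS// /flow_op; ring.
Qed.

End Antisymmetry.

Section Orthogonality.
Context {R : realType}.
Variables (lam sig c : R) (tau nb : R -> R).
Hypotheses (lam0 : 0 < lam) (sig0 : 0 <= sig) (c0 : 0 < c).
Hypothesis dtau : forall b : R, is_derive b 1 tau (c - sig * tau b ^+ 2).
Hypothesis dnb : forall b : R, is_derive b 1 nb (- lam * tau b * nb b).
Hypotheses (tau0 : tau 0 = 0) (nb0 : nb 0 = 1).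
Hypotheses (tauN : forall b : R, tau (- b) = - tau b) (nbN : forall b : R, nb (- b) = nb b).
Hypothesis nb1 : forall b : R, `|nb b| <= 1.
(** For [sig > 0], [tau] stays away from the fixed point [sqrt (c / sig)] of the Riccati equation on
    bounded time intervals; [T'] leaves room between the bound [T] and that point. *)
Hypothesis tauB : forall B : R, exists T T' : R,
  [/\ 0 <= T, T < T', sig * T' ^+ 2 < c &
      forall b, `|b| <= B -> `|tau b| <= T].
Local Notation W := (wt lam sig c).
Local Notation A := (flow_op lam sig c).
Local Notation E := (flow_ker lam sig c tau nb).

Implicit Types (b s : R) (x y m n N : nat).

Let rate_gt0 m : 0 < lam + sig * m%:R.
Proof. by rewrite ltr_pwDl// mulr_ge0. Qed.

Lemma wt_gt0_nneg y : 0 < W y.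
Proof. exact: wt_gt0. Qed.

Lemma flow_ker_ode b x y : is_derive b 1 (fun s => E s x y) (A (E b x) y).
Proof. by apply: flow_ker_derive => // m _; rewrite gt_eqF. Qed.

(** Finitely many terms, each a binomial times a power of [tau]; [bin_geometric] with [e = T' - T]
    turns them into powers of [T']. *)
Lemma flow_ker_bound (B : R) x : exists M T : R, [/\ 0 <= M, 0 < T, sig * T ^+ 2 < c &
  forall b y, `|b| <= B -> `|E b x y| <= M * T ^+ y].
Proof.
have [T [T' [T0 TT' T'c hT]]] := tauB B.
pose e := T' - T; have e0 : 0 < e by rewrite subr_gt0.
pose F m := ker_coef lam sig m * c ^+ m * ('C(x, m)%:R * T ^+ (x - m)) * e ^- m.
have k0 m : 0 <= ker_coef lam sig m.
  by rewrite mulr_ge0// invr_ge0 prodr_ge0// => i _; exact: ltW.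
have F0 m : 0 <= F m.
  rewrite /F; move: (k0 m); move: (ker_coef lam sig m) => k k_ge0.
  by rewrite !mulr_ge0 ?invr_ge0 ?exprn_ge0 ?T0 ?(ltW e0) ?(ltW c0).
exists (\sum_(m < x.+1) F m), T'; split => //.
- exact: sumr_ge0.
- exact: le_lt_trans TT'.
move=> b y /hT hb; rewrite /flow_ker (@ker_widen _ _ _ _ _ _ _ _ x.+1); last first.
  by rewrite ltnS geq_minl.
rewrite normrM -[leRHS]mul1r ler_pM//; apply: (le_trans (ler_norm_sum _ _ _)).
rewrite mulr_suml; apply: ler_sum => m _.
have rho_c : `|c - sig * tau b ^+ 2| <= c.
  have t1 : tau b ^+ 2 <= T' ^+ 2.
    rewrite -(real_normK (num_real (tau b))) lerXn2r ?nnegrE//; last first.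
      by rewrite (le_trans hb)// ltW.
    by rewrite (le_trans T0)// ltW.
  have t2 := mulr_ge0 sig0 (sqr_ge0 (tau b)).
  have t3 := ler_wpM2l sig0 t1.
  by rewrite ler_norml; apply/andP; split; lra.
rewrite /F /kerm; move: (k0 m); move: (ker_coef lam sig m) => k k_ge0.
rewrite !normrM -[leRHS]mulrA (ger0_norm k_ge0).
apply: ler_pM; rewrite ?mulr_ge0//.
  apply: ler_pM; rewrite ?mulr_ge0//.
    by rewrite ler_wpM2l// normrX lerXn2r ?nnegrE// ltW.
  rewrite normrX normrN ger0_norm// ler_wpM2l//.
  by rewrite lerXn2r ?nnegrE.
rewrite normrX ger0_norm//.
apply: (@le_trans _ _ ('C(y, m)%:R * T ^+ (y - m))).
  by rewrite ler_wpM2l// lerXn2r ?nnegrE.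
by rewrite (_ : T' = T + e); [exact: bin_geometric|rewrite /e; ring].
Qed.

(** [W y.+1 / W y] tends to [sig / c], so the ratio of the left side tends to [sig * T ^ 2 / c < 1];
    [q] is the midpoint between this limit and 1. *)
Lemma wt_geometric (T : R) : 0 < T -> sig * T ^+ 2 < c ->
  exists M q : R, [/\ 0 < M, 0 < q, q < 1 & forall y, (T ^+ y) ^+ 2 * W y <= M * q ^+ y].
Proof.
move=> T0 Tc; pose Q := T ^+ 2; have Q0 : 0 < Q by rewrite exprn_gt0.
pose q := (sig * Q / c + 1) / 2.
have s1 : sig * Q / c < 1 by rewrite ltr_pdivrMr// mul1r.
have s0 : 0 <= sig * Q / c by rewrite divr_ge0 ?(ltW c0)// mulr_ge0 ?(ltW Q0).
have q0 : 0 < q by rewrite /q; lra.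
have q1 : q < 1 by rewrite /q; lra.
have qs : 0 < q * c - sig * Q.
  have -> : q * c - sig * Q = (q - sig * Q / c) * c by field; rewrite gt_eqF.
  by apply: mulr_gt0 => //; rewrite /q; lra.
have [N hN] := natr_ge_ex (Q * lam / (q * c - sig * Q)).
have [||M M0 hM] := @ratio_bound _ (fun y => Q ^+ y * W y) q N q0.
- by move=> n /=; rewrite mulr_ge0 ?(exprn_ge0 _ (ltW Q0)) ?(ltW (wt_gt0_nneg _)).
- move=> n /hN; rewrite ler_pdivrMr// => h.
  rewrite -(ler_pM2l (_ : 0 < c * n.+1%:R)) ?mulr_gt0//.
  rewrite (_ : c * n.+1%:R * (Q ^+ n.+1 * W n.+1) = Q ^+ n.+1 * (c * n.+1%:R * W n.+1)); last ring.
  rewrite wtS ?gt_eqF// exprS.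
  rewrite (_ : _ * _ = Q * (lam + sig * n%:R) * (Q ^+ n * W n)); last ring.
  rewrite [leRHS](_ : _ = c * n.+1%:R * q * (Q ^+ n * W n)); last ring.
  rewrite ler_wpM2r ?(mulr_ge0 (exprn_ge0 _ (ltW Q0)) (ltW (wt_gt0_nneg _)))//.
  by have := mulr_gt0 c0 q0; rewrite -natr1; move: (n%:R) h => z; lra.
exists M, q; split => // y.
by rewrite -exprM mulnC exprM; exact: hM.
Qed.

Lemma flow_ker_geometric (B : R) x : exists M q : R, [/\ 0 < M, 0 < q, q < 1 &
  forall b y, `|b| <= B -> E b x y ^+ 2 * W y <= M * q ^+ y].
Proof.
have [M1 [T [M10 T0 Tc h1]]] := flow_ker_bound B x.
have [M2 [q [M20 q0 q1 h2]]] := wt_geometric T0 Tc.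
exists (M1 ^+ 2 * M2 + 1), q; split => //.
  by rewrite ltr_wpDl// mulr_ge0 ?sqr_ge0 ?(ltW M20).
move=> b y /(h1 b y) h.
apply: (@le_trans _ _ (M1 ^+ 2 * ((T ^+ y) ^+ 2 * W y))).
  rewrite mulrA ler_wpM2r ?(ltW (wt_gt0_nneg _))//.
  rewrite -(real_normK (num_real (E b x y))) -exprMn lerXn2r ?nnegrE//.
  by rewrite mulr_ge0 ?exprn_ge0 ?(ltW T0).
apply: (@le_trans _ _ (M1 ^+ 2 * (M2 * q ^+ y))).
  by rewrite ler_wpM2l ?sqr_ge0.
by rewrite mulrA ler_wpM2r ?exprn_ge0 ?(ltW q0)// lerDl.
Qed.

(* The truncated scalar product has derivative the boundary term of
   [flow_op_antisym], which decays geometrically. *)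
Lemma flow_ker_orth b x x' : psum (fun y => E b x y * E b x' y * W y) @ \oo -->
  (x == x')%:R / W x.
Proof.
pose Q N s := psum (fun y => E s x y * E s x' y * W y) N.
pose bd N s := - (c * N%:R * W N * (E s x N * E s x' N.-1 + E s x N.-1 * E s x' N)).
have dQ N s : is_derive s 1 (Q N) (bd N s).
  have h (y : nat) := is_derive1_mul (is_derive1_mul (flow_ker_ode s x y) (flow_ker_ode s x' y))
    (is_derive1_cst (W y) s).
  have dh : is_derive s 1 (Q N) _ :=
    is_derive1_sum (index_enum 'I_N) predT (fun y : 'I_N => h y).
  apply: is_derive_eq dh _.
  rewrite /bd -flow_op_antisym ?gt_eqF//.
  by apply: eq_bigr => y _; rewrite mulr0 addr0.
have [M [q [M0 q0 q1 hM]]] := flow_ker_geometric `|b| x.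
have [M' [q' [M'0 q'0 q'1 hM']]] := flow_ker_geometric `|b| x'.
(* Bound for the boundary flux: the factor [n.+1] comes from the coefficients of [A], and the
   geometric decay beats it. *)
pose K n := (c + lam + sig) * (M * (n.+1%:R * q ^+ n) + M' * (n.+1%:R * q' ^+ n)).
have hbd n s : `|s| <= `|b| -> `|bd n.+1 s| <= K n.
  move=> hs.
  have hq (z : R) : 0 < z -> z < 1 -> z ^+ n.+1 <= z ^+ n.
    by move=> z0 z1; rewrite exprS ler_piMl ?exprn_ge0 ?(ltW z0) ?(ltW z1).
  have a1 := hM s n hs; have a2 := hM s n.+1 hs.
  have a3 := hM' s n hs; have a4 := hM' s n.+1 hs.
  have {}a2 : E s x n.+1 ^+ 2 * W n.+1 <= M * q ^+ n.
    by rewrite (le_trans a2)// ler_pM2l// hq.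
  have {}a4 : E s x' n.+1 ^+ 2 * W n.+1 <= M' * q' ^+ n.
    by rewrite (le_trans a4)// ler_pM2l// hq.
  have eW := wtS lam sig n (lt0r_neq0 c0).
  have w1 := wt_gt0_nneg n; have w2 := wt_gt0_nneg n.+1.
  have cw : 0 <= c * n.+1%:R * W n.+1.
    exact: mulr_ge0 (mulr_ge0 (ltW c0) (ler0n _ _)) (ltW w2).
  rewrite /bd normrN /= normrM (ger0_norm cw).
  set g := E s x n in a1 *; set g' := E s x n.+1 in a2 *.
  set h := E s x' n in a3 *; set h' := E s x' n.+1 in a4 *.
  have p (u v : R) : `|u * v| <= u ^+ 2 + v ^+ 2.
    rewrite normrM -(real_normK (num_real u)) -(real_normK (num_real v)).
    by have := normr_ge0 u; have := normr_ge0 v; nra.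
  apply: (@le_trans _ _ (c * n.+1%:R * W n.+1 * (g' ^+ 2 + h ^+ 2 + (g ^+ 2 + h' ^+ 2)))).
    rewrite (ler_wpM2l cw)//.
    by apply: (le_trans (ler_normD _ _)); apply: lerD.
  have n0 : 0 <= n%:R :> R by [].
  rewrite (_ : _ * _ = c * n.+1%:R * (g' ^+ 2 * W n.+1) + c * n.+1%:R * (h' ^+ 2 * W n.+1) +
    (c * n.+1%:R * W n.+1) * (g ^+ 2 + h ^+ 2)); last ring.
  (* The squares taken at [n] carry the weight at [n.+1]; [wtS] moves it to [n]. *)
  rewrite eW (_ : _ * W n * _ = (lam + sig * n%:R) * (g ^+ 2 * W n) + (lam + sig * n%:R) * (h ^+ 2 * W n)); last ring.
  have r1 : lam + sig * n%:R <= (lam + sig) * n.+1%:R.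
    have l0 := mulr_ge0 (ltW lam0) n0.
    rewrite -subr_ge0 -[n.+1%:R]natr1 (_ : _ - _ = lam * n%:R + sig) ?addr_ge0//.
    by ring.
  have r0 := rate_gt0 n.
  have cn : 0 <= c * n.+1%:R by rewrite mulr_ge0// ltW.
  have b1 : 0 <= g ^+ 2 * W n by exact: mulr_ge0 (sqr_ge0 _) (ltW w1).
  have b3 : 0 <= h ^+ 2 * W n by exact: mulr_ge0 (sqr_ge0 _) (ltW w1).
  have ls : 0 <= (lam + sig) * n.+1%:R by rewrite mulr_ge0// addr_ge0// ltW.
  apply: (@le_trans _ _ (c * n.+1%:R * (M * q ^+ n) + c * n.+1%:R * (M' * q' ^+ n) +
     ((lam + sig) * n.+1%:R * (M * q ^+ n) + (lam + sig) * n.+1%:R * (M' * q' ^+ n)))).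
    have b2 : 0 <= g' ^+ 2 * W n.+1 by exact: mulr_ge0 (sqr_ge0 _) (ltW w2).
    have b4 : 0 <= h' ^+ 2 * W n.+1 by exact: mulr_ge0 (sqr_ge0 _) (ltW w2).
    by apply: lerD; apply: lerD; apply: ler_pM => //; exact: ltW.
  by rewrite /K; rewrite le_eqVlt; apply/orP; left; apply/eqP; ring.
have main n : `|Q n.+1 b - Q n.+1 0| <= `|b| * K n.
  have dK s : is_derive s 1 (fun t : R => K n * t) (K n).
    by apply: is_derive_eq (is_derive1_cmul _ (is_derive1_id s)) _; rewrite mulr1.
  have [b_ge0|b_lt0] := leP 0 b.
    apply: (le_trans (@ler_derive_bound _ (Q n.+1) (bd n.+1) (fun t : R => K n * t)
        (fun=> K n) 0 b b_ge0 (fun s _ => dQ n.+1 s) (fun s _ => dK s) _)).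
      by move=> s /andP[s0 sb]; apply: hbd; rewrite !ger0_norm.
    by rewrite mulr0 subr0 mulrC (ger0_norm b_ge0).
  rewrite distrC.
  apply: (le_trans (@ler_derive_bound _ (Q n.+1) (bd n.+1) (fun t : R => K n * t)
      (fun=> K n) b 0 (ltW b_lt0) (fun s _ => dQ n.+1 s) (fun s _ => dK s) _)).
    move=> s /andP[s0 sb]; apply: hbd.
    by rewrite (ltr0_norm b_lt0) ler0_norm// lerN2.
  by rewrite mulr0 sub0r -mulrN mulrC (ltr0_norm b_lt0).
have K0 : (fun n => `|b| * K n) @ \oo --> 0.
  rewrite -(mulr0 `|b|); apply: cvgMr; rewrite /K.
  rewrite -(mulr0 (c + lam + sig)); apply: cvgMr.
  rewrite -[X in _ --> X](addr0 0); apply: cvgD.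
    by rewrite -[X in _ --> X](mulr0 M); apply: cvgMr; exact: natr_geometric_cvg0.
  by rewrite -[X in _ --> X](mulr0 M'); apply: cvgMr; exact: natr_geometric_cvg0.
(* At time 0 the truncated product has its final value as soon as [x < N]. *)
have Q0 N : (x < N)%N -> Q N 0 = (x == x')%:R / W x.
  move=> xN; rewrite /Q /psum (bigD1 (Ordinal xN))//= big1 => [|y /negbTE xy].
    rewrite !flow_ker0// eqxx addr0 mul1r (eq_sym x' x).
    have [->|_] := eqVneq x x'; last by rewrite !(mul0r, mulr0).
    by rewrite mul1r mulfVK// gt_eqF ?wt_gt0_nneg.
  rewrite -val_eqE/= in xy; rewrite flow_ker0// (eq_sym x) xy.
  by rewrite !mul0r.
have hQ : (fun N => Q (N + x.+1)%N b - (x == x')%:R / W x) @ \oo --> 0.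
  have Ks : (fun N => `|b| * K (N + x)%N) @ \oo --> 0.
    by move: K0; rewrite -(cvg_shiftn x).
  have KsN : (fun N => - (`|b| * K (N + x)%N)) @ \oo --> 0.
    by rewrite -(oppr0); exact: cvgN.
  apply: (squeeze_cvgr _ KsN Ks); apply: nearW => N.
  by rewrite -ler_norml -(Q0 (N + x.+1)%N) ?addnS// ltnS leq_addl.
rewrite -(cvg_shiftn x.+1).
apply: (cvgn_ext (u := fun N => (Q (N + x.+1)%N b - (x == x')%:R / W x) + (x == x')%:R / W x)).
  by move=> N; rewrite subrK.
rewrite -[X in _ --> X]add0r; apply: cvgD; [exact: hQ|exact: cvg_cst].
Qed.

Lemma flow_ker_orth_col b y y' : psum (fun x => E b x y * E b x y' * W x) @ \oo -->
  (y == y')%:R / W y.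
Proof.
apply: (cvgn_ext _ (@flow_ker_orth (- b) y y')) => N; apply: eq_bigr => x _.
by rewrite !(flow_ker_sym _ _ _ _ _ (tauN b) (nbN b)).
Qed.

(** [|E| * W * z ^ y] is at most [E ^ 2 * W + W * z ^ (2 y)]; the first part decays and the second
    grows at most geometrically. This is the input for analyticity of the generating function. *)
Lemma flow_ker_gf_bound (z : R) (B : R) x : 0 < z ->
  exists M r : R, [/\ 0 <= M, 1 <= r &
    forall b y, `|b| <= B -> `|E b x y| * (W y * z ^+ y) <= M * r ^+ y].
Proof.
move=> z0; have [M [q [M0 q0 q1 hM]]] := flow_ker_geometric B x.
(* By [wtS], [z ^ 2 * W y.+1 / W y] never exceeds [z ^ 2 * (lam + sig) / c]. *)
pose r := 1 + z ^+ 2 * (lam + sig) / c.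
have r1 : 1 <= r.
  by rewrite lerDl divr_ge0 ?(ltW c0)// mulr_ge0 ?sqr_ge0// addr_ge0// ltW.
have hW y : W y * (z ^+ y) ^+ 2 <= r ^+ y.
  elim: y => [|y IH]; first by rewrite /wt poch0 !expr0 mulr1 divr1 expr1n mulr1.
  have c1 : 0 < c * y.+1%:R by rewrite mulr_gt0.
  rewrite -(ler_pM2l c1) [leLHS](_ : _ = c * y.+1%:R * W y.+1 * (z ^+ 2 * (z ^+ y) ^+ 2)).
    rewrite wtS ?gt_eqF//.
    rewrite [leLHS](_ : _ = (lam + sig * y%:R) * z ^+ 2 * (W y * (z ^+ y) ^+ 2)); last ring.
    rewrite [r ^+ _]exprS [leRHS]mulrA; apply: ler_pM => //.
    - by rewrite mulr_ge0 ?sqr_ge0// ltW.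
    - exact: mulr_ge0 (ltW (wt_gt0_nneg _)) (sqr_ge0 _).
    apply: (@le_trans _ _ ((lam + sig) * y.+1%:R * z ^+ 2)).
      rewrite ler_wpM2r ?sqr_ge0// -subr_ge0 -[y.+1%:R]natr1.
      rewrite (_ : _ - _ = lam * y%:R + sig); last ring.
      by rewrite addr_ge0// mulr_ge0// ltW.
    rewrite (_ : c * _ * r = (lam + sig) * y.+1%:R * z ^+ 2 + c * y.+1%:R); last first.
      by rewrite /r; field; rewrite gt_eqF.
    by rewrite lerDl ltW.
  by rewrite [z ^+ y.+1]exprS; ring.
exists (M + 1), r; split => //; first by rewrite addr_ge0// ltW.
move=> b y /(hM b y) h.
have wz : 0 <= W y * z ^+ y by rewrite (mulr_ge0 (ltW (wt_gt0_nneg _)))// exprn_ge0// ltW.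
apply: (@le_trans _ _ (E b x y ^+ 2 * W y + W y * (z ^+ y) ^+ 2)).
  rewrite -(real_normK (num_real (E b x y))).
  have := normr_ge0 (E b x y); have := wt_gt0_nneg y; have := exprn_gt0 y z0.
  move: (`|E b x y|) (W y) (z ^+ y) => u v t t0 v0 u0.
  rewrite -subr_ge0 (_ : _ - _ = v * (u ^+ 2 - u * t + t ^+ 2)); last ring.
  by apply: mulr_ge0; [exact: ltW|nra].
rewrite mulrDl mul1r; apply: lerD => //; apply: (le_trans h).
rewrite ler_wpM2l ?(ltW M0)//; apply: (@le_trans _ _ 1).
  by rewrite exprn_ile1 ?ltW.
by rewrite exprn_ege1.
Qed.

End Orthogonality.

(** * Analyticity and uniqueness of the flow *)

Section Taylor.
Context {R : realType}.

(** Here [h] lists successive derivatives. By induction on the order: the derivative of the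
    remainder of [h 0] is a remainder of [h 1], whose bound is integrated by [ler_derive_bound]. *)
Lemma taylor_bound_right (M : nat) (h : nat -> R -> R) (b0 b D : R) : b0 <= b ->
  (forall m (s : R), is_derive s 1 (h m) (h m.+1 s)) ->
  (forall s, b0 <= s <= b -> `|h M s| <= D) ->
  `|h 0 b - \sum_(m < M) h m b0 * (b - b0) ^+ m / m`!%:R| <=
    D * (b - b0) ^+ M / M`!%:R.
Proof.
elim: M h b => [|M IH] h b bb dh hD.
  by rewrite big_ord0 subr0 expr0 mulr1 divr1; apply: hD; rewrite bb lexx.
pose f s := h 0 s - \sum_(m < M.+1) h m b0 * (s - b0) ^+ m / m`!%:R.
pose df s := h 1 s - \sum_(m < M) h m.+1 b0 * (s - b0) ^+ m / m`!%:R.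
pose Bf s := D * (s - b0) ^+ M.+1 / M.+1`!%:R.
pose dB s := D * (s - b0) ^+ M / M`!%:R.
have dp (s a : R) m : is_derive s 1 (fun s => a * (s - b0) ^+ m.+1 / m.+1`!%:R)
    (a * (s - b0) ^+ m / m`!%:R).
  have h1 := is_derive1_exprn m.+1 (is_derive1_add (is_derive1_id s) (is_derive1_cst (- b0) s)).
  have h2 := is_derive1_mul (is_derive1_cmul a h1) (is_derive1_cst (m.+1`!%:R^-1) s).
  apply: is_derive_eq h2 _; rewrite /= factS natrM addr0 mulr0 addr0 mulr1.
  have f0 : (m`!%:R : R) != 0 by rewrite pnatr_eq0 -lt0n fact_gt0.
  have m0 : (m.+1%:R : R) != 0 by rewrite pnatr_eq0.
  move: (m.+1%:R) (m`!%:R) ((s - b0) ^+ m) f0 m0 => u v w v0 u0.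
  by field; rewrite u0 v0.
have df' (s : R) : is_derive s 1 f (df s).
  have hs := is_derive1_sum (index_enum 'I_M) predT (fun m : 'I_M => dp s (h m.+1 b0) m).
  have hh := is_derive1_add (dh 0%N s) (is_derive1_opp
    (is_derive1_add (is_derive1_cst (h 0%N b0 * 1 / 0`!%:R) s) hs)).
  rewrite (_ : f = fun s => h 0%N s - (h 0%N b0 * 1 / 0`!%:R +
      \sum_(m < M) h m.+1 b0 * (s - b0) ^+ m.+1 / m.+1`!%:R)); last first.
    by apply/funext => t; rewrite /f big_ord_recl expr0.
  by apply: is_derive_eq hh _; rewrite add0r.
have f0 : f b0 = 0.
  rewrite /f big_ord_recl /= expr0 mulr1 divr1 big1 ?addr0 ?subrr// => i _.
  by rewrite ?subrr /bump /= expr0n mulr0 mul0r.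
have B0 : Bf b0 = 0 by rewrite /Bf subrr expr0n mulr0 mul0r.
have := @ler_derive_bound _ f df Bf dB b0 b bb (fun s _ => df' s) (fun s _ => dp s D M).
rewrite f0 B0 !subr0; apply => s /andP[s1 s2].
apply: (IH (fun m => h m.+1)) => // t /andP[t1 t2].
by apply: hD; rewrite t1 (le_trans t2).
Qed.

Lemma taylor_bound (M : nat) (h : nat -> R -> R) (b0 b D : R) :
  (forall m (s : R), is_derive s 1 (h m) (h m.+1 s)) ->
  (forall s, `|s - b0| <= `|b - b0| -> `|h M s| <= D) ->
  `|h 0 b - \sum_(m < M) h m b0 * (b - b0) ^+ m / m`!%:R| <=
    D * `|b - b0| ^+ M / M`!%:R.
Proof.
move=> dh hD; have [bb|bb] := leP b0 b.
  rewrite (ger0_norm (_ : 0 <= b - b0)) ?subr_ge0//.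
  apply: taylor_bound_right => // s /andP[s1 s2]; apply: hD.
  by rewrite !ger0_norm ?subr_ge0// lerD2r.
(* Reflecting time reduces [b < b0] to the previous lemma; each derivative contributes a sign. *)
pose k m (s : R) := (-1) ^+ m * h m (- s).
have dk m (s : R) : is_derive s 1 (k m) (k m.+1 s).
  have h1 := is_derive1_compose (dh m (- s)) (is_derive1_opp (is_derive1_id s)).
  by apply: is_derive_eq (is_derive1_cmul ((-1) ^+ m) h1) _; rewrite /k exprS; ring.
have := @taylor_bound_right M k (- b0) (- b) D _ dk _.
rewrite lerN2 (ltW bb) => /(_ isT) H.
have {}H := H _; rewrite /k expr0 mul1r opprK in H.
rewrite (ltr0_norm (_ : b - b0 < 0)) ?subr_lt0//.
rewrite (_ : - (b - b0) = - b - - b0); last ring.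
rewrite (eq_bigr (fun m : 'I_M => (-1) ^+ m * h m (- - b0) * (- b - - b0) ^+ m / m`!%:R)).
  apply: H => s /andP[s1 s2]; rewrite normrM normrX normrN1 expr1n mul1r.
  apply: hD; rewrite (ltr0_norm (_ : b - b0 < 0)) ?subr_lt0//.
  by rewrite ler_norml; apply/andP; split; lra.
move=> m _; rewrite !opprK (_ : - b + b0 = (-1) * (b - b0)); last ring.
rewrite exprMn; have : (-1) ^+ m * (-1) ^+ m = 1 :> R by rewrite -exprMn mulrNN mulr1 expr1n.
move: ((-1) ^+ m) => e e2.
rewrite (_ : e * _ * _ / _ = (e * e) * (h m b0 * (b - b0) ^+ m / m`!%:R)); last ring.
by rewrite e2 mul1r.
Qed.

End Taylor.

Section FlowAnalytic.
Context {R : realType}.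
Variables (lam sig c z : R).
Hypotheses (lam0 : 0 < lam) (sig0 : 0 <= sig) (c0 : 0 < c) (z0 : 0 < z).
Local Notation A := (flow_op lam sig c).
Implicit Types (b s : R) (m n N : nat) (f : nat -> R).

Let u n := wt lam sig c n * z ^+ n.

Lemma gfw_gt0 n : 0 < u n.
Proof.
by apply: mulr_gt0; [apply: wt_gt0 => // m _; rewrite ltr_pwDl// mulr_ge0|exact: exprn_gt0].
Qed.

(** After weighting by [u], [wtS] exchanges the weight at [n] for that of a neighbour, and both
    coefficients of [A] become at most linear in [n]. *)
Lemma flow_op_bound : exists2 B : R, 0 <= B & forall f n,
  `|A f n| * u n <= B * n.+1%:R * (`|f n.+1| * u n.+1 + `|f n.-1| * u n.-1).
Proof.
have cz : 0 <= c / z by rewrite divr_ge0 ?ltW.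
have zls : 0 <= z * (lam + sig) by rewrite mulr_ge0 ?(ltW z0)// addr_ge0// ltW.
exists (c / z + z * (lam + sig)); first by rewrite addr_ge0.
move=> f n; have u0 m : 0 <= u m by rewrite ltW ?gfw_gt0.
have r0 m : 0 <= lam + sig * m%:R by rewrite addr_ge0 ?(ltW lam0)// mulr_ge0.
apply: (@le_trans _ _ ((lam + sig * n%:R) * u n * `|f n.+1| + c * n%:R * u n * `|f n.-1|)).
  rewrite /flow_op; apply: (@le_trans _ _ (((lam + sig * n%:R) * `|f n.+1| + c * n%:R * `|f n.-1|) * u n)).
    rewrite ler_wpM2r//; apply: (le_trans (ler_normD _ _)); apply: lerD.
      by rewrite normrM normrN (ger0_norm (r0 n)).
    by rewrite normrM (ger0_norm (mulr_ge0 (ltW c0) (ler0n _ n))).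
  by rewrite mulrDl; apply: lerD; rewrite le_eqVlt; apply/orP; left; apply/eqP; ring.
have e1 : (lam + sig * n%:R) * u n = c / z * n.+1%:R * u n.+1.
  rewrite /u mulrA -wtS ?gt_eqF// exprS; field; exact: lt0r_neq0.
have e2 : c * n%:R * u n <= z * (lam + sig) * n.+1%:R * u n.-1.
  case: n {e1} => [|n] /=.
    by rewrite mulr0 mul0r; apply: mulr_ge0 => //; apply: mulr_ge0.
  rewrite /u mulrA wtS ?gt_eqF// exprS.
  rewrite (_ : _ * _ * _ = z * (lam + sig * n%:R) * u n); last by rewrite /u; ring.
  rewrite -/(u n); apply: ler_wpM2r => //; rewrite -[leRHS]mulrA ler_pM2l//.
  rewrite -subr_ge0 -[n.+2%:R]natr1 -[n.+1%:R]natr1.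
  rewrite (_ : _ - _ = lam * n%:R + lam + sig + sig); last ring.
  by rewrite !addr_ge0// ?(ltW lam0)// mulr_ge0// ltW.
rewrite {}e1.
have {}e2 : c * n%:R * u n * `|f n.-1| <= z * (lam + sig) * n.+1%:R * u n.-1 * `|f n.-1|.
  exact: ler_wpM2r.
apply: (le_trans (lerD (lexx _) e2)).
have p1 : 0 <= u n.+1 * `|f n.+1| by rewrite mulr_ge0.
have p2 : 0 <= u n.-1 * `|f n.-1| by rewrite mulr_ge0.
rewrite -subr_ge0 (_ : _ - _ = z * (lam + sig) * n.+1%:R * (u n.+1 * `|f n.+1|) +
   c / z * n.+1%:R * (u n.-1 * `|f n.-1|)); last ring.
by apply: addr_ge0; apply: mulr_ge0 => //; apply: mulr_ge0.
Qed.

(** Each application costs a factor linear in the index, so [m] of them cost [(n + m)! / n!].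
    Divided by [m!] this is a binomial coefficient, at most [2 ^ (n + m)]: hence the ratio [2 * r],
    and a Taylor series in time with positive radius. *)
Lemma iter_flow_op_bound (r : R) : 1 <= r -> exists2 K : R, 0 < K & forall (M : R) f,
  0 <= M -> (forall n, `|f n| * u n <= M * r ^+ n) ->
  forall m n, `|iter m A f n| * u n / m`!%:R <= M * K ^+ m * (2 * r) ^+ n.
Proof.
move=> r1; have [B B0 hB] := flow_op_bound; have r0 : 0 < r by lra.
pose K := (B * (r + 1)); have K0 : 0 <= K by rewrite mulr_ge0// addr_ge0// ltW.
exists (2 * K + 1); first by rewrite ltr_wpDl// mulr_ge0.
move=> M f M0 hf.
pose F m n : R := (n + m)`!%:R / n`!%:R.
have factp n : 0 < n`!%:R :> R by rewrite ltr0n fact_gt0.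
have F0 m n : 0 <= F m n by rewrite divr_ge0.
have main m n : `|iter m A f n| * u n <= M * K ^+ m * r ^+ n * F m n.
  elim: m n => [|m IH] n.
    by rewrite /F addn0 divff ?lt0r_neq0// expr0 !mulr1; exact: hf.
  rewrite iterS; apply: (le_trans (hB _ _)).
  apply: (@le_trans _ _ (B * n.+1%:R * (M * K ^+ m * r ^+ n.+1 * F m n.+1 +
      M * K ^+ m * r ^+ n.-1 * F m n.-1))).
    by apply: ler_wpM2l; [rewrite mulr_ge0|apply: lerD].
  have h1 : n.+1%:R * F m n.+1 = F m.+1 n.
    rewrite /F addSnnS factS natrM; field.
    by rewrite lt0r_neq0// lt0r_neq0.
  have h2 : n.+1%:R * (r ^+ n.-1 * F m n.-1) <= r ^+ n * F m.+1 n.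
    case: n {h1} => [|n] /=.
      rewrite expr0 !mul1r /F !add0n fact0 !divr1 factS natrM ler_peMl//.
      by rewrite ler1n.
    have rr : r ^+ n <= r ^+ n.+1 by rewrite exprS ler_peMl// exprn_ge0// ltW.
    have -> : F m.+1 n.+1 = (n + m).+2%:R * (n + m).+1%:R / n.+1%:R * F m n.
      rewrite /F (_ : (n.+1 + m.+1 = (n + m).+2)%N); last by rewrite addSn addnS.
      rewrite !factS !natrM; field.
      by rewrite lt0r_neq0// lt0r_neq0.
    rewrite mulrCA [leRHS]mulrA mulrA ler_wpM2r//; apply: ler_pM => //.
      by rewrite exprn_ge0// ltW.
    by rewrite ler_pdivlMr// -!natrM ler_nat leq_mul// !ltnS leq_addr.
  have bk : 0 <= B * (M * K ^+ m) by rewrite !mulr_ge0// exprn_ge0.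
  rewrite [leLHS](_ : _ = B * (M * K ^+ m) * (r ^+ n.+1 * (n.+1%:R * F m n.+1)) +
      B * (M * K ^+ m) * (n.+1%:R * (r ^+ n.-1 * F m n.-1))); last ring.
  rewrite h1; apply: (le_trans (lerD (lexx _) (ler_wpM2l bk h2))).
  by rewrite /K !exprS le_eqVlt; apply/orP; left; apply/eqP; ring.
move=> m n; rewrite ler_pdivrMr//; apply: (le_trans (main m n)).
have hF : F m n <= 2 ^+ (n + m) * m`!%:R.
  have -> : F m n = 'C(n + m, m)%:R * m`!%:R.
    rewrite /F -(bin_fact (leq_addl n m)) addnK !natrM; field.
    by rewrite lt0r_neq0.
  rewrite ler_wpM2r//; have := @bin_geometric R 1 1 m (n + m) ler01 ltr01.
  by rewrite !expr1n invr1 mulr1 mul1r.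
apply: (@le_trans _ _ (M * K ^+ m * r ^+ n * (2 ^+ (n + m) * m`!%:R))).
  by apply: ler_wpM2l => //; rewrite !mulr_ge0 ?exprn_ge0 ?(ltW r0).
rewrite mulrA; apply: ler_wpM2r => //.
apply: (@le_trans _ _ (M * (2 * K) ^+ m * (2 * r) ^+ n)).
  by rewrite exprD !exprMn le_eqVlt; apply/orP; left; apply/eqP; ring.
apply: ler_wpM2r; first by rewrite exprn_ge0// mulr_ge0// ltW.
apply: ler_wpM2l => //; have k2 : 0 <= 2 * K by rewrite mulr_ge0.
apply: lerXn2r; rewrite ?nnegrE ?addr_ge0//.
by rewrite lerDl.
Qed.

End FlowAnalytic.

(** * Joint power series expansion of the generating function *)

Section FlowExpansion.
Context {R : realType}.
Variables (lam sig c z : R).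
Hypotheses (lam0 : 0 < lam) (sig0 : 0 <= sig) (c0 : 0 < c) (z0 : 0 < z).
Local Notation A := (flow_op lam sig c).
Implicit Types (b s : R) (m n N : nat) (f : nat -> R).

Let u n := wt lam sig c n * z ^+ n.

Lemma flow_op_derive (F : R -> nat -> R) (dF : nat -> R) s n :
  (forall n, is_derive s 1 (F^~ n) (dF n)) ->
  is_derive s 1 (fun s => A (F s) n) (A dF n).
Proof.
move=> dFs; rewrite /flow_op.
exact: (is_derive1_add (is_derive1_cmul _ (dFs n.+1)) (is_derive1_cmul _ (dFs n.-1))).
Qed.

Lemma near_box (b0 t0 d e : R) (Q : R -> R -> Prop) : 0 < d -> 0 < e ->
  (forall b t : R, `|b - b0| < d -> `|t - t0| < e -> Q b t) ->
  \forall x \near ((b0, t0) : R * R), Q x.1 x.2.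
Proof.
move=> d0 e0 h; exists (ball b0 d, ball t0 e).
  by split; exact: nbhsx_ballx.
by move=> [b t] [/= hb ht]; apply: h; rewrite distrC.
Qed.

Lemma geometric_sum_le (q : R) N : 0 <= q -> q <= 2^-1 ->
  \sum_(m < N) q ^+ m <= 2.
Proof.
move=> q0 q1; suff : \sum_(m < N) q ^+ m <= 2 - 2^-1 ^+ N * 2.
  by move=> /le_trans; apply; rewrite gerBl mulr_ge0// exprn_ge0// invr_ge0.
elim: N => [|N IH]; first by rewrite big_ord0 expr0 mul1r subrr.
rewrite big_ord_recr /= exprS.
have : q ^+ N <= 2^-1 ^+ N by rewrite lerXn2r// nnegrE// invr_ge0.
by move: (2^-1 ^+ N) (q ^+ N) IH => x y; lra.
Qed.

Lemma half_pow_cvg0 (a : R) : (fun N => a * 2^-1 ^+ N) @ \oo --> 0.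
Proof.
rewrite -(mulr0 a); apply: cvgMr; apply: cvg_expr.
by rewrite ger0_norm ?invr_ge0// invf_lt1// ltr1n.
Qed.

Definition flow_gf (g : R -> nat -> R) b t : R :=
  limn (psum (fun n => g b n * (u n * t ^+ n))).

Definition flow_coef (g : R -> nat -> R) b0 m n : R :=
  iter m A (g b0) n * u n / m`!%:R.

(* The Taylor coefficients at [b0] are those of [exp((b - b0) A) g_b0]; the
   growth of [A^m] is controlled by [iter_flow_op_bound]. *)
Lemma flow_expansion (g : R -> nat -> R) :
  (forall b n, is_derive b 1 (g^~ n) (A (g b) n)) ->
  (forall B : R, exists M r : R, [/\ 0 <= M, 1 <= r &
     forall b n, `|b| <= B -> `|g b n| * u n <= M * r ^+ n]) ->
  forall b0, \forall x \near ((b0, 0) : R * R),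
    [/\ exists M : R, forall N, \sum_(m < N) \sum_(n < N)
         `|flow_coef g b0 m n| * `|x.1 - b0| ^+ m * `|x.2| ^+ n <= M,
      (fun N => \sum_(m < N) \sum_(n < N)
         flow_coef g b0 m n * ((x.1 - b0) ^+ m * x.2 ^+ n)) @ \oo --> flow_gf g x.1 x.2 &
      psum (fun n => g x.1 n * (u n * x.2 ^+ n)) @ \oo --> flow_gf g x.1 x.2].
Proof.
move=> dg gB b0; have [M [r [M0 r1 hM]]] := gB (`|b0| + 1).
have [K K0 hK] := iter_flow_op_bound lam0 sig0 c0 z0 r1.
have r0 : 0 < r by lra.
(* These radii give [K * |b - b0| <= 1/2] and [2 * r * |t| <= 1/2]; the bound 1 keeps [b] in the
   interval on which [M] and [r] are valid. *)
pose d := Num.min 1 (2 * K)^-1; pose e := (4 * r)^-1.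
have d0 : 0 < d by rewrite /d lt_min ltr01 invr_gt0 mulr_gt0.
have e0 : 0 < e by rewrite /e invr_gt0 mulr_gt0.
apply: (near_box d0 e0 (Q := fun b t => [/\ exists M : R, forall N, \sum_(m < N) \sum_(n < N)
         `|flow_coef g b0 m n| * `|b - b0| ^+ m * `|t| ^+ n <= M,
      (fun N => \sum_(m < N) \sum_(n < N)
         flow_coef g b0 m n * ((b - b0) ^+ m * t ^+ n)) @ \oo --> flow_gf g b t &
      psum (fun n => g b n * (u n * t ^+ n)) @ \oo --> flow_gf g b t])).
move=> b t hb; rewrite subr0 => ht.
have b1 : `|b - b0| <= 1 by rewrite ltW// (lt_le_trans hb)// /d ge_min lexx.
have bK : K * `|b - b0| <= 2^-1.
  rewrite -(ler_pM2l (_ : 0 < 2))// mulfV ?lt0r_neq0// mulrA -ler_pdivlMl ?mulr_gt0//.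
  by rewrite mulr1 ltW// (lt_le_trans hb)// /d ge_min lexx orbT.
have tr : 2 * r * `|t| <= 2^-1.
  rewrite -(ler_pM2l (_ : 0 < 2))// mulfV ?lt0r_neq0// !mulrA -ler_pdivlMl ?mulr_gt0//.
  rewrite mulr1 ltW// (lt_le_trans ht)// /e lef_pV2 ?posrE ?mulr_gt0//.
  by rewrite ler_pM2r//; lra.
have u0 n : 0 < u n by exact: gfw_gt0.
have small s : `|s - b0| <= `|b - b0| -> `|s| <= `|b0| + 1.
  move=> h; rewrite -(subrK b0 s) addrC; apply: (le_trans (ler_normD _ _)).
  by rewrite lerD2l (le_trans h).
have fact_gt m : 0 < m`!%:R :> R by rewrite ltr0n fact_gt0.
have cB m n : `|flow_coef g b0 m n| * `|b - b0| ^+ m * `|t| ^+ n <= M * 2^-1 ^+ m * 2^-1 ^+ n.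
  have h : `|flow_coef g b0 m n| <= M * K ^+ m * (2 * r) ^+ n.
    rewrite /flow_coef normrM normrM (gtr0_norm (u0 n)) normfV (gtr0_norm (fact_gt m)).
    by apply: hK => // k; apply: hM; rewrite lerDl.
  apply: (@le_trans _ _ (M * K ^+ m * (2 * r) ^+ n * `|b - b0| ^+ m * `|t| ^+ n)).
    by rewrite !ler_wpM2r// exprn_ge0.
  rewrite (_ : _ * _ = M * (K * `|b - b0|) ^+ m * (2 * r * `|t|) ^+ n); last first.
    by rewrite !exprMn; ring.
  have p1 : 0 <= K * `|b - b0| by rewrite mulr_ge0// ltW.
  have p2 : 0 <= 2 * r * `|t| by rewrite !mulr_ge0// ltW.
  apply: ler_pM; rewrite ?mulr_ge0 ?exprn_ge0//.
    by rewrite ler_wpM2l// lerXn2r ?nnegrE// invr_ge0.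
  by rewrite lerXn2r ?nnegrE// invr_ge0.
have gc : cvgn (psum (fun n => g b n * (u n * t ^+ n))).
  apply: (psum_norm_cvg (v := fun n => M * 2^-1 ^+ n)).
    move=> n; rewrite normrM normrM (gtr0_norm (u0 n)) normrX mulrA.
    apply: (@le_trans _ _ (M * r ^+ n * `|t| ^+ n)).
      by rewrite ler_wpM2r ?exprn_ge0//; apply: hM; exact: small.
    rewrite -mulrA -exprMn ler_wpM2l// lerXn2r ?nnegrE ?mulr_ge0 ?(ltW r0) ?invr_ge0//.
    apply: le_trans tr; rewrite -mulrA ler_peMl ?mulr_ge0 ?(ltW r0)//; lra.
  apply: (psum_bounded_cvg (B := M * 2)).
    by move=> n; rewrite mulr_ge0// exprn_ge0// invr_ge0.
  move=> N; rewrite psumZ ler_wpM2l//; exact: geometric_sum_le.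
split.
- exists (M * 2 * 2) => N.
  apply: (@le_trans _ _ (\sum_(m < N) \sum_(n < N) M * 2^-1 ^+ m * 2^-1 ^+ n)).
    by apply: ler_sum => m _; apply: ler_sum => n _.
  have half0 : 0 <= 2^-1 :> R by rewrite invr_ge0.
  apply: (@le_trans _ _ (\sum_(m < N) M * 2^-1 ^+ m * 2)).
    apply: ler_sum => m _; rewrite -mulr_sumr ler_wpM2l//.
      by rewrite mulr_ge0// exprn_ge0.
    exact: geometric_sum_le.
  by rewrite -mulr_suml -mulr_sumr ler_wpM2r// ler_wpM2l// geometric_sum_le.
- pose S N := \sum_(m < N) \sum_(n < N) flow_coef g b0 m n * ((b - b0) ^+ m * t ^+ n).
  pose h m n s := iter m A (g s) n.
  have dh n m s : is_derive s 1 (h m n) (h m.+1 n s).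
    elim: m n s => [|m IH] n s; first exact: dg.
    exact: (@flow_op_derive (fun s => iter m A (g s)) (iter m.+1 A (g s))).
  (* The weighted Taylor remainder is geometric in [N] and in [n] at once, so the square partial
     sums of the double series follow those of the generating function. *)
  have rem N n : `|(g b n - \sum_(m < N) h m n b0 * (b - b0) ^+ m / m`!%:R) * (u n * t ^+ n)| <=
      M * 2^-1 ^+ N * 2^-1 ^+ n.
    pose D := M * K ^+ N * (2 * r) ^+ n * N`!%:R / u n.
    have hD s : `|s - b0| <= `|b - b0| -> `|h N n s| <= D.
      move=> /small hs; rewrite /D ler_pdivlMr// -ler_pdivrMr//.
      by apply: hK => // k; exact: hM.
    have := @taylor_bound _ N (fun m => h m n) b0 b D (fun m s => dh n m s) hD.
    rewrite {1}/h /= => hT.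
    rewrite normrM normrM (gtr0_norm (u0 n)) normrX.
    apply: (@le_trans _ _ (D * `|b - b0| ^+ N / N`!%:R * (u n * `|t| ^+ n))).
      by rewrite ler_wpM2r// mulr_ge0 ?exprn_ge0// ltW.
    rewrite (_ : _ * _ = M * (K * `|b - b0|) ^+ N * (2 * r * `|t|) ^+ n); last first.
      rewrite /D !exprMn; have := lt0r_neq0 (fact_gt N); have := lt0r_neq0 (u0 n).
      move: (N`!%:R) (u n) => v w w0 v0; field; by rewrite v0 w0.
    have p1 : 0 <= K * `|b - b0| by rewrite mulr_ge0// ltW.
    have p2 : 0 <= 2 * r * `|t| by rewrite !mulr_ge0// ltW.
    apply: ler_pM; rewrite ?mulr_ge0 ?exprn_ge0//.
      by rewrite ler_wpM2l// lerXn2r ?nnegrE// invr_ge0.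
    by rewrite lerXn2r ?nnegrE// invr_ge0.
  have diff N : `|psum (fun n => g b n * (u n * t ^+ n)) N - S N| <= M * 2 * 2^-1 ^+ N.
    have -> : S N = psum (fun n => (\sum_(m < N) h m n b0 * (b - b0) ^+ m / m`!%:R) * (u n * t ^+ n)) N.
      rewrite /S exchange_big; apply: eq_bigr => n _; rewrite mulr_suml.
      by apply: eq_bigr => m _; rewrite /flow_coef /h; ring.
    rewrite /psum -sumrB; apply: (le_trans (ler_norm_sum _ _ _)).
    apply: (@le_trans _ _ (\sum_(n < N) M * 2^-1 ^+ N * 2^-1 ^+ n)).
      by apply: ler_sum => n _; rewrite -mulrBl.
    rewrite -mulr_sumr (_ : M * 2 * _ = M * 2^-1 ^+ N * 2); last ring.
    rewrite ler_wpM2l ?mulr_ge0 ?exprn_ge0 ?invr_ge0//.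
    by apply: geometric_sum_le; rewrite ?invr_ge0.
  have d1 := half_pow_cvg0 (M * 2).
  have d2 : (fun N => - (M * 2 * 2^-1 ^+ N)) @ \oo --> 0.
    by rewrite -[X in _ --> X]oppr0; exact: cvgN.
  have d3 : (fun N => psum (fun n => g b n * (u n * t ^+ n)) N - S N) @ \oo --> 0.
    apply: (squeeze_cvgr _ d2 d1); apply: nearW => N.
    by rewrite -ler_norml diff.
  apply: (cvgn_ext (u := fun N => psum (fun n => g b n * (u n * t ^+ n)) N -
      (psum (fun n => g b n * (u n * t ^+ n)) N - S N))).
    by move=> N; rewrite opprB addrC subrK.
  by rewrite -[X in _ --> X]subr0; apply: cvgB.
- by [].
Qed.

End FlowExpansion.

Section FlatSeries.
Context {R : realType}.

(** Once the coefficients below [m] vanish, flatness of order [m + 1] yields [|a m| <= K * x] for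
    all small positive [x]. *)
Lemma flat_pseries_eq0 (a : nat -> R) (phi : R -> R) (r M : R) : 0 < r ->
  (forall m, `|a m| * r ^+ m <= M) ->
  (forall x, `|x| <= r / 2 -> psum (fun m => a m * x ^+ m) @ \oo --> phi x) ->
  (forall k, exists C : R, forall x, `|x| <= r / 2 -> `|phi x| <= C * `|x| ^+ k) ->
  forall m, a m = 0.
Proof.
move=> r0 aM aphi flat m; elim/ltn_ind: m => m IH.
have M0 : 0 <= M by apply: le_trans (aM 0%N); rewrite mulr_ge0// exprn_ge0// ltW.
have [C hC] := flat m.+1.
pose K := C + 2 * M * r ^- m.+1.
have bnd x : 0 < x -> x <= r / 2 -> `|a m| <= K * x.
  move=> x0 xr; have hx : `|x| <= r / 2 by rewrite gtr0_norm.
  pose q := x / r; have q0 : 0 <= q by rewrite divr_ge0 ?ltW.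
  have q1 : q <= 2^-1 by rewrite /q ler_pdivrMr// mulrC.
  have tail : `|phi x - a m * x ^+ m| <= 2 * M * q ^+ m.+1.
    have h : (fun k => `|\sum_(j < k) a (m.+1 + j)%N * x ^+ (m.+1 + j)|) @ \oo -->
        `|phi x - a m * x ^+ m|.
      apply: cvg_norm.
      have h1 : (fun k => psum (fun m => a m * x ^+ m) (k + m.+1)%N - a m * x ^+ m) @ \oo
          --> phi x - a m * x ^+ m.
        apply: cvgB; last exact: cvg_cst.
        by have := aphi x hx; rewrite -(cvg_shiftn m.+1).
      apply: cvgn_ext h1 => k; rewrite /psum addnC big_split_ord /= big_ord_recr /=.
      rewrite big1 => [|i _]; last by rewrite IH ?ltn_ord// mul0r.
      by rewrite add0r [a m * _ + _]addrC addrK.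
    apply: cvgn_le h _ => k; apply: (le_trans (ler_norm_sum _ _ _)).
    apply: (@le_trans _ _ (\sum_(j < k) M * q ^+ m.+1 * q ^+ j)).
      apply: ler_sum => j _; rewrite normrM normrX (gtr0_norm x0) -mulrA -exprD.
      rewrite (_ : x = q * r); last by rewrite /q divfK// gt_eqF.
      rewrite exprMn mulrCA mulrC ler_wpM2r ?exprn_ge0//.
    rewrite -mulr_sumr (_ : 2 * M * _ = M * q ^+ m.+1 * 2); last ring.
    by rewrite ler_wpM2l ?mulr_ge0 ?exprn_ge0// geometric_sum_le.
  rewrite -(ler_pM2r (_ : 0 < x ^+ m)) ?exprn_gt0//.
  rewrite -[X in _ * X](gtr0_norm (exprn_gt0 m x0)) -normrM.
  rewrite (_ : a m * x ^+ m = phi x - (phi x - a m * x ^+ m)); last ring.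
  apply: (le_trans (ler_normB _ _)); apply: (le_trans (lerD (hC x hx) tail)).
  rewrite (gtr0_norm x0) /K /q expr_div_n.
  by rewrite le_eqVlt; apply/orP; left; apply/eqP; rewrite exprS; ring.
apply/eqP; rewrite -normr_le0; apply/ler_addgt0Pl => e e0; rewrite addr0.
have K1 : 0 < `|K| + 1 by rewrite ltr_pwDr.
pose x := Num.min (r / 2) (e / (`|K| + 1)).
have x0 : 0 < x by rewrite /x lt_min !divr_gt0.
apply: (le_trans (bnd x x0 _)); first by rewrite /x ge_min lexx.
apply: (@le_trans _ _ ((`|K| + 1) * x)).
  by rewrite ler_pM2r// (le_trans (ler_norm K))// lerDl.
by rewrite mulrC -ler_pdivlMr// /x ge_min lexx orbT.
Qed.

End FlatSeries.

(** * An analytic solution with zero initial value vanishes *)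

Section FlowUniqueness.
Context {R : realType}.
Variables (lam sig c : R) (u : nat -> R).
Hypothesis u0 : forall n, 0 < u n.
Local Notation A := (flow_op lam sig c).
Implicit Types (b s : R) (m n N : nat) (f : nat -> R).

Variables (D : R -> nat -> R) (G : R -> R -> R).
Hypothesis dD : forall b n, is_derive b 1 (D^~ n) (A (D b) n).

(** The two series share the sum [G]: the double one expresses analyticity, the single one the link
    with the coordinates of [D]. *)
Definition expansion_at (b0 : R) (cf : nat -> nat -> R) (b t : R) : Prop :=
  [/\ exists M : R, forall N, \sum_(m < N) \sum_(n < N)
         `|cf m n| * `|b - b0| ^+ m * `|t| ^+ n <= M,
      (fun N => \sum_(m < N) \sum_(n < N)
         cf m n * ((b - b0) ^+ m * t ^+ n)) @ \oo --> G b t &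
      psum (fun n => D b n * (u n * t ^+ n)) @ \oo --> G b t].

Lemma near_box_ex (b0 t0 : R) (Q : R -> R -> Prop) :
  (\forall x \near ((b0, t0) : R * R), Q x.1 x.2) ->
  exists2 e : R, 0 < e & forall b t : R, `|b - b0| <= e -> `|t - t0| <= e -> Q b t.
Proof.
move=> [[/= U V] [/nbhs_ballP[d /= d0 dU] /nbhs_ballP[e /= e0 eV]] UV].
exists (Num.min d e / 2); first by rewrite divr_gt0// lt_min d0.
have m0 : 0 < Num.min d e by rewrite lt_min d0.
move=> b t hb ht; apply: (UV (b, t)); split => /=.
  apply: dU; rewrite /ball /= distrC; apply: (le_lt_trans hb).
  by apply: (@lt_le_trans _ _ (Num.min d e)); [lra|rewrite ge_min lexx].
apply: eV; rewrite /ball /= distrC; apply: (le_lt_trans ht).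
by apply: (@lt_le_trans _ _ (Num.min d e)); [lra|rewrite ge_min lexx orbT].
Qed.

(** Reorder the double series as a series in [t] with coefficients [s n], power series in [b - b0];
    comparison identifies [s n] with [D b n * u n]. The equation makes these flat at [b0], so all
    [cf] vanish. *)
Lemma flow_zero_local b0 cf :
  (\forall x \near ((b0, 0) : R * R), expansion_at b0 cf x.1 x.2) ->
  (forall n, D b0 n = 0) ->
  exists2 e : R, 0 < e & forall b n, `|b - b0| <= e -> D b n = 0.
Proof.
move=> /near_box_ex[e e0 hQ] Db0; exists (e / 2 / 2); first by rewrite !divr_gt0.
have hQ' x t : `|x| <= e -> `|t| <= e -> expansion_at b0 cf (b0 + x) t.
  by move=> hx ht; apply: hQ; rewrite ?subr0// addrC addKr.
have ee : `|e| <= e by rewrite gtr0_norm.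
have [[M hM] _ _] := hQ' e e ee ee.
(* One term is at most the bounded double sum at the corner [(e, e)]; in the half-size box the terms
   therefore decay geometrically. *)
have cM m n : `|cf m n| * e ^+ m * e ^+ n <= M.
  apply: le_trans (hM (maxn m n).+1).
  have hm : (m < (maxn m n).+1)%N by rewrite ltnS leq_maxl.
  have hn : (n < (maxn m n).+1)%N by rewrite ltnS leq_maxr.
  rewrite (bigD1 (Ordinal hm))//= (bigD1 (Ordinal hn))//=.
  rewrite (addrC b0) addrK (gtr0_norm e0) -addrA lerDl; apply: addr_ge0.
    by apply: sumr_ge0 => i _; rewrite !mulr_ge0 ?exprn_ge0 ?(ltW e0).
  by apply: sumr_ge0 => i _; apply: sumr_ge0 => j _; rewrite !mulr_ge0 ?exprn_ge0 ?(ltW e0).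
have M0 : 0 <= M by apply: le_trans (cM 0%N 0%N); rewrite !mulr_ge0 ?exprn_ge0 ?(ltW e0).
have ce m n : `|cf m n| * e ^+ m <= M * e ^- n by rewrite ler_pdivlMr ?exprn_gt0.
have half x : `|x| <= e / 2 -> `|x| / e <= 2^-1 by move=> h; rewrite ler_pdivrMr// mulrC.
have cx x m n : `|x| <= e / 2 -> `|cf m n * x ^+ m| <= M * e ^- n * 2^-1 ^+ m.
  move=> /half h; rewrite normrM normrX.
  rewrite (_ : `|x| ^+ m = e ^+ m * (`|x| / e) ^+ m); last first.
    by rewrite -exprMn mulrC divfK// gt_eqF.
  rewrite mulrA; apply: ler_pM; rewrite ?mulr_ge0 ?exprn_ge0 ?divr_ge0 ?(ltW e0)//.
  by rewrite lerXn2r ?nnegrE ?divr_ge0 ?(ltW e0).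
have en n : 0 <= M * e ^- n by rewrite mulr_ge0// invr_ge0 exprn_ge0// ltW.
pose s n x := limn (psum (fun m => cf m n * x ^+ m)).
have scvg n x : `|x| <= e / 2 -> psum (fun m => cf m n * x ^+ m) @ \oo --> s n x.
  move=> hx; suff h : cvgn (psum (fun m => cf m n * x ^+ m)) by exact: h.
  apply: (psum_norm_cvg (v := fun m => M * e ^- n * 2^-1 ^+ m)) => [m|]; first exact: cx.
  apply: (psum_bounded_cvg (B := M * e ^- n * 2)) => [m|N].
    by rewrite mulr_ge0// exprn_ge0.
  by rewrite psumZ ler_wpM2l// geometric_sum_le.
have stail n x N : `|x| <= e / 2 ->
    `|s n x - psum (fun m => cf m n * x ^+ m) N| <= M * e ^- n * 2 * 2^-1 ^+ N.
  move=> hx.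
  have h : (fun k => `|psum (fun m => cf m n * x ^+ m) (k + N)%N -
      psum (fun m => cf m n * x ^+ m) N|) @ \oo -->
      `|s n x - psum (fun m => cf m n * x ^+ m) N|.
    apply: cvg_norm; apply: cvgB; last exact: cvg_cst.
    by have := scvg n x hx; rewrite -(cvg_shiftn N).
  apply: cvgn_le h _ => k; rewrite /psum addnC big_split_ord /= [X in X - _]addrC addrK.
  apply: (le_trans (ler_norm_sum _ _ _)).
  apply: (@le_trans _ _ (\sum_(j < k) M * e ^- n * 2^-1 ^+ N * 2^-1 ^+ j)).
    by apply: ler_sum => j _; rewrite -mulrA -exprD; exact: cx.
  rewrite -mulr_sumr (_ : M * e ^- n * 2 * _ = M * e ^- n * 2^-1 ^+ N * 2); last ring.
  apply: ler_wpM2l; last exact: geometric_sum_le.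
  exact: mulr_ge0 (en n) (exprn_ge0 _ _).
have sB n x : `|x| <= e / 2 -> `|s n x| <= M * e ^- n * 2.
  by move=> /(stail n x 0%N); rewrite /psum big_ord0 subr0 expr0 mulr1.
have e2e : e / 2 <= e by lra.
have e4e : e / 2 / 2 <= e / 2 by lra.
(* Summing over [m] first: the tails beyond [N] are of order [2^-1 ^ N], so the iterated and the
   square sums have the same limit. *)
have sG x t : `|x| <= e / 2 -> `|t| <= e / 2 ->
    psum (fun n => s n x * t ^+ n) @ \oo --> G (b0 + x) t.
  move=> hx ht; have [_ h _] := hQ' x t (le_trans hx e2e) (le_trans ht e2e).
  rewrite (addrC b0) addrK -(addrC b0) in h.
  pose S N := \sum_(m < N) \sum_(n < N) cf m n * (x ^+ m * t ^+ n).
  have diff N : `|psum (fun n => s n x * t ^+ n) N - S N| <= M * 2 * 2 * 2^-1 ^+ N.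
    have -> : S N = psum (fun n => psum (fun m => cf m n * x ^+ m) N * t ^+ n) N.
      rewrite /S exchange_big; apply: eq_bigr => n _; rewrite mulr_suml.
      by apply: eq_bigr => m _; rewrite mulrA.
    rewrite {1 2}/psum -sumrB; apply: (le_trans (ler_norm_sum _ _ _)).
    apply: (@le_trans _ _ (\sum_(n < N) M * 2 * 2^-1 ^+ N * 2^-1 ^+ n)).
      apply: ler_sum => n _; rewrite -mulrBl normrM normrX.
      apply: (@le_trans _ _ (M * e ^- n * 2 * 2^-1 ^+ N * `|t| ^+ n)).
        by rewrite ler_wpM2r ?exprn_ge0// stail.
      rewrite (_ : _ * _ = M * 2 * 2^-1 ^+ N * (`|t| / e) ^+ n); last first.
        by rewrite expr_div_n; ring.
      rewrite ler_wpM2l ?mulr_ge0 ?exprn_ge0// lerXn2r ?nnegrE ?divr_ge0 ?(ltW e0)//.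
      exact: half.
    rewrite -mulr_sumr (_ : M * 2 * 2 * _ = M * 2 * 2^-1 ^+ N * 2); last ring.
    by rewrite ler_wpM2l ?mulr_ge0 ?exprn_ge0// geometric_sum_le.
  have d1 := @half_pow_cvg0 R (M * 2 * 2).
  have d2 : (fun N => - (M * 2 * 2 * 2^-1 ^+ N)) @ \oo --> 0.
    by rewrite -[X in _ --> X]oppr0; exact: cvgN.
  have d3 : (fun N => psum (fun n => s n x * t ^+ n) N - S N) @ \oo --> 0.
    apply: (squeeze_cvgr _ d2 d1); apply: nearW => N.
    by rewrite -ler_norml diff.
  apply: (cvgn_ext (u := fun N => (psum (fun n => s n x * t ^+ n) N - S N) + S N)).
    by move=> N; rewrite subrK.
  by rewrite -[X in _ --> X]add0r; apply: cvgD.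
(* Two power series in [t] with the same sum near 0 have equal coefficients; their difference is
   flat since its sum is 0. *)
have Ds x n : `|x| <= e / 2 -> D (b0 + x) n * u n = s n x.
  move=> hx; pose a n := D (b0 + x) n * u n - s n x.
  have he2 : `|e / 2| <= e by rewrite gtr0_norm// divr_gt0.
  have [_ _ hD] := hQ' x (e / 2) (le_trans hx e2e) he2.
  have [K hK] : exists K : R, forall n, `|D (b0 + x) n * (u n * (e / 2) ^+ n)| <= K.
    have hc : cvgn (series (fun n => D (b0 + x) n * (u n * (e / 2) ^+ n))).
      by rewrite series_psum; apply/cvg_ex; exists (G (b0 + x) (e / 2)).
    have [K [_ hK]] := cvg_series_bounded hc.
    by exists (K + 1) => k; apply: (hK (K + 1)) => //; rewrite ltrDl.
  suff : a n = 0 by move=> /eqP; rewrite subr_eq0 => /eqP.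
  apply: (@flat_pseries_eq0 _ a (fun=> 0) (e / 2) (K + M * 2)).
  - by rewrite divr_gt0.
  - move=> m; rewrite /a; have e20 : 0 <= e / 2 by rewrite divr_ge0// ltW.
    rewrite -(ger0_norm (exprn_ge0 m e20)) -normrM mulrBl.
    apply: (le_trans (ler_normB _ _)); apply: lerD; first by rewrite -mulrA.
    rewrite normrM normrX (ger0_norm e20).
    apply: (@le_trans _ _ (M * e ^- m * 2 * (e / 2) ^+ m)).
      by rewrite ler_wpM2r ?exprn_ge0// sB.
    rewrite (_ : _ * _ = M * 2 * 2^-1 ^+ m); last first.
      by rewrite exprMn; have := lt0r_neq0 (exprn_gt0 m e0); move: (e ^+ m) => v v0; field.
    by rewrite ler_piMr ?mulr_ge0// exprn_ile1// invf_le1// ler1n.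
  - move=> t ht; have ht' := le_trans ht e4e.
    have [_ _ h1] := hQ' x t (le_trans hx e2e) (le_trans ht' e2e).
    have h2 := sG x t hx ht'.
    rewrite -(subrr (G (b0 + x) t)); apply: (cvgn_ext _ (cvgB h1 h2)) => N.
    rewrite [LHS](_ : _ = psum (fun n => D (b0 + x) n * (u n * t ^+ n)) N - psum (fun n => s n x * t ^+ n) N)//.
    by rewrite /psum -sumrB; apply: eq_bigr => i _; rewrite /a; ring.
  - by move=> k; exists 0 => t _; rewrite normr0 mul0r.
(* The derivative of [D b n] involves two neighbours, both of order [k]; integrating from [b0] gains
   one order. *)
have flat k n : exists C : R, 0 <= C /\ forall x, `|x| <= e / 2 -> `|D (b0 + x) n| <= C * `|x| ^+ k.
  elim: k n => [|k IH] n.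
    exists (M * e ^- n * 2 / u n); split.
      by rewrite divr_ge0 ?(ltW (u0 n))// (mulr_ge0 (en n)).
    move=> x hx; rewrite expr0 mulr1 ler_pdivlMr//.
    by rewrite -(gtr0_norm (u0 n)) -normrM Ds// sB.
  have [C1 [C10 hC1]] := IH n.+1; have [C2 [C20 hC2]] := IH n.-1.
  pose C := `|lam + sig * n%:R| * C1 + `|c * n%:R| * C2.
  have C0 : 0 <= C by rewrite addr_ge0// mulr_ge0.
  exists C; split => // x hx.
  have dB y : `|y| <= `|x| -> `|A (D (b0 + y)) n| <= C * `|x| ^+ k.
    move=> yx; have hy := le_trans yx hx.
    have yk : `|y| ^+ k <= `|x| ^+ k by rewrite lerXn2r ?nnegrE.
    rewrite /flow_op /C mulrDl; apply: (le_trans (ler_normD _ _)).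
    rewrite [X in X + _ <= _]normrM normrN [X in _ + X <= _]normrM.
    rewrite -!(mulrA `|_|); apply: lerD; apply: ler_wpM2l => //.
      by apply: (le_trans (hC1 y hy)); rewrite ler_wpM2l.
    by apply: (le_trans (hC2 y hy)); rewrite ler_wpM2l.
  pose K := C * `|x| ^+ k.
  have dK (v : R) : is_derive v 1 (fun t : R => K * t) K.
    by apply: is_derive_eq (is_derive1_cmul _ (is_derive1_id v)) _; rewrite mulr1.
  rewrite exprSr mulrA -/K.
  have [x_ge0|x_lt0] := leP 0 x.
    have bb : b0 <= b0 + x by rewrite lerDl.
    have := @ler_derive_bound _ (D^~ n) (fun v => A (D v) n) (fun t : R => K * t)
        (fun=> K) b0 (b0 + x) bb (fun v _ => dD v n) (fun v _ => dK v).
    rewrite Db0 subr0 -mulrBr (addrC b0) addrK (ger0_norm x_ge0); apply.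
    move=> t /andP[t1 t2]; rewrite -(subrKC b0 t); apply: dB.
    by rewrite !ger0_norm//; lra.
  have bb : b0 + x <= b0 by rewrite gerDl ltW.
  have := @ler_derive_bound _ (D^~ n) (fun v => A (D v) n) (fun t : R => K * t)
      (fun=> K) (b0 + x) b0 bb (fun v _ => dD v n) (fun v _ => dK v).
  rewrite Db0 sub0r normrN -mulrBr opprD addrA subrr sub0r (ltr0_norm x_lt0); apply.
  move=> t /andP[t1 t2]; rewrite -(subrKC b0 t); apply: dB.
  by rewrite (ltr0_norm x_lt0) ler0_norm; lra.
have cf0 m n : cf m n = 0.
  apply: (@flat_pseries_eq0 _ (fun m => cf m n) (fun x => D (b0 + x) n * u n) (e) (M * e ^- n)) => //.
    by move=> x hx; rewrite Ds//; exact: scvg.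
  move=> k; have [C [C0 hC]] := flat k n; exists (C * u n) => x hx.
  rewrite normrM (gtr0_norm (u0 n)) mulrAC ler_wpM2r ?(ltW (u0 n))//.
  exact: hC.
move=> b n hb; have hx : `|b - b0| <= e / 2 by apply: le_trans hb e4e.
have := Ds _ n hx; rewrite subrKC => h.
have s0 : s n (b - b0) = 0.
  apply/cvg_lim => //; apply: (cvgn_ext (u := fun=> 0)); last exact: cvg_cst.
  by move=> N; rewrite /psum big1// => m _; rewrite cf0 mul0r.
by move: h; rewrite s0 => /eqP; rewrite mulf_eq0 (gt_eqF (u0 n)) orbF => /eqP.
Qed.

(** The times at which all coordinates vanish form a nonempty set, open by [flow_zero_local] and
    closed by continuity of each coordinate. *)
Lemma flow_zero : (forall n, D 0 n = 0) ->
  (forall b0, exists cf, \forall x \near ((b0, 0) : R * R), expansion_at b0 cf x.1 x.2) ->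
  forall b n, D b n = 0.
Proof.
move=> D0 hexp.
pose Z := [set b | forall n, D b n = 0].
suff : Z = setT by move=> ZT b; have : Z b by rewrite ZT.
have conn : connected ([set: R]) by apply/connected_intervalP.
apply: conn.
- by exists 0.
- exists Z; rewrite ?setTI//; rewrite openE => b0 Zb0.
  have [cf hcf] := hexp b0; have [e e0 he] := flow_zero_local hcf Zb0.
  apply/nbhs_ballP; exists e => // b; rewrite /ball /= distrC => hb n.
  by apply: he; exact: ltW.
- exists Z; rewrite ?setTI//.
  rewrite (_ : Z = \bigcap_n ((D^~ n) @^-1` [set 0])); last first.
    by apply/seteqP; split => [b h n _|b h n]; [exact: h|exact: (h n I)].
  apply: closed_bigI => n _; apply: closed_comp; last exact: closed_eq.
  by move=> b _; exact: is_derive1_cvg (dD b n).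
Qed.

End FlowUniqueness.

Section ComplexParts.
Context {R : realType}.
Implicit Types (x y : R[i]) (q : bool).

(** Selecting the part by a boolean lets one argument treat both. *)
Definition reim q x : R := if q then complex.Re x else complex.Im x.

Lemma cpartD q x y : reim q (x + y) = reim q x + reim q y.
Proof. by case: q x y => [] [a b] [a' b']. Qed.

Lemma cpartMr q x (a : R) : reim q (x * a%:C) = reim q x * a.
Proof. by case: q x => [] [u v] /=; ring. Qed.

Lemma cpartMl q x (a : R) : reim q (a%:C * x) = a * reim q x.
Proof. by rewrite mulrC cpartMr mulrC. Qed.

Lemma cpart_sum q (I : Type) (r : seq I) (P : pred I) (F : I -> R[i]) :
  reim q (\sum_(i <- r | P i) F i) = \sum_(i <- r | P i) reim q (F i).
Proof. by case: q; [exact: Re_sum|exact: Im_sum]. Qed.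

Lemma cpart_le_normc q x : `|reim q x| <= Normc.normc x.
Proof.
case: x => a b /=; rewrite -sqrtr_sqr ler_wsqrtr//.
by case: q => /=; rewrite ?lerDl ?lerDr sqr_ge0.
Qed.

Lemma normc_le_parts x : Normc.normc x <= `|complex.Re x| + `|complex.Im x|.
Proof.
case: x => a b /=; rewrite -[leRHS]ger0_norm ?addr_ge0// -sqrtr_sqr ler_wsqrtr//.
rewrite sqrrD !real_normK ?num_real// addrAC lerDl mulrn_wge0//.
Qed.

Lemma cpart_ext x y : (forall q, reim q x = reim q y) -> x = y.
Proof.
case: x y => a b [a' b'] h; have /= -> := h true.
by have /= -> := h false.
Qed.

Lemma clim_to_cpart (u : nat -> R[i]) (l : R[i]) :
  clim_to u l <-> forall q, (fun n => reim q (u n)) @ \oo --> reim q l.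
Proof.
split=> [[h1 h2] []//|h]; split; [exact: (h true)|exact: (h false)].
Qed.

End ComplexParts.

Section ComplexFlow.
Context {R : realType}.
Variables (lam sig c z : R) (u : nat -> R).
Variable AC : (nat -> R[i]) -> (nat -> R[i]).
Hypotheses (lam0 : 0 < lam) (sig0 : 0 <= sig) (c0 : 0 < c) (z0 : 0 < z).
(** The prescribed generating-function weight is the reversible weight up to a geometric factor;
    [z = p^-1] for both SIP and IRW. *)
Hypothesis uE : forall n, u n = wt lam sig c n * z ^+ n.
Local Notation A := (flow_op lam sig c).
(** [AC] has real coefficients, so real and imaginary parts evolve separately. *)
Hypothesis ACE : forall f n q, reim q (AC f n) = A (fun k => reim q (f k)) n.
Implicit Types (b s t : R) (f : nat -> R[i]) (g : R -> nat -> R[i]).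

Let u0 n : 0 < u n.
Proof. by rewrite uE gfw_gt0. Qed.

Lemma flow_solution_part f g q : flow_solution u AC f g ->
  [/\ forall n, reim q (g 0 n) = reim q (f n),
      forall b n, is_derive b 1 (fun s => reim q (g s n)) (A (fun k => reim q (g b k)) n) &
      exists G : R -> R -> R, forall b0, exists cf,
        \forall x \near ((b0, 0) : R * R),
          expansion_at u (fun b n => reim q (g b n)) G b0 cf x.1 x.2].
Proof.
move=> [g0 dg [G hG]]; split.
- by move=> n; rewrite g0.
- move=> b n; rewrite -ACE; have [h1 h2] := dg b n; by case: q.
- exists (fun b t => reim q (G b t)) => b0; have [[cf hcf] hs] := hG b0.
  exists (fun m n => reim q (cf m n)); apply: filterS2 hcf hs => x [[M hM] h1] h2.
  rewrite subr0 in h1 hM.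
  split.
  + exists M => N; apply: le_trans (hM N); apply: ler_sum => m _; apply: ler_sum => n _.
    by rewrite !ler_wpM2r ?exprn_ge0// cpart_le_normc.
  + have := (clim_to_cpart _ _).1 h1 q; apply: cvgn_ext => N.
    rewrite cpart_sum; apply: eq_bigr => m _; rewrite cpart_sum; apply: eq_bigr => n _.
    by rewrite cpartMr.
  + have := (clim_to_cpart _ _).1 h2 q; apply: cvgn_ext => N.
    by rewrite /series /= big_mkord cpart_sum; apply: eq_bigr => n _; rewrite cpartMr.
Qed.

Lemma expansion_atB (D D' : R -> nat -> R) (G G' : R -> R -> R) b0 cf cf' b t :
  expansion_at u D G b0 cf b t -> expansion_at u D' G' b0 cf' b t ->
  expansion_at u (fun b n => D b n - D' b n) (fun b t => G b t - G' b t) b0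
    (fun m n => cf m n - cf' m n) b t.
Proof.
move=> [[M hM] h1 h2] [[M' hM'] h1' h2']; split.
- exists (M + M') => N; apply: le_trans (lerD (hM N) (hM' N)).
  rewrite -big_split /=; apply: ler_sum => m _; rewrite -big_split /=; apply: ler_sum => n _.
  by rewrite -!mulrDl !ler_wpM2r ?exprn_ge0// ler_normB.
- apply: cvgn_ext (cvgB h1 h1') => N.
  rewrite -[LHS]/(_ - _) -sumrB; apply: eq_bigr => m _; rewrite -sumrB; apply: eq_bigr => n _.
  by rewrite mulrBl.
- apply: cvgn_ext (cvgB h2 h2') => N.
  by rewrite -[LHS]/(_ - _) /psum -sumrB; apply: eq_bigr => n _; rewrite mulrBl.
Qed.

Lemma flow_solution_unique f g g' :
  flow_solution u AC f g -> flow_solution u AC f g' -> g = g'.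
Proof.
move=> sg sg'; apply/funext => b; apply/funext => n; apply: cpart_ext => q.
have [i1 d1 [G1 e1]] := flow_solution_part q sg.
have [i2 d2 [G2 e2]] := flow_solution_part q sg'.
apply/eqP; rewrite -subr_eq0; apply/eqP.
apply: (@flow_zero _ lam sig c u u0 (fun b n => reim q (g b n) - reim q (g' b n))
   (fun b t => G1 b t - G2 b t)).
- move=> s k; apply: is_derive_eq (is_derive1_add (d1 s k) (is_derive1_opp (d2 s k))) _.
  by rewrite /flow_op; ring.
- by move=> k; rewrite i1 i2 subrr.
- move=> b0; have [cf1 h1] := e1 b0; have [cf2 h2] := e2 b0.
  exists (fun m n => cf1 m n - cf2 m n); apply: filterS2 h1 h2 => x; exact: expansion_atB.
Qed.

(** A geometric bound, locally uniform in time, suffices for the analyticity clause: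
    [flow_expansion] then applies to each part. *)
Lemma flow_solution_intro f g : g 0 = f ->
  (forall b n q, is_derive b 1 (fun s => reim q (g s n)) (A (fun k => reim q (g b k)) n)) ->
  (forall q (B : R), exists M r : R, [/\ 0 <= M, 1 <= r &
     forall b n, `|b| <= B -> `|reim q (g b n)| * u n <= M * r ^+ n]) ->
  flow_solution u AC f g.
Proof.
move=> g0 dg gB; split => //.
  by move=> b n; split; [have := dg b n true|have := dg b n false]; rewrite -ACE.
pose gq q b n := reim q (g b n).
exists (fun b t => flow_gf lam sig c z (gq true) b t +i* flow_gf lam sig c z (gq false) b t).
move=> b0.
have dgq q b n : is_derive b 1 (gq q ^~ n) (A (gq q b) n) by exact: dg.
have gqB q (B : R) : exists M r : R, [/\ 0 <= M, 1 <= r &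
     forall b n, `|b| <= B -> `|gq q b n| * (wt lam sig c n * z ^+ n) <= M * r ^+ n].
  have [M [r [M0 r1 h]]] := gB q B; exists M, r; split => // b n hb.
  by rewrite -uE; exact: h.
have ex q := flow_expansion lam0 sig0 c0 z0 (dgq q) (gqB q) b0.
split.
- exists (fun m n => flow_coef lam sig c z (gq true) b0 m n +i*
    flow_coef lam sig c z (gq false) b0 m n).
  apply: filterS2 (ex true) (ex false) => x [[M hM] h1 _] [[M' hM'] h1' _]; rewrite subr0; split.
    exists (M + M') => N; apply: le_trans (lerD (hM N) (hM' N)).
    rewrite -big_split /=; apply: ler_sum => m _; rewrite -big_split /=; apply: ler_sum => n _.
    by rewrite -!mulrDl !ler_wpM2r ?exprn_ge0//; exact: (normc_le_parts (_ +i* _)).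
  apply/clim_to_cpart => q.
  have {h1 h1'} : (fun N => \sum_(m < N) \sum_(n < N)
         flow_coef lam sig c z (gq q) b0 m n * ((x.1 - b0) ^+ m * x.2 ^+ n)) @ \oo -->
    flow_gf lam sig c z (gq q) x.1 x.2 by case: q.
  rewrite (_ : reim q _ = flow_gf lam sig c z (gq q) x.1 x.2); last by case: q.
  apply: cvgn_ext => N; rewrite cpart_sum; apply: eq_bigr => m _; rewrite cpart_sum.
  by apply: eq_bigr => n _; rewrite cpartMr; case: q.
- apply: filterS2 (ex true) (ex false) => x [_ _ h1] [_ _ h1']; apply/clim_to_cpart => q.
  have {h1 h1'} : psum (fun n => gq q x.1 n * (wt lam sig c n * z ^+ n * x.2 ^+ n)) @ \oo -->
    flow_gf lam sig c z (gq q) x.1 x.2 by case: q.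
  rewrite (_ : reim q _ = flow_gf lam sig c z (gq q) x.1 x.2); last by case: q.
  apply: cvgn_ext => N; rewrite /series /= big_mkord cpart_sum.
  by apply: eq_bigr => n _; rewrite cpartMr uE.
Qed.

Lemma exp_flowE f g b : flow_solution u AC f g -> exp_flow u b AC f = g b.
Proof.
move=> sg; rewrite /exp_flow (@xget_unique _ _ _ g)// => g' sg'.
exact: flow_solution_unique sg' sg.
Qed.

End ComplexFlow.

(** * The exponential as a kernel operator, and its unitarity *)

Section KernelFlow.
Context {R : realType}.
Variables (lam sig c z : R) (tau nb : R -> R) (u : nat -> R).
Variable AC : (nat -> R[i]) -> (nat -> R[i]).
Hypotheses (lam0 : 0 < lam) (sig0 : 0 <= sig) (c0 : 0 < c) (z0 : 0 < z).
Hypothesis dtau : forall b : R, is_derive b 1 tau (c - sig * tau b ^+ 2).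
Hypothesis dnb : forall b : R, is_derive b 1 nb (- lam * tau b * nb b).
Hypotheses (tau0 : tau 0 = 0) (nb0 : nb 0 = 1).
Hypotheses (tauN : forall b : R, tau (- b) = - tau b) (nbN : forall b : R, nb (- b) = nb b).
Hypothesis nb1 : forall b : R, `|nb b| <= 1.
Hypothesis tauB : forall B : R, exists T T' : R,
  [/\ 0 <= T, T < T', sig * T' ^+ 2 < c &
      forall b, `|b| <= B -> `|tau b| <= T].
Hypothesis uE : forall n, u n = wt lam sig c n * z ^+ n.
Hypothesis ACE : forall f n q,
  reim q (AC f n) = flow_op lam sig c (fun k => reim q (f k)) n.
Local Notation E := (flow_ker lam sig c tau nb).
Local Notation W := (wt lam sig c).

Definition kernel_flow (N : nat) (f : nat -> R[i]) (b : R) (y : nat) : R[i] :=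
  \sum_(x < N) f x * (E b x y * W x)%:C.

Lemma cpart_kernel_flow N f b y q : reim q (kernel_flow N f b y) =
  \sum_(x < N) reim q (f x) * W x * E b x y.
Proof.
by rewrite cpart_sum; apply: eq_bigr => x _; rewrite cpartMr; ring.
Qed.

Lemma kernel_flow_solution N f : (forall x, (N <= x)%N -> f x = 0) ->
  flow_solution u AC f (kernel_flow N f).
Proof.
move=> fN; apply: (flow_solution_intro lam0 sig0 c0 z0 uE ACE).
- apply/funext => y; rewrite /kernel_flow.
  have Wn x : W x != 0 by rewrite gt_eqF// wt_gt0_nneg.
  have [yN|Ny] := ltnP y N.
    rewrite (bigD1 (Ordinal yN))//= big1 => [|x /negbTE xy].
      by rewrite flow_ker0// eqxx mul1r mulVf// mulr1 addr0.
    by rewrite -val_eqE/= in xy; rewrite flow_ker0// xy mul0r mul0r mulr0.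
  rewrite fN// big1// => x _; rewrite flow_ker0// ltn_eqF ?mul0r ?mulr0//.
  exact: leq_trans Ny.
- move=> b n q.
  rewrite (_ : (fun s => _) = fun s => \sum_(x < N) reim q (f x) * W x * E s x n); last first.
    by apply/funext => s; exact: cpart_kernel_flow.
  have dE x := is_derive1_cmul (reim q (f x) * W x) (flow_ker_ode lam0 sig0 dtau dnb b x n).
  apply: is_derive_eq (is_derive1_sum (index_enum 'I_N) predT (fun x : 'I_N => dE x)) _.
  rewrite /flow_op !cpart_kernel_flow !mulr_sumr -big_split /=.
  by apply: eq_bigr => x _; ring.
- move=> q B; elim: N {fN} => [|N [M [r [M0 r1 h]]]].
    by exists 0, 1; split => // b n _; rewrite cpart_kernel_flow big_ord0 normr0 !mul0r.
  have [M' [r' [M'0 r'1 h']]] := flow_ker_gf_bound lam0 sig0 c0 nb1 tauB B N z0.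
  pose K := `|reim q (f N) * W N|; pose r2 := Num.max r r'.
  have r21 : 1 <= r2 by rewrite le_max r1.
  exists (M + K * M'), r2; split => //; first by apply: addr_ge0 => //; apply: mulr_ge0; rewrite ?/K.
  move=> b n hb; have u0 : 0 <= u n by rewrite uE ltW// gfw_gt0.
  have r0 : 0 <= r by lra. have r'0 : 0 <= r' by lra. have r20 : 0 <= r2 by lra.
  have := h b n hb; rewrite !cpart_kernel_flow big_ord_recr /= => hN.
  apply: (@le_trans _ _ (M * r ^+ n + K * (M' * r' ^+ n))).
    apply: (@le_trans _ _ ((`|\sum_(x < N) reim q (f x) * W x * E b x n| + K * `|E b N n|) * u n)).
      by rewrite ler_wpM2r// /K -normrM ler_normD.
    rewrite mulrDl; apply: lerD => //; rewrite -mulrA; apply: ler_wpM2l; first exact: normr_ge0.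
    by rewrite uE; exact: h'.
  rewrite mulrDl -mulrA; have K0 : 0 <= K by exact: normr_ge0.
  apply: lerD; apply: ler_wpM2l => //; last apply: ler_wpM2l => //.
    by rewrite lerXn2r ?nnegrE// le_max lexx.
  by rewrite lerXn2r ?nnegrE// le_max lexx orbT.
Qed.

Lemma kernel_exp_flow N f b y : (forall x, (N <= x)%N -> f x = 0) ->
  exp_flow u b AC f y = \sum_(x < N) f x * (E b x y * W x)%:C.
Proof.
by move=> fN; rewrite (exp_flowE lam0 sig0 c0 z0 uE ACE b (kernel_flow_solution fN)).
Qed.

Lemma kernel_exp_well_defined : exp_well_defined u AC.
Proof.
move=> f [N fN]; exists (kernel_flow N f); split; first exact: kernel_flow_solution.
move=> g; apply: (flow_solution_unique lam0 sig0 c0 z0 uE ACE).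
exact: kernel_flow_solution.
Qed.

(** [K] is the normalization of [w]. Dividing the kernel by [K] preserves [P * w = E * W] and turns
    the squared norms [1 / W] into [1 / w]. *)
Lemma kernel_unitary (th : nat -> R[i]) (w : nat -> R) (K : R) b : 0 < K ->
  (forall x, w x = K * W x) ->
  (forall x, th x * conjc (th x) = 1) ->
  extends_to_unitary w (fun f => exp_flow u b AC (fun x => th x * f x)).
Proof.
move=> K0 wE hth.
have w0 x : 0 < w x by rewrite wE mulr_gt0// wt_gt0_nneg.
pose P x y := E b x y / K.
have aux (F F' : nat -> R) (x x' : nat) : psum F @ \oo --> (x == x')%:R / W x ->
    (forall y, F' y = K^-1 * F y) -> psum F' @ \oo --> (x == x')%:R / w x.
  move=> h e; rewrite wE invfM mulrCA; apply: (cvgn_ext (u := fun N => K^-1 * psum F N)).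
    by move=> N; rewrite -psumZ; apply: eq_bigr => y _; rewrite e.
  exact: cvgMr.
have Kn : K != 0 by rewrite gt_eqF.
have rowP x x' : psum (fun y => P x y * P x' y * w y) @ \oo --> (x == x')%:R / w x.
  have h := @flow_ker_orth _ lam sig c tau nb lam0 sig0 c0 dtau dnb tau0 nb0 nb1 tauB b x x'.
  apply: (aux _ _ _ _ h) => y.
  by rewrite /P wE; field.
have colP y y' : psum (fun x => P x y * P x y' * w x) @ \oo --> (y == y')%:R / w y.
  have h := @flow_ker_orth_col _ lam sig c tau nb lam0 sig0 c0 dtau dnb tau0 nb0 tauN nbN nb1 tauB b y y'.
  apply: (aux _ _ _ _ h) => x.
  by rewrite /P wE; field.
exists (fun f => copk w P (fun x => th x * f x)).
  exact: phase_unitary.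
move=> f [N fN]; apply/funext => y.
have thN x : (N <= x)%N -> th x * f x = 0 by move=> /fN ->; rewrite mulr0.
rewrite (kernel_exp_flow _ _ thN) (copk_finite _ _ _ thN); apply: eq_bigr => x _.
by congr (_ * _%:C); rewrite /P wE; field.
Qed.

End KernelFlow.

(** * Duality and phases *)

Section Duality.
Context {R : realType}.
Variables (T : Type) (occ : T -> nat) (inc dec : T -> T) (rate : nat -> nat -> R).
Variable d : T -> T -> R[i].

Definition two_site_duality : Prop := forall a1 a2 b1 b2 : T,
  (rate (occ a1) (occ a2))%:C * (d (dec a1) b1 * d (inc a2) b2 - d a1 b1 * d a2 b2) +
  (rate (occ a2) (occ a1))%:C * (d (inc a1) b1 * d (dec a2) b2 - d a1 b1 * d a2 b2) =
  (rate (occ b1) (occ b2))%:C * (d a1 (dec b1) * d a2 (inc b2) - d a1 b1 * d a2 b2) +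
  (rate (occ b2) (occ b1))%:C * (d a1 (inc b1) * d a2 (dec b2) - d a1 b1 * d a2 b2).

(** The generator is a sum over edges, and a jump along one edge leaves the factors at all other
    sites unchanged; they come out as a common factor. *)
Lemma single_site_of_two_sites :
  two_site_duality -> single_site_self_duality occ inc dec rate d.
Proof.
move=> h2 V e _ e_irr x y; apply: eq_bigr => i _; apply: eq_bigr => l /andP[eil _].
have il : l != i by apply: contraTneq eil => ->; rewrite e_irr.
have prod2 (F : V -> R[i]) : \prod_v F v = F i * (F l * \prod_(v | (v != i) && (v != l)) F v).
  by rewrite (bigD1 i)//= (bigD1 l).
have rest (F F' : V -> R[i]) : (forall v, v != i -> v != l -> F v = F' v) ->
    \prod_(v | (v != i) && (v != l)) F v = \prod_(v | (v != i) && (v != l)) F' v.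
  by move=> h; apply: eq_bigr => v /andP[vi vl]; exact: h.
have mE (t : {ffun V -> T}) (j k : V) : k != j ->
    [/\ move inc dec t j k j = dec (t j), move inc dec t j k k = inc (t k) &
        forall v, v != j -> v != k -> move inc dec t j k v = t v].
  move=> kj; rewrite /move; split; rewrite ?ffunE ?eqxx// ?(negbTE kj)//.
  by move=> v vj vk; rewrite ffunE (negbTE vj) (negbTE vk).
have li : i != l by rewrite eq_sym.
have [x1 x2 x3] := mE x i l il; have [x4 x5 x6] := mE x l i li.
have [y1 y2 y3] := mE y i l il; have [y4 y5 y6] := mE y l i li.
rewrite /edge_generator !prod2 x1 x2 x4 x5 y1 y2 y4 y5.
set r := \prod_(v | _) d (x v) (y v).
rewrite (rest (fun v => d (move inc dec x i l v) (y v)) (fun v => d (x v) (y v))); last first.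
  by move=> v vi vl; rewrite x3.
rewrite (rest (fun v => d (move inc dec x l i v) (y v)) (fun v => d (x v) (y v))); last first.
  by move=> v vi vl; rewrite x6.
rewrite (rest (fun v => d (x v) (move inc dec y i l v)) (fun v => d (x v) (y v))); last first.
  by move=> v vi vl; rewrite y3.
rewrite (rest (fun v => d (x v) (move inc dec y l i v)) (fun v => d (x v) (y v))); last first.
  by move=> v vi vl; rewrite y6.
rewrite -/r.
have := h2 (x i) (x l) (y i) (y l) => /(congr1 (fun t => t * r)) h.
transitivity (((rate (occ (x i)) (occ (x l)))%:C *
    (d (dec (x i)) (y i) * d (inc (x l)) (y l) - d (x i) (y i) * d (x l) (y l)) +
  (rate (occ (x l)) (occ (x i)))%:C *
    (d (inc (x i)) (y i) * d (dec (x l)) (y l) - d (x i) (y i) * d (x l) (y l))) * r).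
  by ring.
by rewrite h; ring.
Qed.

End Duality.

Section Phases.
Context {R : realType}.

Lemma cexp_i (r : R) : cexp ('i * r%:C) = cos r +i* sin r.
Proof.
rewrite /cexp (_ : 'i * r%:C = 0 +i* r); last first.
  by apply/eqP; rewrite eq_complex /=; apply/andP; split; apply/eqP; ring.
by rewrite /= expR0 mul1r.
Qed.

Lemma cexp_iD (r s : R) : cexp ('i * (r + s)%:C) = cexp ('i * r%:C) * cexp ('i * s%:C).
Proof.
rewrite !cexp_i cosD sinD; apply/eqP; rewrite eq_complex /=.
by rewrite eqxx/= addrC.
Qed.

Lemma cexp_i_unit (r : R) : cexp ('i * r%:C) * conjc (cexp ('i * r%:C)) = 1.
Proof.
rewrite cexp_i; apply/eqP; rewrite eq_complex /=; apply/andP; split; apply/eqP.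
  by rewrite mulrN opprK -!expr2 cos2Dsin2.
by ring.
Qed.

Lemma cexp_i_pi_nat (r : R) (x : nat) :
  cexp ('i * (pi * (x%:R + r))%:C) = ((-1) ^+ x)%:C * cexp ('i * (pi * r)%:C).
Proof.
elim: x => [|x IH]; first by rewrite add0r expr0 mul1r.
rewrite (_ : pi * (x.+1%:R + r) = pi + pi * (x%:R + r)); last by rewrite -natr1; ring.
by rewrite cexp_iD IH (cexp_i pi) cospi sinpi mulrA -[_ +i* 0]/((-1)%:C) -rmorphM -exprS.
Qed.

End Phases.

Section InfiniteCase.
Context {R : realType}.
Implicit Types (w : nat -> R) (f g : nat -> R[i]).

Lemma L2_finite w f : (forall x, 0 < w x) -> finitely_supported f -> L2 w f.
Proof.
move=> w0 [N fN]; rewrite /L2 /= series_psum.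
have p0 n : 0 <= Normc.normc (f n) ^+ 2 * w n by rewrite mulr_ge0 ?sqr_ge0 ?ltW.
apply: (psum_bounded_cvg p0 (B := psum (fun n => Normc.normc (f n) ^+ 2 * w n) N)) => M.
have [MN|NM] := leqP M N; first exact: psum_homo.
rewrite -(subnK (ltnW NM)); elim: (M - N)%N => [//|k IH].
rewrite addSn psumS fN ?leq_addl// (_ : Normc.normc 0 = 0) ?expr0n ?mul0r ?addr0//.
by rewrite /= expr0n addr0 sqrtr0.
Qed.

Lemma extends_to_unitary_finite w S f g : (forall x, 0 < w x) ->
  extends_to_unitary w S -> finitely_supported f -> finitely_supported g ->
  L2 w (S f) /\ inner w (S f) (S g) = inner w f g.
Proof.
move=> w0 [U [U1 _ U3 _] US] ff fg.
have lf := L2_finite w0 ff; have lg := L2_finite w0 fg.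
by rewrite -!US//; split; [exact: U1|exact: U3].
Qed.

Lemma inner_disjoint w f g : (forall x, f x * conjc (g x) = 0) -> inner w f g = 0.
Proof.
move=> h; apply: clim_uniq.
rewrite (_ : series _ = fun=> 0); first by split; exact: cvg_cst.
apply/funext => N; rewrite /series /= big1// => i _.
by rewrite h mul0r.
Qed.

End InfiniteCase.

Section KernelConclusion.
Context {R : realType}.
Variables (lam sig c z K r : R) (tau nb : R -> R) (u w : nat -> R).
Variable AC : (nat -> R[i]) -> (nat -> R[i]).
Variable Dch : nat -> nat -> R[i].
Variable rate : nat -> nat -> R.
Hypotheses (lam0 : 0 < lam) (sig0 : 0 <= sig) (c0 : 0 < c) (z0 : 0 < z) (K0 : 0 < K).
Hypothesis r0 : r != 0.
Hypothesis dtau : forall b : R, is_derive b 1 tau (c - sig * tau b ^+ 2).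
Hypothesis dnb : forall b : R, is_derive b 1 nb (- lam * tau b * nb b).
Hypotheses (tau0 : tau 0 = 0) (nb0 : nb 0 = 1).
Hypotheses (tauN : forall b : R, tau (- b) = - tau b) (nbN : forall b : R, nb (- b) = nb b).
Hypothesis nb1 : forall b : R, `|nb b| <= 1.
Hypothesis tauB : forall B : R, exists T T' : R,
  [/\ 0 <= T, T < T', sig * T' ^+ 2 < c &
      forall b, `|b| <= B -> `|tau b| <= T].
Hypothesis uE : forall n, u n = wt lam sig c n * z ^+ n.
Hypothesis ACE : forall f n q,
  reim q (AC f n) = flow_op lam sig c (fun k => reim q (f k)) n.
Hypothesis wE : forall x, w x = K * wt lam sig c x.
Hypothesis DchE : forall x y, Dch x y = ((wt lam sig c x)^-1)%:C * (x == y)%:R.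
(** [r] rescales time. For IRW [A] has raising coefficient [lam = p] where the process has rate
    factor 1, so [r = p]; for SIP [r = 1]. *)
Hypothesis rateE : forall a b, r * rate a b = a%:R * (lam + sig * b%:R).
Local Notation E := (flow_ker lam sig c tau nb).
Local Notation W := (wt lam sig c).

Lemma kernel_duality_fun (th : nat -> R[i]) b x y :
  exp_flow u b AC (fun x' => th x' * Dch x x') y = th x * (E b x y)%:C.
Proof.
rewrite (@kernel_exp_flow _ _ _ _ _ _ _ _ _ lam0 sig0 c0 z0 dtau dnb tau0 nb0 nb1 tauB uE ACE x.+1); last first.
  by move=> x' xx'; rewrite DchE ltn_eqF// !mulr0.
rewrite big_ord_recr /= big1 => [|x' _]; last first.
  by rewrite DchE eq_sym ltn_eqF// !mulr0 mul0r.
rewrite add0r DchE eqxx mulr1 -mulrA -rmorphM /=; congr (_ * _%:C).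
by field; rewrite gt_eqF// wt_gt0_nneg.
Qed.

Lemma kernel_conclusion (th : nat -> R[i]) (t1 : R[i]) b :
  (forall x, th x * conjc (th x) = 1) -> (forall x, th x.+1 = t1 * th x) ->
  let S f := exp_flow u b AC (fun x => th x * f x) in
  let d x y := S (Dch x) y in
  [/\ extends_to_unitary w S,
      single_site_self_duality id succn predn rate d,
      forall x : nat, L2 w (d x),
      forall x x' : nat, x <> x' -> inner w (d x) (d x') = 0
    & forall x : nat, inner w (d x) (d x) = inner w (Dch x) (Dch x)].
Proof.
move=> hth th1 S d.
have U : extends_to_unitary w S.
  exact: (kernel_unitary lam0 sig0 c0 z0 dtau dnb tau0 nb0 tauN nbN nb1 tauB uE ACE b K0 wE hth).
have w0 x : 0 < w x by rewrite wE mulr_gt0// wt_gt0_nneg.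
have fD x : finitely_supported (Dch x).
  by exists x.+1 => y xy; rewrite DchE ltn_eqF// mulr0.
have P x x' := extends_to_unitary_finite w0 U (fD x) (fD x').
split => //.
- apply: single_site_of_two_sites => x1 x2 y1 y2.
  have nz m (_ : (m < x1)%N || (m < y1)%N || (m < x2)%N || (m < y2)%N) :
      lam + sig * m%:R != 0 by rewrite gt_eqF// ltr_pwDl// mulr_ge0.
  have h := @ker_two_sites R lam sig (tau b) (c - sig * tau b ^+ 2) (nb b) x1 x2 y1 y2 nz.
  have dE x y : d x y = th x * (E b x y)%:C by exact: kernel_duality_fun.
  have r0' : r%:C != 0 by rewrite (inj_eq (@complexI _)).
  (* A jump preserves the number of particles and [th] is geometric, so the phases factor out; at
     [a = 0] the rate removes the meaningless [a.-1]. *)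
  have thp a a' : (a%:R : R)%:C * (th a.-1 * th a'.+1) = a%:R%:C * (th a * th a').
    by case: a => [|a]; rewrite ?mul0r//= !th1; ring.
  have side (q e1 e2 e e' : R[i]) a a' : a%:R%:C * q * (th a.-1 * e1 * (th a'.+1 * e2) - th a * e * (th a' * e')) =
      th a * th a' * (a%:R%:C * q * (e1 * e2 - e * e')).
    rewrite [LHS](_ : _ = q * (e1 * e2) * (a%:R%:C * (th a.-1 * th a'.+1)) -
      q * (e * e') * (a%:R%:C * (th a * th a'))); last by ring.
    by rewrite thp; ring.
  have rC a a' : r%:C * (rate a a')%:C = a%:R%:C * (lam + sig * a'%:R)%:C.
    by rewrite -!rmorphM /= rateE.
  have expand (q q' X Y : R[i]) : r%:C * (q * X + q' * Y) = (r%:C * q) * X + (r%:C * q') * Y.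
    by ring.
  apply: (mulfI r0'); rewrite !expand !rC !dE side.
  rewrite [th x1.+1 * _ * _]mulrC [th x1 * _ * (th x2 * _)]mulrC side.
  set L1 := (lam + sig * x1%:R); set L2 := (lam + sig * x2%:R).
  set L3 := (lam + sig * y1%:R); set L4 := (lam + sig * y2%:R).
  rewrite (mulrC (th x2)) -mulrDr.
  rewrite [RHS](_ : _ = th x1 * th x2 *
     (y1%:R%:C * L4%:C * ((E b x1 y1.-1)%:C * (E b x2 y2.+1)%:C - (E b x1 y1)%:C * (E b x2 y2)%:C) +
      y2%:R%:C * L3%:C * ((E b x1 y1.+1)%:C * (E b x2 y2.-1)%:C - (E b x1 y1)%:C * (E b x2 y2)%:C))); last by ring.
  congr (_ * _); rewrite -!rmorphM -!rmorphB -!rmorphM -!rmorphD /=; congr (_%:C).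
  rewrite /flow_ker [RHS]h /L1 /L2; ring.
- by move=> x; have [] := P x x.
- move=> x x' xx'; have [_ ->] := P x x'; apply: inner_disjoint => y.
  rewrite !DchE; case: (x =P y) => [e|_]; last by rewrite mulr0 mul0r.
  by case: (x' =P y) => [e'|_]; [case: xx'; rewrite e e'|rewrite mulr0 rmorph0 mulr0].
- by move=> x; have [_ ->] := P x x.
Qed.

End KernelConclusion.

(** * Independent random walkers *)

Section Hypergeometric.
Context {R : realType}.
Implicit Types (x y m : nat).

Lemma rising_opp x m : rising (- x%:R : R) m = (-1) ^+ m * (m`!%:R * 'C(x, m)%:R).
Proof.
rewrite -natrM mulnC bin_ffact /rising; elim: m => [|m IH].
  by rewrite big_ord0 ffactn0 mul1r.
rewrite big_ord_recr /= IH ffactnSr natrM exprS.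
have [xm|mx] := ltnP x m; first by rewrite ffact_small// !(mul0r, mulr0).
by rewrite natrB//; ring.
Qed.

Lemma rising_poch (l : R) m : rising l m = poch l 1 m.
Proof. by apply: eq_bigr => i _; rewrite mul1r. Qed.

Lemma hypergeometric_finite (a b : seq R) (z : R) N :
  (forall m, (N <= m)%N -> hyp_term a b z m = 0) ->
  hypergeometric a b z = \sum_(m < N) hyp_term a b z m.
Proof.
move=> h; apply/cvg_lim => //; rewrite series_psum.
apply: (@cvg_trans _ ((fun=> psum (hyp_term a b z) N) @ \oo)); last exact: cvg_cst.
apply: near_eq_cvg; near=> M.
have NM : (N <= M)%N by near: M; exact: nbhs_infty_ge.
rewrite -(subnK NM); elim: (M - N)%N => [//|k IH].
by rewrite addSn psumS -IH h ?leq_addl// addr0.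
Unshelve. all: by end_near. Qed.

Lemma signr_cancel x (a b : R) : (-1) ^+ x * (a * ((-1) ^+ x * b)) = a * b.
Proof.
by rewrite mulrCA [(-1) ^+ x * (_ * _)]mulrA -exprMn mulrNN mulr1 expr1n mul1r.
Qed.

Lemma rising_prod x y m : \prod_(l <- [:: - x%:R; - y%:R : R]) rising l m =
  m`!%:R ^+ 2 * 'C(x, m)%:R * 'C(y, m)%:R.
Proof.
rewrite !big_cons big_nil mulr1 !rising_opp.
have : (-1) ^+ m * (-1) ^+ m = 1 :> R by rewrite -exprMn mulrNN mulr1 expr1n.
move: ((-1) ^+ m) => e e2; rewrite [LHS](_ : _ = (e * e) * (m`!%:R ^+ 2 * 'C(x, m)%:R * 'C(y, m)%:R)); last ring.
by rewrite e2 mul1r.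
Qed.

(** The only trace of [tau] is the sign [(-1) ^ (x - m)], which splits into the prefactor [(-1) ^ x]
    and the sign of [- rho]. *)
Lemma ker_tau1_hypergeometric (lam sig rho nb : R) x y :
  ker lam sig 1 rho nb x y = nb * (-1) ^+ x *
    \sum_(m < (minn x y).+1)
      'C(x, m)%:R * 'C(y, m)%:R * ker_coef lam sig m * (- rho) ^+ m.
Proof.
rewrite /ker -mulrA [(-1) ^+ x * _]mulr_sumr; congr (_ * _).
apply: eq_bigr => m _; rewrite /kerm /shift_basis expr1n mulr1.
have mx : (m <= x)%N by have := ltn_ord m; rewrite ltnS leq_min => /andP[].
rewrite [(- rho) ^+ m]exprNn.
have sgn k j : (-1) ^+ k = (-1) ^+ (k + j) * (-1) ^+ j :> R.
  by rewrite exprD -mulrA -exprMn mulrNN mulr1 expr1n mulr1.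
by rewrite (sgn (x - m)%N m) subnK//; ring.
Qed.

End Hypergeometric.

Section IRWCase.
Context {R : realType}.
Variable p : R.
Hypothesis p0 : 0 < p.

(** With [sig = 0] and [c = 1] the Riccati equation is [tau' = 1]; the Gaussian [nb] reflects the
    central commutator of the Heisenberg algebra. *)
Let tau (b : R) := b.
Let nb (b : R) := expR (- p / 2 * b ^+ 2).

Let dtau (b : R) : is_derive b 1 tau (1 - 0 * tau b ^+ 2).
Proof. by rewrite mul0r subr0; exact: is_derive1_id. Qed.

Let dnb (b : R) : is_derive b 1 nb (- p * tau b * nb b).
Proof.
have h := is_derive1_cmul (- p / 2) (is_derive1_exprn 2 (is_derive1_id b)).
apply: is_derive_eq (is_derive1_compose (is_derive_expR _) h) _.
by rewrite /= expr1 /nb /tau; field.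
Qed.

Let nb0 : nb 0 = 1.
Proof. by rewrite /nb expr0n mulr0 expR0. Qed.

Let nbN (b : R) : nb (- b) = nb b.
Proof. by rewrite /nb sqrrN. Qed.

Let nb1 (b : R) : `|nb b| <= 1.
Proof.
rewrite ger0_norm ?expR_ge0// expR_le1.
have h := mulr_ge0 (ltW p0) (sqr_ge0 b).
by rewrite (_ : - p / 2 * b ^+ 2 = - (p * b ^+ 2 / 2)); [rewrite oppr_le0 divr_ge0|ring].
Qed.

Let tauB (B : R) : exists T T' : R, [/\ 0 <= T, T < T', 0 * T' ^+ 2 < 1 &
  forall b, `|b| <= B -> `|tau b| <= T].
Proof.
exists `|B|, (`|B| + 1); split => //.
- by rewrite ltrDl.
- by move=> b /le_trans; apply; exact: ler_norm.
Qed.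

Let wtE n : wt p 0 1 n = p ^+ n / n`!%:R.
Proof.
rewrite /wt expr1n mulr1; congr (_ / _); elim: n => [|n IH]; first by rewrite poch0.
by rewrite pochS IH mul0r addr0 exprSr.
Qed.

Let uE n : irw_gf n = wt p 0 1 n * p^-1 ^+ n.
Proof.
rewrite wtE /irw_gf exprVn; have := lt0r_neq0 (exprn_gt0 n p0).
by move: (p ^+ n) => v v0; rewrite mulrC mulrA mulVf// mul1r.
Qed.

Let ACE f n q : reim q (irw_A p f n) = flow_op p 0 1 (fun k => reim q (f k)) n.
Proof.
rewrite /irw_A /flow_op cpartD mul0r addr0; congr (_ + _).
  by rewrite -rmorphN cpartMl.
rewrite mul1r; case: n => [|n] /=; first by rewrite mul0r; case: q.
by rewrite -(rmorph_nat (@real_complex R)) cpartMl.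
Qed.

Let wE x : irw_w p x = expR (- p) * wt p 0 1 x.
Proof. by rewrite wtE mulrC. Qed.

Let DchE x y : irw_Dch p x y = ((wt p 0 1 x)^-1)%:C * (x == y)%:R.
Proof.
rewrite /irw_Dch wtE invf_div.
by have [->|_] := eqVneq x y; rewrite ?mulr0.
Qed.

Let rateE (a b : nat) : p * a%:R = a%:R * (p + 0 * b%:R).
Proof. by rewrite mul0r addr0 mulrC. Qed.

Let th (a : R) (x : nat) : R[i] := cexp ('i * (a * x%:R)%:C).

Let SE (a b : R) f : irw_S p a b f = exp_flow irw_gf b (irw_A p) (fun x => th a x * f x).
Proof.
rewrite /irw_S; congr exp_flow; apply/funext => x; rewrite /exp_idiag /th rmorphM mulrA.
congr (cexp (_ * _) * _); rewrite /irw_a /irw_ad; case: x => [//|x].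
by rewrite eqxx mulr1 rmorph_nat.
Qed.

Lemma irw_case :
  [/\ exp_well_defined irw_gf (irw_A p),
        forall a b : R,
        let d := fun x y : nat => irw_S p a b (irw_Dch p x) y in
        [/\ extends_to_unitary (irw_w p) (irw_S p a b),
            irw_self_duality d,
            forall x : nat, L2 (irw_w p) (d x),
            forall x x' : nat, x <> x' -> inner (irw_w p) (d x) (d x') = 0
          & forall x : nat, inner (irw_w p) (d x) (d x) =
              inner (irw_w p) (irw_Dch p x) (irw_Dch p x)]
      & forall x y : nat,
          irw_S p pi 1 (irw_Dch p x) y =
          (expR (- p / 2) * charlier p x y)%:C].
Proof.
have pV0 : 0 < p^-1 by rewrite invr_gt0.
split.
- exact: (@kernel_exp_well_defined _ _ _ _ _ _ _ _ _ p0 (lexx 0) ltr01 pV0 dtau dnb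
    erefl nb0 nb1 tauB uE ACE).
- move=> a b; rewrite /irw_self_duality (_ : irw_S p a b =
    fun f => exp_flow irw_gf b (irw_A p) (fun x => th a x * f x)); last first.
    by apply/funext => f; exact: SE.
  apply: (@kernel_conclusion _ _ _ _ _ _ p _ _ _ _ _ _ _ p0 (lexx 0) ltr01 pV0
    (expR_gt0 _) (lt0r_neq0 p0) dtau dnb erefl nb0 (fun=> erefl) nbN nb1 tauB uE ACE wE DchE
    (fun a b => rateE a b) (th a) (cexp ('i * a%:C)) b).
    by move=> x; exact: cexp_i_unit.
  by move=> x; rewrite /th -cexp_iD -natr1; congr (cexp (_ * _%:C)); ring.
- move=> x y; rewrite SE.
  rewrite (@kernel_duality_fun _ _ _ _ _ _ _ _ _ _ p0 (lexx 0) ltr01 pV0 dtau dnb erefl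
    nb0 nb1 tauB uE ACE DchE).
  rewrite /th -[x%:R]addr0 cexp_i_pi_nat mulr0 (_ : 'i * 0%:C = 'i * (0:R)%:C)//.
  rewrite cexp_i cos0 sin0 (_ : 1 +i* 0 = 1)// mulr1 -rmorphM; congr (_%:C).
  rewrite /flow_ker /tau ker_tau1_hypergeometric /nb expr1n mulr1 subr0 -[_ * _ * \sum_(_ < _) _]mulrA signr_cancel.
  congr (_ * _); [by rewrite mulr1|rewrite /charlier].
  (* [poch p 0 m] is [p ^ m]; together with [rho = 1] it gives the argument [- p^-1]. *)
  have tE m : hyp_term [:: - x%:R; - y%:R] [::] (- p^-1) m =
     'C(x, m)%:R * 'C(y, m)%:R * ker_coef p 0 m * (- 1) ^+ m.
    rewrite /hyp_term rising_prod big_nil divr1 /ker_coef.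
    rewrite (_ : poch p 0 m = p ^+ m); last first.
      by elim: m => [|m IH]; [rewrite poch0|rewrite pochS IH mul0r addr0 exprSr].
    have f0 : (m`!%:R : R) != 0 by rewrite pnatr_eq0 -lt0n fact_gt0.
    have e0 := lt0r_neq0 (exprn_gt0 m p0).
    rewrite (exprNn p^-1) exprVn; move: (p ^+ m) (m`!%:R) ((-1) ^+ m) e0 f0 => v f e v0 f0.
    by field; rewrite v0 f0.
  rewrite (@hypergeometric_finite _ _ _ _ (minn x y).+1); last first.
    move=> m; rewrite tE gtn_min => /orP[] h; rewrite (bin_small h) ?(mul0r, mulr0)//.
  by apply: eq_bigr => m _; rewrite tE.
Qed.

End IRWCase.

(** * Symmetric inclusion process *)

Section Hyperbolic.
Context {R : realType}.
Implicit Types t : R.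

Definition cosh t : R := (expR t + expR (- t)) / 2.
(** In this form monotonicity and the upper bound 1 are immediate. *)
Definition tanh t : R := 1 - 2 / (expR (2 * t) + 1).

Lemma cosh_gt0 t : 0 < cosh t.
Proof. by rewrite divr_gt0// addr_gt0 ?expR_gt0. Qed.

Lemma cosh_ge1 t : 1 <= cosh t.
Proof.
rewrite /cosh expRN; have := expR_gt0 t; move: (expR t) => e e0.
rewrite -subr_ge0 (_ : _ - _ = (e - 1) ^+ 2 / (2 * e)); last by field; rewrite gt_eqF.
by rewrite divr_ge0 ?sqr_ge0// mulr_ge0// ltW.
Qed.

Lemma coshN t : cosh (- t) = cosh t.
Proof. by rewrite /cosh opprK addrC. Qed.

Lemma tanhN t : tanh (- t) = - tanh t.
Proof.
rewrite /tanh mulrN expRN; have := expR_gt0 (2 * t); move: (expR (2 * t)) => e e0.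
by field; rewrite ?gt_eqF// ?addr_gt0//.
Qed.

Lemma tanh0 : tanh 0 = 0.
Proof. by rewrite /tanh mulr0 expR0; field. Qed.

Lemma cosh0 : cosh 0 = 1.
Proof. by rewrite /cosh oppr0 expR0; field. Qed.

Lemma is_derive_tanh t : is_derive t 1 tanh (1 - tanh t ^+ 2).
Proof.
have h1 := is_derive1_compose (is_derive_expR (2 * t)) (is_derive1_cmul 2 (is_derive1_id t)).
have h2 := is_derive1_add h1 (is_derive1_cst 1 t).
have n0 : expR (2 * t) + 1 != 0 by rewrite gt_eqF.
have h3 := @is_deriveV R (fun t => expR (2 * t) + 1) t _ 1 n0 h2.
have h4 := is_derive1_add (is_derive1_cst 1 t) (is_derive1_opp (is_derive1_cmul 2 h3)).
apply: is_derive_eq h4 _; rewrite /tanh /GRing.scale /=.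
by move: (expR (2 * t)) n0 => e n0; field.
Qed.

Lemma is_derive_cosh t : is_derive t 1 cosh (cosh t * tanh t).
Proof.
have h1 := is_derive1_compose (is_derive_expR (- t)) (is_derive1_opp (is_derive1_id t)).
have h2 := is_derive1_mul (is_derive1_add (is_derive_expR t) h1) (is_derive1_cst 2^-1 t).
apply: is_derive_eq h2 _.
rewrite /cosh /tanh (_ : 2 * t = t + t); last ring.
rewrite expRD expRN; have := expR_gt0 t; move: (expR t) => e e0.
have n1 : e != 0 by rewrite gt_eqF.
have n2 : e * e + 1 != 0 by rewrite gt_eqF// addr_gt0// mulr_gt0.
by field; rewrite ?n1 ?n2.
Qed.

Lemma tanh_bound (B : R) : exists T : R, [/\ 0 <= T, T < 1 &
  forall t, `|t| <= B -> `|tanh t| <= T].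
Proof.
have nn s : 0 <= s -> 0 <= tanh s.
  move=> s0; rewrite subr_ge0 ler_pdivrMr// mul1r -[2]/(1 + 1) lerD2r.
  by rewrite -[leLHS]expR0 ler_expR mulr_ge0.
have lt1 s : tanh s < 1 by rewrite gtrBl divr_gt0.
have mono s r : s <= r -> tanh s <= tanh r.
  move=> sr; rewrite lerD2l lerN2 ler_pM2l// lef_pV2 ?posrE// lerD2r ler_expR.
  by rewrite ler_pM2l.
exists (tanh `|B|); split => // [|t tB]; first exact: nn.
have tB' : `|t| <= `|B| by rewrite (le_trans tB)// ler_norm.
rewrite (_ : `|tanh t| = tanh `|t|); first exact: mono.
have [t0|t0] := leP 0 t; first by rewrite !ger0_norm// nn.
by rewrite (ltr0_norm t0) tanhN ler0_norm// -[tanh t]opprK -tanhN oppr_le0 nn// oppr_ge0 ltW.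
Qed.

End Hyperbolic.

Section SIPCase.
Context {R : realType}.
Variables k p : R.
Hypotheses (k0 : 0 < k) (p01 : 0 < p < 1).

Let p0 : 0 < p. Proof. by case/andP: p01. Qed.
Let p1 : p < 1. Proof. by case/andP: p01. Qed.
Let lam0 : 0 < 2 * k. Proof. by rewrite mulr_gt0. Qed.
Let c0 : 0 < p^-1. Proof. by rewrite invr_gt0. Qed.

Let s := Num.sqrt p.
Let s0 : 0 < s. Proof. by rewrite sqrtr_gt0. Qed.
Let s2 : s ^+ 2 = p. Proof. by rewrite sqr_sqrtr// ltW. Qed.

(** Rescaling by [s], the root of [p], reduces [tau' = p^-1 - tau ^ 2] to the equation of [tanh]. *)
Let tau (b : R) := tanh (b / s) / s.
Let nb (b : R) := cosh (b / s) `^ (- (2 * k)).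

Let scaled (f : R -> R) df (b : R) : is_derive (b / s) 1 f df ->
  is_derive b 1 (fun b => f (b / s)) (df / s).
Proof.
move=> h; have h1 := is_derive1_mul (is_derive1_id b) (is_derive1_cst s^-1 b).
have hh := @is_derive1_compose R f (fun b => b * s^-1) b _ _ h h1.
by apply: is_derive_eq hh _; rewrite mulr0 addr0 mul1r.
Qed.

Let dtau (b : R) : is_derive b 1 tau (p^-1 - 1 * tau b ^+ 2).
Proof.
have h := is_derive1_mul (scaled (is_derive_tanh (b / s))) (is_derive1_cst s^-1 b).
apply: is_derive_eq h _; rewrite /tau -s2; field; exact: lt0r_neq0.
Qed.

Let dnb (b : R) : is_derive b 1 nb (- (2 * k) * tau b * nb b).
Proof.
have h := is_derive1_powR (- (2 * k)) (cosh_gt0 (b / s)).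
have hh := @is_derive1_compose R (fun t => t `^ (- (2 * k))) (fun b => cosh (b / s)) b _ _
  h (scaled (is_derive_cosh (b / s))).
apply: is_derive_eq hh _.
rewrite /nb /tau; have c1 := cosh_gt0 (b / s); move: (tanh _) => th.
rewrite -[in RHS](subrK 1 (- (2 * k))) [X in _ = _ * X]powRD; last first.
  by apply/implyP => _; rewrite gt_eqF.
by rewrite powRr1 ?(ltW c1)//; ring.
Qed.

Let tau0 : tau 0 = 0.
Proof. by rewrite /tau mul0r tanh0 mul0r. Qed.

Let nb0 : nb 0 = 1.
Proof. by rewrite /nb mul0r cosh0 powR1. Qed.

Let tauN (b : R) : tau (- b) = - tau b.
Proof. by rewrite /tau mulNr tanhN mulNr. Qed.

Let nbN (b : R) : nb (- b) = nb b.
Proof. by rewrite /nb mulNr coshN. Qed.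

Let nb1 (b : R) : `|nb b| <= 1.
Proof.
rewrite ger0_norm ?powR_ge0// -[leRHS](powRr0 (cosh (b / s))).
by rewrite ler_powR ?cosh_ge1// oppr_le0 ltW.
Qed.

(** On bounded sets [tanh] stays below some [T < 1]; the midpoint of [T] and 1 provides the
    margin. *)
Let tauB (B : R) : exists T T' : R, [/\ 0 <= T, T < T', 1 * T' ^+ 2 < p^-1 &
  forall b, `|b| <= B -> `|tau b| <= T].
Proof.
have [T [T0 T1 hT]] := tanh_bound (B / s).
have sV : 0 < s^-1 by rewrite invr_gt0.
exists (T / s), ((1 + T) / 2 / s); split.
- by rewrite divr_ge0// ltW.
- by rewrite ltr_pM2r//; lra.
- rewrite mul1r -s2 expr_div_n -[ltRHS]mul1r ltr_pM2r ?invr_gt0 ?exprn_gt0//.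
  by rewrite expr_lt1//; lra.
- move=> b bB; rewrite /tau normrM (gtr0_norm sV) ler_pM2r//; apply: hT.
  by rewrite normrM (gtr0_norm sV) ler_pM2r.
Qed.

(** This turns the Gamma quotients of the SIP data into the finite products of [wt]. *)
Let Gamma_poch n : Gamma (2 * k + n%:R) = poch (2 * k) 1 n * Gamma (2 * k).
Proof.
elim: n => [|n IH]; first by rewrite poch0 mul1r addr0.
rewrite -[n.+1%:R]natr1 addrA GammaS ?IH ?pochS ?mul1r; first by ring.
by rewrite ltr_pwDl.
Qed.

Let G0 : Gamma (2 * k) != 0.
Proof. by rewrite gt_eqF// Gamma_gt0. Qed.

Let fact0 n : (n`!%:R : R) != 0.
Proof. by rewrite pnatr_eq0 -lt0n fact_gt0. Qed.

Let poch_neq0 n : poch (2 * k) 1 n != 0.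
Proof. by rewrite gt_eqF// prodr_gt0// => i _; rewrite ltr_pwDl// mul1r. Qed.

Let uE n : sip_gf k n = wt (2 * k) 1 p^-1 n * p^-1 ^+ n.
Proof.
rewrite /sip_gf /wt Gamma_poch.
have := lt0r_neq0 (exprn_gt0 n c0); move: (p^-1 ^+ n) (fact0 n) => v.
by move: (n`!%:R) => f f0 v0; field; rewrite f0 v0 G0.
Qed.

Let ACE f n q : reim q (sip_A k p f n) =
  flow_op (2 * k) 1 p^-1 (fun m => reim q (f m)) n.
Proof.
rewrite /sip_A /flow_op cpartD mul1r; congr (_ + _).
  by rewrite /sip_Kp -mulNr -rmorphN cpartMl.
rewrite cpartMl -mulrA; congr (_ * _); case: n => [|n] /=.
  by rewrite mul0r; case: q.
by rewrite -(rmorph_nat (@real_complex R)) cpartMl.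
Qed.

Let wE x : sip_w k p x = (1 - p) `^ (2 * k) * wt (2 * k) 1 p^-1 x.
Proof.
rewrite /sip_w /wt Gamma_poch exprVn.
have := lt0r_neq0 (exprn_gt0 x p0); move: (p ^+ x) (fact0 x) => v.
by move: (x`!%:R) => f f0 v0; field; rewrite f0 v0 G0.
Qed.

Let DchE x y : sip_Dch k p x y = ((wt (2 * k) 1 p^-1 x)^-1)%:C * (x == y)%:R.
Proof.
rewrite /sip_Dch; have [<-|_] := eqVneq x y; last by rewrite !mulr0.
congr (_%:C * _); rewrite /wt Gamma_poch exprVn.
have := lt0r_neq0 (exprn_gt0 x p0); move: (p ^+ x) (fact0 x) => v.
by move: (x`!%:R) => f f0 v0; field; rewrite f0 v0 G0 poch_neq0.
Qed.

Let rateE (a b : nat) : 1 * (a%:R * (2 * k + b%:R)) = a%:R * (2 * k + 1 * b%:R).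
Proof. by rewrite !mul1r. Qed.

Let th (a : R) (x : nat) : R[i] := cexp ('i * (a * (x%:R + k))%:C).

Let SE (a b : R) f : sip_S k p a b f =
  exp_flow (sip_gf k) b (sip_A k p) (fun x => th a x * f x).
Proof.
rewrite /sip_S; congr exp_flow; apply/funext => x; rewrite /exp_idiag /th.
have -> : sip_K0 k (fun y => (y == x)%:R) x = (x%:R + k)%:C.
  by rewrite /sip_K0 eqxx mulr1.
by rewrite rmorphM mulrA.
Qed.

(** The time at which [tau] reaches 1, since [tanh (b1 / s) = s]. *)
Let b1 := Num.sqrt p * arctanh (Num.sqrt p).

Let s1 : s < 1.
Proof. by rewrite -sqrtr1 ltr_sqrt. Qed.

Let exp_b1 : expR (2 * (b1 / s)) = (1 + s) / (1 - s).
Proof.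
rewrite /b1 -/s /arctanh (_ : 2 * _ = ln ((1 + s) / (1 - s))).
  by rewrite lnK// posrE divr_gt0 ?subr_gt0// addr_gt0.
by field; exact: lt0r_neq0.
Qed.

Let tau_b1 : tau b1 = 1.
Proof.
rewrite /tau /tanh exp_b1; field.
rewrite gt_eqF//= gt_eqF ?subr_gt0//=.
by rewrite (_ : 1 + s + (1 - s) = 2)//; ring.
Qed.

(** From [tanh = s] one gets [cosh ^ 2 = 1 / (1 - s ^ 2) = 1 / (1 - p)]. *)
Let nb_b1 : nb b1 = (1 - p) `^ k.
Proof.
have p1' : 0 < 1 - p by rewrite subr_gt0.
have c1 := cosh_gt0 (b1 / s).
have c2 : cosh (b1 / s) ^+ 2 = (1 - p)^-1.
  have e0 := expR_gt0 (b1 / s).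
  have := exp_b1; rewrite (_ : 2 * _ = b1 / s + b1 / s); last by field; exact: lt0r_neq0.
  rewrite expRD /cosh expRN; move: (expR (b1 / s)) e0 => e e0 ee.
  have -> : ((e + e^-1) / 2) ^+ 2 = (e * e + 2 + (e * e)^-1) / 4.
    by field; exact: lt0r_neq0.
  rewrite ee -s2.
  have n1 : 1 - s != 0 by rewrite gt_eqF// subr_gt0.
  have n2 : 1 + s != 0 by rewrite gt_eqF// addr_gt0.
  have -> : 1 - s ^+ 2 = (1 - s) * (1 + s) by ring.
  by field; rewrite n1 n2.
rewrite /nb (_ : - (2 * k) = - 2%:R * k); last by rewrite mulNr.
by rewrite powRrM powR_invn ?(ltW c1)// c2 invrK.
Qed.

Lemma sip_case :
    [/\ exp_well_defined (sip_gf k) (sip_A k p),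
        forall a b : R,
        let d := fun x y : nat => sip_S k p a b (sip_Dch k p x) y in
        [/\ extends_to_unitary (sip_w k p) (sip_S k p a b),
            sip_self_duality k d,
            forall x : nat, L2 (sip_w k p) (d x),
            forall x x' : nat, x <> x' -> inner (sip_w k p) (d x) (d x') = 0
          & forall x : nat, inner (sip_w k p) (d x) (d x) =
              inner (sip_w k p) (sip_Dch k p x) (sip_Dch k p x)]
      & forall x y : nat,
          sip_S k p pi (Num.sqrt p * arctanh (Num.sqrt p)) (sip_Dch k p x) y =
          sip_phase k p * (meixner k p x y)%:C].
Proof.
have K0 : 0 < (1 - p) `^ (2 * k) by rewrite powR_gt0// subr_gt0.
split.
- exact: (@kernel_exp_well_defined _ _ _ _ _ _ _ _ _ lam0 ler01 c0 c0 dtau dnb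
    tau0 nb0 nb1 tauB uE ACE).
- move=> a b; rewrite /sip_self_duality (_ : sip_S k p a b =
    fun f => exp_flow (sip_gf k) b (sip_A k p) (fun x => th a x * f x)); last first.
    by apply/funext => f; exact: SE.
  apply: (@kernel_conclusion _ _ _ _ _ _ 1 _ _ _ _ _ _ _ lam0 ler01 c0 c0
    K0 (oner_neq0 _) dtau dnb tau0 nb0 tauN nbN nb1 tauB uE ACE wE DchE
    rateE (th a) (cexp ('i * a%:C)) b).
    by move=> x; exact: cexp_i_unit.
  by move=> x; rewrite /th -cexp_iD -natr1; congr (cexp (_ * _%:C)); ring.
- move=> x y; rewrite SE.
  rewrite (@kernel_duality_fun _ _ _ _ _ _ _ _ _ _ lam0 ler01 c0 c0 dtau dnb tau0
    nb0 nb1 tauB uE ACE DchE).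
  rewrite /th cexp_i_pi_nat /sip_phase mulrAC -rmorphM mulrC -[RHS]mulrA -rmorphM.
  congr (_ * _%:C).
  rewrite /flow_ker -/b1 tau_b1 nb_b1 ker_tau1_hypergeometric expr1n mulr1.
  rewrite -[_ * _ * \sum_(_ < _) _]mulrA signr_cancel; congr (_ * _).
  (* At [tau = 1], [rho = p^-1 - 1], so [- rho] is the Meixner argument. *)
  have tE m : hyp_term [:: - x%:R; - y%:R] [:: 2 * k] (1 - p^-1) m =
     'C(x, m)%:R * 'C(y, m)%:R * ker_coef (2 * k) 1 m * (- (p^-1 - 1)) ^+ m.
    rewrite /hyp_term rising_prod big_cons big_nil mulr1 rising_poch /ker_coef opprB.
    move: ((1 - p^-1) ^+ m) (poch_neq0 m) (fact0 m) => v.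
    by move: (m`!%:R) (poch _ _ _) => f g g0 f0; field; rewrite f0 g0.
  rewrite /meixner (@hypergeometric_finite _ _ _ _ (minn x y).+1); last first.
    move=> m; rewrite tE gtn_min => /orP[] h; rewrite (bin_small h) ?(mul0r, mulr0)//.
  by apply: eq_bigr => m _; rewrite tE.
Qed.

End SIPCase.

(** * Symmetric exclusion process *)

Section MatrixExponential.
Context {R : realType}.
Variables (n : nat) (M : 'M[R]_n.+1).
Implicit Types (x y z : 'I_n.+1) (Q : 'M[R]_n.+1) (b : R).

Let D : R := \sum_i \sum_j `|M i j|.

Let D0 : 0 <= D.
Proof. by apply: sumr_ge0 => i _; apply: sumr_ge0. Qed.

Let rowD x : \sum_z `|M x z| <= D.
Proof.
rewrite /D [leRHS](bigD1 x)//= lerDl; apply: sumr_ge0 => i _; exact: sumr_ge0.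
Qed.

Let power_bound m x y : `|(M ^+ m) x y| <= D ^+ m.
Proof.
elim: m x => [|m IH] x.
  by rewrite !expr0 mxE; case: (x == y); rewrite ?normr1 ?normr0.
rewrite !exprS mxE; apply: (le_trans (ler_norm_sum _ _ _)).
apply: (@le_trans _ _ (\sum_z `|M x z| * D ^+ m)).
  by apply: ler_sum => z _; rewrite normrM ler_wpM2l.
by rewrite -mulr_suml ler_wpM2r ?exprn_ge0.
Qed.

(** The left factor [Q] makes the family closed under termwise differentiation, which replaces [Q]
    by [Q *m M]. *)
Let coef Q x y m : R := (Q *m M ^+ m) x y / m`!%:R.

Let coef_diffs Q x y : pseries_diffs (coef Q x y) = coef (Q *m M) x y.
Proof.
apply/funext => m; rewrite /pseries_diffs /coef exprS -mulmxA mulmxE.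
have m0 : (m.+1%:R : R) != 0 by rewrite pnatr_eq0.
have f0 : (m`!%:R : R) != 0 by rewrite pnatr_eq0 -lt0n fact_gt0.
rewrite factS natrM; move: (m.+1%:R) (m`!%:R) m0 f0 => u v u0 v0.
by field; rewrite u0 v0.
Qed.

Let coef_cvg Q x y b : cvgn (psum (fun m => coef Q x y m * b ^+ m)).
Proof.
pose q := \sum_z `|Q x z|.
apply: (@psum_norm_cvg _ _ (fun m => q * exp_coeff (D * `|b|) m)) => [m|].
  rewrite /coef /exp_coeff /= normrM normrM normfV normr_nat normrX exprMn.
  rewrite [leRHS](_ : _ = q * D ^+ m / m`!%:R * `|b| ^+ m); last by ring.
  rewrite ler_wpM2r ?exprn_ge0// ler_wpM2r ?invr_ge0// mxE.
  apply: (le_trans (ler_norm_sum _ _ _)); rewrite mulr_suml.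
  by apply: ler_sum => z _; rewrite normrM ler_wpM2l.
have h := is_cvg_series_exp_coeff (D * `|b|); rewrite series_psum in h.
rewrite (_ : psum _ = fun N => q * psum (exp_coeff (D * `|b|)) N); last first.
  by apply/funext => N; rewrite psumZ.
exact: is_cvgMr.
Qed.

(** The generator matrix is real, so its exponential is studied over [R] and carried to [R[i]] by
    [rexpm_mxexp]. *)
Definition rexpm b x y : R := limn (psum (fun m => (M ^+ m) x y / m`!%:R * b ^+ m)).

Let expQ Q b x y := limn (psum (fun m => coef Q x y m * b ^+ m)).

Let expQ1 b x y : rexpm b x y = expQ 1%:M b x y.
Proof.
rewrite /rexpm /expQ (_ : (fun m => coef _ x y m * _) =
    fun m => (M ^+ m) x y / m`!%:R * b ^+ m)//.
by apply/funext => m; rewrite /coef mul1mx.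
Qed.

Lemma rexpm_cvg b x y :
  psum (fun m => (M ^+ m) x y / m`!%:R * b ^+ m) @ \oo --> rexpm b x y.
Proof.
have := @coef_cvg 1%:M x y b; rewrite (_ : (fun m => coef _ x y m * _) =
    fun m => (M ^+ m) x y / m`!%:R * b ^+ m)//.
by apply/funext => m; rewrite /coef mul1mx.
Qed.

Lemma rexpm_mxexp b x y :
  mxexp (b%:C *: map_mx (real_complex R) M) x y = (rexpm b x y)%:C.
Proof.
rewrite mxE; apply: clim_uniq.
have e N : series (fun m => (m`!%:R)^-1 * ((b%:C *: map_mx (real_complex R) M) ^+ m) x y) N =
    (psum (fun m => (M ^+ m) x y / m`!%:R * b ^+ m) N)%:C.
  rewrite /series /psum /= big_mkord rmorph_sum; apply: eq_bigr => m _.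
  rewrite exprZn -rmorphXn -rmorphXn /= !mxE !rmorphM /= fmorphV rmorph_nat; ring.
split.
  by rewrite (_ : (fun N => _) = psum (fun m => (M ^+ m) x y / m`!%:R * b ^+ m));
    [exact: rexpm_cvg|apply/funext => N; rewrite e].
by rewrite (_ : (fun N => _) = fun=> 0); [exact: cvg_cst|apply/funext => N; rewrite e].
Qed.

Lemma rexpm0 x y : rexpm 0 x y = (x == y)%:R.
Proof.
apply/cvg_lim => //; apply: (@cvg_trans _ ((fun=> (x == y)%:R : R) @ \oo)); last exact: cvg_cst.
apply: near_eq_cvg; near=> N.
have N0 : (0 < N)%N by near: N; exact: nbhs_infty_gt.
rewrite -(prednK N0) /psum big_ord_recl big1 ?addr0.
  by rewrite expr0 mxE fact0 divr1 mulr1.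
by move=> m _; rewrite expr0n mulr0.
Unshelve. all: by end_near. Qed.

Lemma rexpm_derive b x y :
  is_derive b 1 (fun s => rexpm s x y) (\sum_z M x z * rexpm b z y).
Proof.
have cv Q t : cvgn (pseries (coef Q x y) t).
  by rewrite /pseries series_psum; exact: coef_cvg.
have h : is_derive b 1 (fun s => limn (pseries (coef 1%:M x y) s))
    (limn (pseries (pseries_diffs (coef 1%:M x y)) b)).
  apply: (@pseries_snd_diffs _ _ (`|b| + 1)); rewrite ?coef_diffs//.
  by rewrite [ltRHS]ger0_norm ?addr_ge0// ltrDl.
rewrite (_ : (fun s => rexpm s x y) = (fun s => limn (pseries (coef 1%:M x y) s))); last first.
  by apply/funext => s; rewrite expQ1 /expQ /pseries series_psum.
apply: is_derive_eq h _; rewrite coef_diffs mul1mx /pseries series_psum.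
apply/cvg_lim => //; apply: (@cvgn_ext _ (fun N => \sum_z M x z * psum (fun m => (M ^+ m) z y / m`!%:R * b ^+ m) N)).
  move=> N; rewrite /psum; under eq_bigr do rewrite mulr_sumr.
  rewrite exchange_big; apply: eq_bigr => m _ /=.
  rewrite /coef mxE !mulr_suml; apply: eq_bigr => z _; ring.
apply: cvg_big => [|z _]; first exact: add_continuous.
by apply: cvgMr; exact: rexpm_cvg.
Qed.

End MatrixExponential.

(** * Energy conservation and the flow on two sites *)

Section TwoVariableFlow.
Context {R : realType}.
Variables (lam sig c : R).
Local Notation W := (wt lam sig c).
Local Notation A := (flow_op lam sig c).
Implicit Types F : nat -> nat -> R.

Definition flow_op2 F y1 y2 : R := A (F ^~ y2) y1 + A (F y1) y2.

Definition pair_gen F y1 y2 : R :=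
  y1%:R * (lam + sig * y2%:R) * (F y1.-1 y2.+1 - F y1 y2) +
  y2%:R * (lam + sig * y1%:R) * (F y1.+1 y2.-1 - F y1 y2).

(** Occupations 0 and 1 are separated because two successive removals meet the truncation of
    [predn], where the coefficients vanish. *)
Lemma pair_gen_flow_op2 F y1 y2 :
  pair_gen (flow_op2 F) y1 y2 = flow_op2 (pair_gen F) y1 y2.
Proof.
rewrite /flow_op2 /pair_gen /flow_op.
case: y1 => [|[|y1]]; case: y2 => [|[|y2]]; cbn [predn]; rewrite -?natr1; ring.
Qed.

(* At [y = n] the coefficient of [f y.+1] in [flow_op] is 0, so the values of a
   function beyond [n] are irrelevant. *)
Variable n : nat.
Hypotheses (lamE : lam + sig * n%:R = 0) (c0 : c != 0).
Hypothesis wt0 : forall y, (y <= n)%N -> 0 < W y.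

Lemma wt_last : W n.+1 = 0.
Proof.
have := wtS lam sig n c0; rewrite lamE mul0r => /eqP.
by rewrite mulf_eq0 mulf_eq0 (negbTE c0) pnatr_eq0 => /eqP.
Qed.

(** The flux of [flow_op_antisym] at [N = n + 1] carries [W n.+1 = 0], so antisymmetry is exact
    here. *)
Lemma energy_derive (g h : R -> nat -> R) (s : R) :
  (forall y, (y <= n)%N -> is_derive s 1 (fun t => g t y) (A (g s) y)) ->
  (forall y, (y <= n)%N -> is_derive s 1 (fun t => h t y) (A (h s) y)) ->
  is_derive s 1 (fun t => \sum_(y < n.+1) g t y * h t y * W y) 0.
Proof.
move=> dg dh; rewrite [X in is_derive _ _ _ X](_ : 0 =
    \sum_(y < n.+1) (A (g s) y * h s y + g s y * A (h s) y) * W y); last first.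
  by rewrite flow_op_antisym// wt_last !(mulr0, mul0r) oppr0.
apply: is_derive1_sum => y.
have dy := is_derive1_mul (dg y (ltn_ord y)) (dh y (ltn_ord y)).
have hd := is_derive1_mul dy (is_derive1_cst (W y) s).
by apply: is_derive_eq hd _; rewrite mulr0 addr0.
Qed.

Lemma energy_eq0 (g : nat -> R) : \sum_(y < n.+1) g y * g y * W y = 0 ->
  forall y, (y <= n)%N -> g y = 0.
Proof.
move=> h y yn; have y' : (y < n.+1)%N by [].
have p0 (i : 'I_n.+1) : 0 <= g i * g i * W i.
  by rewrite mulr_ge0 ?(ltW (wt0 _))// -?expr2 ?sqr_ge0// -ltnS.
have /(_ (Ordinal y') isT) /= := psumr_eq0P (fun i _ => p0 i) h.
by move/eqP; rewrite mulf_eq0 (gt_eqF (wt0 yn)) orbF mulf_eq0 orbb => /eqP.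
Qed.

Definition flow2 (H : R -> nat -> nat -> R) := forall (s : R) y1 y2,
  (y1 <= n)%N -> (y2 <= n)%N ->
  is_derive s 1 (fun t => H t y1 y2) (flow_op2 (H s) y1 y2).

Lemma flow2_lin (a : R) H H' : flow2 H -> flow2 H' ->
  flow2 (fun t y1 y2 => a * H t y1 y2 + H' t y1 y2).
Proof.
move=> hH hH' s y1 y2 h1 h2.
apply: is_derive_eq (is_derive1_add (is_derive1_cmul a (hH s _ _ h1 h2)) (hH' s _ _ h1 h2)) _.
by rewrite /flow_op2 /flow_op; ring.
Qed.

(** By commutation, [pair_gen] maps solutions to solutions. A jump to occupation [n + 1] has rate 0,
    so [H] is differentiated only where its equation is known. *)
Lemma flow2_gen H : flow2 H -> flow2 (fun t => pair_gen (H t)).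
Proof.
move=> hH s y1 y2 h1 h2; rewrite -pair_gen_flow_op2.
have d0 := hH s _ _ h1 h2.
have jump (q : R) a1 a2 : (a2 <= n)%N -> (a1 <= n)%N ->
    is_derive s 1 (fun t => q * (lam + sig * a2%:R) * (H t a1.-1 a2.+1 - H t y1 y2))
     (q * (lam + sig * a2%:R) * (flow_op2 (H s) a1.-1 a2.+1 - flow_op2 (H s) y1 y2)).
  move=> a2n a1n; have [->|ne] := eqVneq a2 n.
    rewrite lamE mulr0 mul0r.
    rewrite (_ : (fun t => _) = fun=> 0); first exact: is_derive1_cst.
    by apply/funext => t; rewrite mul0r.
  apply: is_derive1_cmul; apply: (is_derive1_add _ (is_derive1_opp d0)).
  apply: hH; first exact: leq_trans (leq_pred _) _.
  by rewrite ltn_neqAle ne.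
have jump' (q : R) a1 a2 : (a2 <= n)%N -> (a1 <= n)%N ->
    is_derive s 1 (fun t => q * (lam + sig * a1%:R) * (H t a1.+1 a2.-1 - H t y1 y2))
     (q * (lam + sig * a1%:R) * (flow_op2 (H s) a1.+1 a2.-1 - flow_op2 (H s) y1 y2)).
  move=> a2n a1n; have [->|ne] := eqVneq a1 n.
    rewrite lamE mulr0 mul0r.
    rewrite (_ : (fun t => _) = fun=> 0); first exact: is_derive1_cst.
    by apply/funext => t; rewrite mul0r.
  apply: is_derive1_cmul; apply: (is_derive1_add _ (is_derive1_opp d0)).
  apply: hH; last exact: leq_trans (leq_pred _) _.
  by rewrite ltn_neqAle ne.
by apply: is_derive1_add; [exact: jump|exact: jump'].
Qed.

(** The energy summed over both variables is constant: with one variable fixed, the sum over the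
    other reduces to a flux weighted by [W n.+1 = 0]. *)
Lemma flow2_eq0 H : flow2 H ->
  (forall y1 y2, (y1 <= n)%N -> (y2 <= n)%N -> H 0 y1 y2 = 0) ->
  forall b y1 y2, (y1 <= n)%N -> (y2 <= n)%N -> H b y1 y2 = 0.
Proof.
move=> hH H0 b y1 y2 h1 h2.
pose S t := \sum_(z1 < n.+1) \sum_(z2 < n.+1) H t z1 z2 * H t z1 z2 * W z1 * W z2.
have dS (s : R) : is_derive s 1 S 0.
  have d (z1 z2 : 'I_n.+1) : is_derive s 1 (fun t => H t z1 z2 * H t z1 z2 * W z1 * W z2)
      (W z2 * ((A (H s ^~ z2) z1 * H s z1 z2 + H s z1 z2 * A (H s ^~ z2) z1) * W z1) +
       W z1 * ((A (H s z1) z2 * H s z1 z2 + H s z1 z2 * A (H s z1) z2) * W z2)).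
    have dH := hH s z1 z2 (ltn_ord z1) (ltn_ord z2).
    have := is_derive1_cmul (W z1 * W z2) (is_derive1_mul dH dH).
    rewrite (_ : (fun t => _ * _ * (_ * _)) = fun t => H t z1 z2 * H t z1 z2 * W z1 * W z2); last first.
      by apply/funext => t; ring.
    by move=> h; apply: is_derive_eq h _; rewrite /flow_op2; ring.
  apply: is_derive_eq (is_derive1_sum _ _ (fun z1 => is_derive1_sum _ _ (d z1))) _.
  under eq_bigr do rewrite big_split /=.
  rewrite big_split /= exchange_big /= [X in X + _]big1 => [|z2 _]; last first.
    by rewrite -mulr_sumr flow_op_antisym// wt_last !(mulr0, mul0r) oppr0 mulr0.
  rewrite big1 ?addr0// => z1 _.
  by rewrite -mulr_sumr flow_op_antisym// wt_last !(mulr0, mul0r) oppr0 mulr0.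
have S0 : S b = 0.
  rewrite (is_derive_0_is_cst b 0 dS) /S big1// => z1 _; rewrite big1// => z2 _.
  by rewrite H0 ?mul0r// -ltnS.
have p0 (z1 z2 : 'I_n.+1) : 0 <= H b z1 z2 * H b z1 z2 * W z1 * W z2.
  have w1 := ltW (wt0 (ltn_ord z1 : z1 <= n)%N).
  have w2 := ltW (wt0 (ltn_ord z2 : z2 <= n)%N).
  by apply: (mulr_ge0 (mulr_ge0 _ w1) w2); rewrite -expr2 sqr_ge0.
have y1' : (y1 < n.+1)%N by []; have y2' : (y2 < n.+1)%N by [].
have /(_ (Ordinal y1') isT) /= e1 :=
  psumr_eq0P (fun (z1 : 'I_n.+1) _ => sumr_ge0 _ (fun z2 _ => p0 z1 z2)) S0.
have /(_ (Ordinal y2') isT) /= := psumr_eq0P (fun z2 _ => p0 (Ordinal y1') z2) e1.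
move/eqP; rewrite mulf_eq0 (gt_eqF (wt0 h2)) orbF mulf_eq0 (gt_eqF (wt0 h1)) orbF.
by rewrite mulf_eq0 orbb => /eqP.
Qed.

End TwoVariableFlow.

(** * The kernel of the matrix exponential: orthogonality and duality *)

Section FiniteKernel.
Context {R : realType}.
Variables (n : nat) (c : R).
Hypothesis c0 : 0 < c.
Local Notation W := (wt n%:R (-1) c).
Local Notation A := (flow_op n%:R (-1) c).
Implicit Types (x y : nat) (b : R).

Let c_neq0 : c != 0. Proof. exact: lt0r_neq0. Qed.

Let lamE : n%:R + -1 * n%:R = 0 :> R. Proof. by rewrite mulN1r subrr. Qed.

Lemma fin_rate_gt0 m : (m < n)%N -> 0 < n%:R + -1 * m%:R :> R.
Proof. by move=> mn; rewrite mulN1r subr_gt0 ltr_nat. Qed.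

Lemma fin_wt_gt0 y : (y <= n)%N -> 0 < W y.
Proof.
move=> yn; apply: wt_gt0 => // m my; apply: fin_rate_gt0; exact: leq_trans my yn.
Qed.

Definition fin_mx : 'M[R]_n.+1 := \matrix_(y, z) A (fun u => (u == z)%:R) y.

Let pick_sum (v : nat -> R) a : (a <= n)%N -> \sum_(z < n.+1) (a == z)%:R * v z = v a.
Proof.
move=> an; have a' : (a < n.+1)%N by [].
rewrite (bigD1 (Ordinal a'))//= eqxx mul1r big1 ?addr0// => z.
by rewrite -val_eqE eq_sym /= => /negbTE ->; rewrite mul0r.
Qed.

(** At [y = n] the value [v n.+1], unseen by the matrix, has coefficient 0 in [flow_op]. *)
Lemma fin_mx_sum (v : nat -> R) (y : 'I_n.+1) : \sum_z fin_mx y z * v z = A v y.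
Proof.
transitivity (- (n%:R + -1 * y%:R) * \sum_(z < n.+1) (y.+1 == z)%:R * v z +
    c * y%:R * \sum_(z < n.+1) (y.-1 == z)%:R * v z).
  rewrite !mulr_sumr -big_split; apply: eq_bigr => z _ /=.
  by rewrite mxE /flow_op; ring.
have yn : (y <= n)%N by rewrite -ltnS.
rewrite (pick_sum _ (leq_trans (leq_pred _) yn)) /flow_op; congr (_ + _).
have [->|ne] := eqVneq (y : nat) n; first by rewrite lamE oppr0 !mul0r.
by rewrite pick_sum// ltn_neqAle ne.
Qed.

(** The evolved delta function at [x], divided by [W x]; a column of the exponential is an evolved
    state, hence the order [y], [x]. Extension by 0 gives a function on [nat], as [flow_op]
    expects. *)
Definition fin_ker b x y : R :=
  if (x <= n)%N && (y <= n)%N then rexpm fin_mx b (inord y) (inord x) / W x else 0.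

Lemma fin_ker_derive b x y : (y <= n)%N ->
  is_derive b 1 (fun s => fin_ker s x y) (A (fin_ker b x) y).
Proof.
move=> yn; have [xn|xn] := leqP x n; last first.
  rewrite (_ : (fun s => fin_ker s x y) = fun=> 0); last first.
    by apply/funext => s; rewrite /fin_ker leqNgt xn.
  rewrite /flow_op /fin_ker leqNgt xn /= !mulr0 addr0; exact: is_derive1_cst.
have := is_derive1_mul (rexpm_derive fin_mx b (inord y) (inord x))
  (is_derive1_cst (W x)^-1 b).
rewrite (_ : (fun s => rexpm _ _ _ _ * _) = (fun s => fin_ker s x y)); last first.
  by apply/funext => s; rewrite /fin_ker xn yn.
move=> h; apply: is_derive_eq h _; rewrite mulr0 addr0 mulr_suml.
rewrite -[y in RHS](@inordK n)// -fin_mx_sum; apply: eq_bigr => z _.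
by rewrite /fin_ker xn -ltnS ltn_ord /= inord_val mulrA.
Qed.

Lemma fin_ker0 x y : (x <= n)%N -> (y <= n)%N ->
  fin_ker 0 x y = (x == y)%:R / W x.
Proof.
move=> xn yn; rewrite /fin_ker xn yn rexpm0 -val_eqE /= !inordK//.
by rewrite eq_sym.
Qed.

Lemma fin_ker_orth b x x' : (x <= n)%N -> (x' <= n)%N ->
  \sum_(y < n.+1) fin_ker b x y * fin_ker b x' y * W y = (x == x')%:R / W x.
Proof.
move=> xn x'n.
have dE s := energy_derive lamE c_neq0 (@fin_ker_derive s x) (@fin_ker_derive s x').
rewrite (is_derive_0_is_cst b 0 dE).
transitivity (\sum_(y < n.+1) (x == y)%:R * (fin_ker 0 x' y)).
  apply: eq_bigr => y _; have yn : (y <= n)%N by rewrite -ltnS.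
  rewrite (fin_ker0 xn yn); have [<-|_] := eqVneq x y; last by rewrite !mul0r.
  have w := lt0r_neq0 (fin_wt_gt0 xn).
  by rewrite mulrAC mul1r mulVf ?mul1r.
rewrite pick_sum// fin_ker0//; have [->|] := eqVneq x' x => //.
by rewrite !mul0r.
Qed.

(** For square matrices a right inverse is a left inverse. *)
Lemma fin_ker_orth_col b (y y' : 'I_n.+1) :
  \sum_(x < n.+1) fin_ker b x y * W x * (fin_ker b x y' * W y') = (y == y')%:R.
Proof.
pose P : 'M[R]_n.+1 := \matrix_(x, y) (fin_ker b x y * W y).
pose Q : 'M[R]_n.+1 := \matrix_(y, x) (fin_ker b x y * W x).
have PQ : P *m Q = 1%:M.
  apply/matrixP => x x'; rewrite !mxE.
  have xn : (x <= n)%N by rewrite -ltnS.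
  have xn' : (x' <= n)%N by rewrite -ltnS.
  transitivity ((\sum_(y < n.+1) fin_ker b x y * fin_ker b x' y * W y) * W x').
    by rewrite mulr_suml; apply: eq_bigr => z _; rewrite !mxE; ring.
  rewrite fin_ker_orth// -val_eqE; have [->|_] := eqVneq (x : nat) x'.
    by rewrite mul1r mulVf// lt0r_neq0// fin_wt_gt0.
  by rewrite !mul0r.
have /matrixP/(_ y y') := mulmx1C PQ; rewrite !mxE => <-.
by apply: eq_bigr => x _; rewrite !mxE.
Qed.

(** As a function of time and [(y1, y2)], the difference of the sides solves the two-variable flow:
    the left one by commutation, the right one as a linear combination of solutions. At time 0 it
    vanishes by [ker_two_sites] at [tau = 0]. *)
Lemma fin_ker_two_sites b x1 x2 y1 y2 :
  (x1 <= n)%N -> (x2 <= n)%N -> (y1 <= n)%N -> (y2 <= n)%N ->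
  pair_gen n%:R (-1) (fun z1 z2 => fin_ker b x1 z1 * fin_ker b x2 z2) y1 y2 =
  pair_gen n%:R (-1) (fun z1 z2 => fin_ker b z1 y1 * fin_ker b z2 y2) x1 x2.
Proof.
move=> x1n x2n y1n y2n.
pose T a1 a2 s z1 z2 := fin_ker s a1 z1 * fin_ker s a2 z2.
have dT a1 a2 : flow2 n%:R (-1) c n (T a1 a2).
  move=> s z1 z2 h1 h2.
  have := is_derive1_mul (@fin_ker_derive s a1 z1 h1) (@fin_ker_derive s a2 z2 h2).
  by move=> h; apply: is_derive_eq h _; rewrite /flow_op2 /flow_op /T; ring.
pose q1 := x1%:R * (n%:R + -1 * x2%:R) : R.
pose q2 := x2%:R * (n%:R + -1 * x1%:R) : R.
have h1 := flow2_lin (- q1) (dT x1.-1 x2.+1) (flow2_gen lamE (dT x1 x2)).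
have h2 := flow2_lin (q1 + q2) (dT x1 x2) (flow2_lin (- q2) (dT x1.+1 x2.-1) h1).
(* Needed also for [a > n]: there the weight is 0 and so, by convention, is its inverse, in
   agreement with the default value of [fin_ker]. *)
have e0 a z : fin_ker 0 a z = ker n%:R (-1) 0 (c - (-1) * 0 ^+ 2) 1 a z.
  transitivity (flow_ker n%:R (-1) c (fun=> 0) (fun=> 1) 0 a z); last by [].
  rewrite flow_ker0//.
  have [an|an] := leqP a n.
    have [zn|zn] := leqP z n; first exact: fin_ker0.
    by rewrite /fin_ker an leqNgt zn /= ltn_eqF ?mul0r// (leq_ltn_trans an).
  rewrite /fin_ker leqNgt an /= /wt (_ : poch _ _ a = 0) ?mul0r ?invr0 ?mulr0//.
  rewrite /poch; apply/eqP/prodf_eq0.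
  by exists (Ordinal an) => //=; rewrite lamE.
have h0 := flow2_eq0 lamE c_neq0 fin_wt_gt0 h2 _ b y1n y2n.
apply/eqP; rewrite -subr_eq0; apply/eqP; rewrite -[RHS]h0 => [|z1 z2 z1n z2n].
  by rewrite /T /pair_gen /q1 /q2; ring.
have nz m : (m < x1)%N || (m < z1)%N || (m < x2)%N || (m < z2)%N ->
    n%:R + -1 * m%:R != 0 :> R.
  move=> h; apply/lt0r_neq0/fin_rate_gt0.
  by case/orP: h => [/orP[/orP[]|]|] /leq_trans; exact.
have := ker_two_sites 0 (c - (-1) * 0 ^+ 2) 1 nz.
rewrite -!e0 /T /pair_gen /q1 /q2 => h.
move/eqP: h; rewrite -subr_eq0 => /eqP h; apply: etrans _ h; ring.
Qed.

End FiniteKernel.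

(** * Unitarity, duality and Krawtchouk polynomials for SEP *)

Section SEPCase.
Context {R : realType}.
Variables (n : nat) (p : R).
Hypotheses (p0 : 0 < p) (p1 : p < 1).

Let c : R := (1 - p) / p.
Local Notation W := (wt n%:R (-1) c).
Local Notation E := (fin_ker n c).

Let p'0 : 0 < 1 - p. Proof. by rewrite subr_gt0. Qed.

Let c0 : 0 < c. Proof. exact: divr_gt0. Qed.

Let fact0 m : (m`!%:R : R) != 0.
Proof. by rewrite pnatr_eq0 -lt0n fact_gt0. Qed.

Let poch_bin m : poch n%:R (-1) m = m`!%:R * 'C(n, m)%:R :> R.
Proof.
have := @rising_opp R n m; rewrite (_ : rising _ m = (-1) ^+ m * poch n%:R (-1) m).
  by apply: mulfI; rewrite expf_neq0// oppr_eq0 oner_eq0.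
rewrite /rising /poch; elim: m => [|m IH]; first by rewrite !big_ord0 mul1r.
by rewrite !big_ord_recr /= IH exprS; ring.
Qed.

Let wtE x : W x = 'C(n, x)%:R * (p / (1 - p)) ^+ x.
Proof.
rewrite /wt poch_bin /c -[p / (1 - p)]invf_div exprVn.
have := lt0r_neq0 (exprn_gt0 x c0); rewrite -/c; move: (c ^+ x) (fact0 x) => v.
by move: (x`!%:R) => f f0 v0; field; rewrite f0 v0.
Qed.

Let K : R := (1 - p) ^+ n.

Let K0 : K != 0. Proof. by rewrite expf_neq0// lt0r_neq0. Qed.

Let wE (x : 'I_n.+1) : sep_w p x = K * W x.
Proof. by rewrite /sep_w wtE mulrC. Qed.

Let W0 (x : 'I_n.+1) : 0 < W x.
Proof. by apply: fin_wt_gt0 => //; rewrite -ltnS. Qed.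

Let DchE (x y : 'I_n.+1) : sep_Dch p x y = ((W x)^-1)%:C * (x == y)%:R.
Proof.
rewrite /sep_Dch; have [<-|_] := eqVneq x y; last by rewrite !mulr0.
congr (_%:C * _); have xn : (x <= n)%N by rewrite -ltnS.
have b0 : ('C(n, x)%:R : R) != 0 by rewrite pnatr_eq0 -lt0n bin_gt0.
rewrite wtE -(bin_fact xn) !natrM -[(1 - p) / p]invf_div exprVn.
have := lt0r_neq0 (exprn_gt0 x (divr_gt0 p0 p'0)).
move: ((p / (1 - p)) ^+ x) (fact0 x) (fact0 (n - x)) b0 => v.
move: (x`!%:R) ((n - x)`!%:R) ('C(n, x)%:R) => f g b f0 g0 b0 v0.
by field; rewrite f0 g0 b0 v0.
Qed.

Let op_mxE : op_mx (@sep_A R n p) = map_mx (real_complex R) (fin_mx n c).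
Proof.
apply/matrixP => x y; rewrite !mxE /sep_A /sep_Jp /sep_Jm /flow_op.
have xn : (x <= n)%N by rewrite -ltnS.
have up : (n%:R - x%:R) * (if (x < n)%N then (inord x.+1 == y)%:R else 0) =
    ((n%:R + -1 * x%:R) * (x.+1 == y)%:R)%:C :> R[i].
  rewrite mulN1r rmorphM rmorphB !rmorph_nat.
  have [xn'|] := ltnP x n; first by rewrite -val_eqE /= inordK.
  by move=> nx; rewrite (_ : (x : nat) = n) ?subrr ?mul0r//; apply/eqP; rewrite eqn_leq xn.
have dn : x%:R * (if (0 < x)%N then (inord x.-1 == y)%:R else 0) =
    (x%:R * (x.-1 == y)%:R)%:C :> R[i].
  rewrite rmorphM !rmorph_nat; have [->|x0] := posnP x; first by rewrite !mul0r.
  by rewrite -val_eqE /= inordK// (leq_ltn_trans (leq_pred _) (ltn_ord x)).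
by rewrite up dn -rmorphN -rmorphM -rmorphD /=; congr (_%:C); rewrite -/c; ring.
Qed.

Let th (a : R) (x : nat) : R[i] := cexp ('i * (a * (x%:R + - (n%:R / 2)))%:C).

Let thth a x : th a x * conjc (th a x) = 1. Proof. exact: cexp_i_unit. Qed.

Let SE (a b : R) f (y : 'I_n.+1) :
  sep_S p a b f y = \sum_(x < n.+1) (E b x y * W x)%:C * (th a x * f x).
Proof.
rewrite /sep_S /exp_mx mxE; apply: eq_bigr => x _; rewrite op_mxE rexpm_mxexp !mxE.
congr (_%:C * _).
  have w := lt0r_neq0 (W0 x).
  have xn : (x <= n)%N by rewrite -ltnS.
  have yn : (y <= n)%N by rewrite -ltnS.
  by rewrite /fin_ker xn yn /= !inord_val mulfVK.
rewrite /exp_idiag /th /sep_J0 eqxx mulr1 rmorphM mulrA.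
by congr (cexp (_ * _) * _).
Qed.

Let conj_realM (t : R) (v : R[i]) : conjc (t%:C * v) = t%:C * conjc v.
Proof.
by case: v => v v'; apply/eqP; rewrite eq_complex /=; apply/andP; split; apply/eqP; ring.
Qed.

Let orthE b (x x' : 'I_n.+1) :
  \sum_(y < n.+1) E b x y * E b x' y * W y = (x == x')%:R / W x.
Proof. by rewrite fin_ker_orth// -ltnS. Qed.

Lemma sep_unitary (a b : R) :
  unitary_on setT (finner (sep_w (n := n) p)) (sep_S p a b).
Proof.
split => //.
- move=> s f g _ _; apply/funext => y; rewrite !SE mulr_sumr -big_split.
  by apply: eq_bigr => x _ /=; ring.
- move=> f g _ _; rewrite /finner.
  pose F (x x' : 'I_n.+1) := (K * W x * W x')%:C * (th a x * f x) * conjc (th a x' * g x').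
  transitivity (\sum_(x < n.+1) \sum_(x' < n.+1) \sum_(y < n.+1)
      F x x' * (E b x y * E b x' y * W y)%:C).
    transitivity (\sum_(y < n.+1) \sum_(x < n.+1) \sum_(x' < n.+1)
        F x x' * (E b x y * E b x' y * W y)%:C).
      apply: eq_bigr => y _.
      have conj_sum : conjc (sep_S p a b g y) =
          \sum_(x < n.+1) (E b x y * W x)%:C * conjc (th a x * g x).
        rewrite SE; apply: etrans (rmorph_sum _ _ _ _) _.
        by apply: eq_bigr => x _; exact: conj_realM.
      rewrite conj_sum SE !mulr_suml; apply: eq_bigr => x _.
      rewrite mulr_sumr mulr_suml; apply: eq_bigr => x' _.
      by rewrite wE /F !rmorphM /=; ring.
    by rewrite exchange_big; apply: eq_bigr => x _; exact: exchange_big.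
  apply: eq_bigr => x _; rewrite (bigD1 x)//= [X in _ + X]big1 ?addr0 => [|x' xx'].
    rewrite -mulr_sumr -rmorph_sum orthE eqxx mul1r wE /F.
    have -> : conjc (th a x * g x) = conjc (th a x) * conjc (g x) := rmorphM _ _ _.
    have e : K * W x * W x * (W x)^-1 = K * W x by rewrite mulfK// lt0r_neq0.
    transitivity ((th a x * conjc (th a x)) * (f x * conjc (g x)) * (K * W x * W x * (W x)^-1)%:C).
      move: (K * W x * W x) (W x)^-1 (conjc (th a x)) (conjc (g x)) => u v t t'.
      by rewrite [(u * v)%:C]rmorphM; ring.
    by rewrite e thth mul1r.
  by rewrite -mulr_sumr -rmorph_sum orthE eq_sym (negbTE xx') mul0r mulr0.
(* The preimage comes from the transposed kernel and the conjugate phase; column orthogonality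
   verifies it. *)
- move=> g _; exists (fun x => conjc (th a x) * \sum_(y < n.+1) (E b x y * W y)%:C * g y) => //.
  apply/funext => y'; rewrite SE.
  transitivity (\sum_(y < n.+1) (\sum_(x < n.+1) E b x y' * W x * (E b x y * W y))%:C * g y).
    transitivity (\sum_(x < n.+1) \sum_(y < n.+1) (E b x y' * W x * (E b x y * W y))%:C * g y).
      apply: eq_bigr => x _; rewrite (mulrA (th a x)) thth mul1r mulr_sumr.
      by apply: eq_bigr => y _; rewrite mulrA -rmorphM.
    by rewrite exchange_big; apply: eq_bigr => y _; rewrite rmorph_sum mulr_suml.
  rewrite (bigD1 y')//= [X in _ + X]big1 ?addr0 => [|y yy'].
    by rewrite fin_ker_orth_col// eqxx mul1r.
  by rewrite fin_ker_orth_col// eq_sym (negbTE yy') mul0r.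
Qed.

Let dE (a b : R) (x y : 'I_n.+1) :
  sep_S p a b (sep_Dch p x) y = th a x * (E b x y)%:C.
Proof.
rewrite SE (bigD1 x)//= big1 ?addr0 => [|x' xx'].
  rewrite DchE eqxx mulr1 mulrCA -rmorphM; congr (_ * _%:C).
  by rewrite mulfK// lt0r_neq0.
by rewrite DchE eq_sym (negbTE xx') !mulr0.
Qed.

Lemma sep_duality (a b : R) :
  sep_self_duality (fun x y : 'I_n.+1 => sep_S p a b (sep_Dch p x) y).
Proof.
apply: single_site_of_two_sites => a1 a2 b1 b2.
have ord_le (i : 'I_n.+1) : (i <= n)%N by rewrite -ltnS.
have decE (i : 'I_n.+1) : (inord i.-1 : 'I_n.+1) = i.-1 :> nat.
  by rewrite inordK// (leq_ltn_trans (leq_pred _) (ltn_ord i)).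
have last_site (j : 'I_n.+1) : (n <= j)%N -> n%:R - j%:R = 0 :> R.
  by move=> nj; rewrite (_ : (j : nat) = n) ?subrr//; apply/eqP; rewrite eqn_leq ord_le.
pose D (x y : nat) := th a x * (E b x y)%:C.
have th1 x : th a x.+1 = cexp ('i * a%:C) * th a x.
  by rewrite /th -cexp_iD -natr1; congr (cexp (_ * _%:C)); ring.
have thp x x' : (x%:R : R)%:C * (th a x.-1 * th a x'.+1) = x%:R%:C * (th a x * th a x').
  by case: x => [|x]; rewrite ?mul0r//= !th1; ring.
(* At [j = n] the rate is 0, so the default value of [inord j.+1] does not matter; otherwise the
   phases recombine by [thp]. *)
have x_jump (i j : 'I_n.+1) (u v : nat) : (i%:R * (n%:R - j%:R))%:C *
    (D (inord i.-1 : 'I_n.+1) u * D (inord j.+1 : 'I_n.+1) v - D i u * D j v) =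
    th a i * th a j *
      (i%:R * (n%:R - j%:R) * (E b i.-1 u * E b j.+1 v - E b i u * E b j v))%:C.
  rewrite decE; have [jn|/last_site->] := ltnP j n; last by rewrite mulr0 !mul0r mulr0.
  rewrite inordK// /D; move: (n%:R - j%:R) (thp i j) => q.
  rewrite !rmorphM rmorphB !rmorphM.
  move: (th a i.-1) (th a j.+1) (th a i) (th a j) => t1 t2 t3 t4 e.
  transitivity (q%:C * (E b i.-1 u)%:C * (E b j.+1 v)%:C * (i%:R%:C * (t1 * t2)) -
    q%:C * (E b i u)%:C * (E b j v)%:C * (i%:R%:C * (t3 * t4))); first by ring.
  by rewrite e; ring.
have y_jump (i j : 'I_n.+1) (u v : nat) : (i%:R * (n%:R - j%:R))%:C *
    (D u (inord i.-1 : 'I_n.+1) * D v (inord j.+1 : 'I_n.+1) - D u i * D v j) =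
    th a u * th a v *
      (i%:R * (n%:R - j%:R) * (E b u i.-1 * E b v j.+1 - E b u i * E b v j))%:C.
  rewrite decE; have [jn|/last_site->] := ltnP j n; last by rewrite mulr0 !mul0r mulr0.
  rewrite inordK// /D; move: (n%:R - j%:R) => q.
  by rewrite !rmorphM rmorphB !rmorphM; ring.
rewrite !dE -!/(D _ _) (x_jump a1 a2 b1 b2) (y_jump b1 b2 a1 a2).
rewrite (mulrC (D (inord a1.+1 : 'I_n.+1) b1)) (mulrC (D a1 (inord b1.+1 : 'I_n.+1))).
rewrite (mulrC (D a1 b1)) (x_jump a2 a1 b2 b1) (y_jump b2 b1 a2 a1).
rewrite (mulrC (th a a2)) -!mulrDr -!rmorphD; congr (_ * _%:C).
have := fin_ker_two_sites c0 b (ord_le a1) (ord_le a2) (ord_le b1) (ord_le b2).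
rewrite /pair_gen !mulN1r => h; symmetry.
by apply: etrans (etrans _ h) _; ring.
Qed.

Let q : R := Num.sqrt (p / (1 - p)).

Let q0 : 0 < q. Proof. by rewrite sqrtr_gt0 divr_gt0. Qed.

Let q2 : q ^+ 2 = p / (1 - p). Proof. by rewrite sqr_sqrtr// divr_ge0// ltW. Qed.

Let cq : c = (q ^+ 2)^-1. Proof. by rewrite q2 invf_div. Qed.

(** The pole at [s / q = pi / 2] confines the derivative lemmas to [[0, b1]]; since
    [b1 / q = atan q], this interval ends before the pole, and [tau b1 = 1]. *)
Let tau (s : R) := tan (s / q) / q.
Let nb (s : R) := cos (s / q) ^+ n.
Let b1 : R := q * atan q.

Let scaled (f : R -> R) (s a : R) : is_derive (s / q) 1 f a ->
  is_derive s 1 (fun t => f (t / q)) (a * q^-1).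
Proof.
move=> df; have h := is_derive1_mul (is_derive1_id s) (is_derive1_cst q^-1 s).
have hh := @is_derive1_compose R f (fun t => t * q^-1) s _ _ df h.
by apply: is_derive_eq hh _; rewrite mulr0 addr0 mul1r.
Qed.

Let cos_neq0 (s : R) : 0 <= s <= b1 -> cos (s / q) != 0.
Proof.
move=> /andP[s0 s1]; apply/lt0r_neq0/cos_gt0_pihalf/andP; split.
  by apply: lt_le_trans (divr_ge0 s0 (ltW q0)); rewrite oppr_lt0 divr_gt0 ?pi_gt0.
by apply: le_lt_trans (atan_ltpi2 q); rewrite ler_pdivrMr// mulrC.
Qed.

Let dtau (s : R) : 0 <= s <= b1 -> is_derive s 1 tau (c - -1 * tau s ^+ 2).
Proof.
move=> /cos_neq0 cs.
have h := is_derive1_mul (scaled (is_derive_tan cs)) (is_derive1_cst q^-1 s).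
apply: is_derive_eq h _; rewrite (cos2_tan2 cs) cq /tau; field; exact: lt0r_neq0.
Qed.

Let dnb (s : R) : 0 <= s <= b1 -> is_derive s 1 nb (- n%:R * tau s * nb s).
Proof.
move=> /cos_neq0 cs; have h := is_derive1_exprn n (scaled (is_derive_cos (s / q))).
apply: is_derive_eq h _; rewrite /nb /tau /tan; case: (n) => [|m]; first by ring.
rewrite exprS /=; move: (_ ^+ m) => v; field; rewrite cs lt0r_neq0//.
Qed.

Let b1_ge0 : 0 <= b1.
Proof. by rewrite mulr_ge0 ?(ltW q0)// -[leLHS]atan0 le_atan// ltW. Qed.

Let b1E : b1 / q = atan q. Proof. by rewrite /b1 mulrAC mulfV ?mul1r// lt0r_neq0. Qed.

Let tau_b1 : tau b1 = 1. Proof. by rewrite /tau b1E atanK mulfV// lt0r_neq0. Qed.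

(** [cos (atan q) ^ 2 = 1 / (1 + q ^ 2) = 1 - p]. *)
Let nb_b1 : nb b1 = (1 - p) `^ (n%:R / 2).
Proof.
rewrite /nb b1E cos_atan q2 (_ : 1 + p / (1 - p) = (1 - p)^-1); last first.
  by field; exact: lt0r_neq0.
by rewrite sqrtrV ?(ltW p'0)// invrK mulrC powRrM powR12_sqrt ?(ltW p'0)// powR_mulrn// sqrtr_ge0.
Qed.

(* Both sides solve the same linear equation, and the energy of their
   difference is constant in time. *)
Let fin_ker_flow (x y : 'I_n.+1) : E b1 x y = flow_ker n%:R (-1) c tau nb b1 x y.
Proof.
pose g s z := E s x z + - flow_ker n%:R (-1) c tau nb s x z.
have xn : (x <= n)%N by rewrite -ltnS.
have dg (s : R) : 0 <= s <= b1 -> is_derive s 1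
    (fun t => \sum_(z < n.+1) g t z * g t z * W z) 0.
  move=> hs.
  have dz z : (z <= n)%N -> is_derive s 1 (fun t => g t z)
      (flow_op n%:R (-1) c (g s) z).
    move=> zn.
    have nz m : (m < x)%N || (m < z)%N -> n%:R + -1 * m%:R != 0 :> R.
      by move=> h; apply/lt0r_neq0/fin_rate_gt0; case/orP: h => /leq_trans; exact.
    have h := is_derive1_add (@fin_ker_derive R n c s x z zn)
      (is_derive1_opp (flow_ker_derive nz (dtau hs) (dnb hs))).
    by apply: is_derive_eq h _; rewrite /flow_op /g; ring.
  by apply: (energy_derive _ (lt0r_neq0 c0)) => //; rewrite mulN1r subrr.
(* The explicit kernel is differentiated only on [[0, b1]], so constancy of the energy is drawn from
   the mean value inequality with zero majorant. *)
have := ler_derive_bound b1_ge0 dg (fun s _ => is_derive1_cst 0 s)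
  (fun s _ => eq_ind_r (fun t => t <= 0) (lexx 0) (normr0 R)).
rewrite subrr normr_le0 [X in _ - X]big1 ?subr0 => [/eqP h|z _]; last first.
  have zn : (z <= n)%N by rewrite -ltnS.
  rewrite /g (fin_ker0 _ xn zn) flow_ker0 ?subrr ?mul0r//.
    by rewrite /tau mul0r tan0 mul0r.
  by rewrite /nb mul0r cos0 expr1n.
have yn : (y <= n)%N by rewrite -ltnS.
by apply/eqP; rewrite -subr_eq0; apply/eqP/(energy_eq0 (fin_wt_gt0 c0) h yn).
Qed.

(** [rising (- n)] and [poch n (-1)] differ by [(-1) ^ m], which accounts for the sign of [- rho];
    here [rho = c + 1 = p^-1]. *)
Let tE x y m : hyp_term [:: - x%:R; - y%:R] [:: - n%:R] p^-1 m =
  'C(x, m)%:R * 'C(y, m)%:R * ker_coef n%:R (-1) m * (- p^-1) ^+ m.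
Proof.
rewrite /hyp_term rising_prod big_cons big_nil mulr1 rising_opp /ker_coef poch_bin.
rewrite (exprNn p^-1) !invfM invr_sign.
have := fact0 m; move: (m`!%:R) ('C(n, m)%:R^-1) => f d f0.
by field.
Qed.

Lemma sep_krawtchouk (x y : 'I_n.+1) :
  sep_S p pi (Num.sqrt (p / (1 - p)) * atan (Num.sqrt (p / (1 - p))))
    (sep_Dch p x) y = sep_phase n p * (krawtchouk n p x y)%:C.
Proof.
rewrite dE -/q -/b1 fin_ker_flow /flow_ker tau_b1 nb_b1 ker_tau1_hypergeometric /th cexp_i_pi_nat.
rewrite /sep_phase mulrAC -rmorphM mulrC -[RHS]mulrA -rmorphM.
(* The shift of [J0] by [- n / 2] selects the branch [exp(- i pi j)]. *)
rewrite (_ : 'i * (pi * - (n%:R / 2))%:C = - 'i * (pi * (n%:R / 2))%:C); last first.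
  by rewrite mulrN rmorphN mulrN mulNr.
congr (_ * _%:C).
rewrite -[_ * _ * \sum_(_ < _) _]mulrA signr_cancel; congr (_ * _).
apply: eq_bigr => m _; rewrite tE (_ : c - -1 * 1 ^+ 2 = p^-1)//.
by rewrite /c; field; exact: lt0r_neq0.
Qed.

Lemma sep_case :
  (forall a b : R,
        let d := fun x y : 'I_n.+1 => sep_S p a b (sep_Dch p x) y in
        [/\ unitary_on setT (finner (sep_w (n := n) p)) (sep_S p a b),
            sep_self_duality d,
            forall x x' : 'I_n.+1, x <> x' ->
              finner (sep_w p) (d x) (d x') = 0
          & forall x : 'I_n.+1, finner (sep_w p) (d x) (d x) =
              finner (sep_w p) (sep_Dch p x) (sep_Dch p x)]) /\
    (forall x y : 'I_n.+1,
        sep_S p pi (Num.sqrt (p / (1 - p)) * atan (Num.sqrt (p / (1 - p))))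
          (sep_Dch p x) y =
        sep_phase n p * (krawtchouk n p x y)%:C).
Proof.
split; last exact: sep_krawtchouk.
move=> a b d; have U := sep_unitary a b; have [_ _ U3 _] := U.
split => //.
- exact: sep_duality.
- move=> x x' xx'; rewrite /d -[LHS]/(finner _ (sep_S p a b _) (sep_S p a b _)) U3//.
  apply: big1 => y _; rewrite !DchE; case: (x =P y) => [e|_]; last by rewrite mulr0 !mul0r.
  by case: (x' =P y) => [e'|_]; [case: xx'; rewrite e e'|rewrite !mulr0 rmorph0 mulr0 mul0r].
- by move=> x; exact: U3.
Qed.

End SEPCase.

Theorem theorem3p1 (R : realType) :
  (forall k p : R, 0 < k -> 0 < p < 1 ->
    [/\ exp_well_defined (sip_gf k) (sip_A k p),
        forall a b : R,
        let d := fun x y : nat => sip_S k p a b (sip_Dch k p x) y in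
        [/\ extends_to_unitary (sip_w k p) (sip_S k p a b),
            sip_self_duality k d,
            forall x : nat, L2 (sip_w k p) (d x),
            forall x x' : nat, x <> x' -> inner (sip_w k p) (d x) (d x') = 0
          & forall x : nat, inner (sip_w k p) (d x) (d x) =
              inner (sip_w k p) (sip_Dch k p x) (sip_Dch k p x)]
      & forall x y : nat,
          sip_S k p pi (Num.sqrt p * arctanh (Num.sqrt p)) (sip_Dch k p x) y =
          sip_phase k p * (meixner k p x y)%:C])
  /\
  (* n = 2j *)
  (forall (n : nat) (p : R), (0 < n)%N -> 0 < p < 1 ->
    (forall a b : R,
        let d := fun x y : 'I_n.+1 => sep_S p a b (sep_Dch p x) y in
        [/\ unitary_on setT (finner (sep_w (n := n) p)) (sep_S p a b),
            sep_self_duality d,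
            forall x x' : 'I_n.+1, x <> x' ->
              finner (sep_w p) (d x) (d x') = 0
          & forall x : 'I_n.+1, finner (sep_w p) (d x) (d x) =
              finner (sep_w p) (sep_Dch p x) (sep_Dch p x)]) /\
    (forall x y : 'I_n.+1,
        sep_S p pi (Num.sqrt (p / (1 - p)) * atan (Num.sqrt (p / (1 - p))))
          (sep_Dch p x) y =
        sep_phase n p * (krawtchouk n p x y)%:C))
  /\
  (forall p : R, 0 < p ->
    [/\ exp_well_defined irw_gf (irw_A p),
        forall a b : R,
        let d := fun x y : nat => irw_S p a b (irw_Dch p x) y in
        [/\ extends_to_unitary (irw_w p) (irw_S p a b),
            irw_self_duality d,
            forall x : nat, L2 (irw_w p) (d x),
            forall x x' : nat, x <> x' -> inner (irw_w p) (d x) (d x') = 0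
          & forall x : nat, inner (irw_w p) (d x) (d x) =
              inner (irw_w p) (irw_Dch p x) (irw_Dch p x)]
      & forall x y : nat,
          irw_S p pi 1 (irw_Dch p x) y =
          (expR (- p / 2) * charlier p x y)%:C]).
Proof.
split; first by move=> k p k0 p01; exact: sip_case.
split; last by move=> p p0; exact: irw_case.
by move=> n p _ /andP[p0 p1]; exact: sep_case.
Qed.
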